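(* There is an element $P\in R_0[[\epsilon]]$ such that the ideal $\mathcal I_P\subset R[[\epsilon]]$ is invariant under all the Toda derivations $\mathcal D_{T_k}$, $k\ge 1$. Thus the $\mathcal D_{T_k}$ induce derivations $\mathbf D_{T_k}$ of $R_0[[\epsilon]]\cong R[[\epsilon]]/\mathcal I_P$. Suitable linear combinations of the $\mathbf D_{T_k}$ over $\mathbb C((\epsilon))$ are a deformation of the KdV hierarchy $K_1,K_2,\ldots$ with $K_1=w^{(3)}+w^{(1)}w^{(0)}$; that is, these linear combinations are mutually commuting elements $L_k\in R_0[[\epsilon]]$ which become the $K_k$ when $\epsilon$ is set equal to $0$.
   Context: **Rings.** $R=\mathbb C[v^{(0)},v^{(1)},\ldots;w^{(0)},w^{(1)},\ldots]$ and $R_0=\mathbb C[w^{(0)},w^{(1)},\ldots]\subset R$, with the $\mathbb C$-derivation $\partial v^{(k)}=v^{(k+1)}$, $\partial w^{(k)}=w^{(k+1)}$, extended to $R[[\epsilon]]$ by $\partial\epsilon=0$. Derivations of $R[[\epsilon]]$ and $R_0[[\epsilon]]$ are taken continuous in the $\epsilon$-topology, killing $\epsilon$, and commuting with $\partial$. A derivation $D$ of $R_0$ (or $R_0[[\epsilon]]$) commuting with $\partial$ is identified with the element $D(w^{(0)})$; every element arises this way, so $R_0$ and $R_0[[\epsilon]]$ become Lie algebras, and ''commute'' refers to this Lie bracket. **KdV hierarchy.** The element $K_1=w^{(3)}+w^{(1)}w^{(0)}$ of $R_0$ is called the KdV element. It belongs to a sequence $K_1,K_2,\ldots$ of mutually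 commuting elements of $R_0$ such that $K_{n+1}$ is not in the $\partial$-invariant subring generated by $K_1,\ldots,K_n$ and their derivatives; these $K_k$ are called the KdV hierarchy. **Toda hierarchy.** Let $S_1=\mathbb C[X_j,Y_j:j\in\mathbb Z]$. Let $C$ be the $\mathbb Z\times\mathbb Z$ matrix with $C_{i+1,i}=1$, $C_{i,i}=X_i$, $C_{i,i+1}=Y_i$ and all other entries $0$. For a matrix $E$ let $E^+$ be its strictly upper triangular part. Let $T_k=(P_k,Q_k)\in S_1\oplus S_1$, where $P_k$ is the $(0,0)$ entry and $Q_k$ the $(0,1)$ entry of $[C,(C^k)^+]$; in particular $T_1=(Y_{-1}-Y_0,\;Y_0(X_0-X_1))$. **Derivations $\mathcal D_{T_k}$.** Put $E_j=\exp(j\epsilon\partial):R[[\epsilon]]\to R[[\epsilon]]$. For $(A,B)\in S_1\oplus S_1$ let $\mathcal D'_{A,B}$ be the derivation of $R[[\epsilon]]$ such that $\mathcal D'_{A,B}(v^{(0)})$, respectively $\mathcal D'_{A,B}(w^{(0)})$, is obtained from $A$, respectively $B$, by substituting $X_j=E_j(v^{(0)})$, $Y_j=E_j(w^{(0)})$ for all $j$. Let $\Phi$ be the continuous $\mathbb C[[\epsilon]]$-algebra endomorphism of $R[[\epsilon]]$ commuting with $\partial$ with $\Phi(v^{(0)})=-2+\epsilon^2v^{(0)}$ and $\Phi(w^{(0)})=1+\epsilon^2w^{(0)}$; it is invertible over $R((\epsilon))$. Put $\mathcal D_{A,B}=\Phi\mathcal D'_{A,B}\Phi^{-1}$. For $(A,B)=T_k$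 this gives mutually commuting derivations $\mathcal D_{T_k}$ of $R[[\epsilon]]$. **Ideal.** For $P\in R_0[[\epsilon]]$, $\mathcal I_P$ is the closure of the ideal of $R[[\epsilon]]$ generated by $W=v^{(0)}-P$, $\partial W$, $\partial^2W,\ldots$. The natural map $R_0[[\epsilon]]\to R[[\epsilon]]/\mathcal I_P$ is an isomorphism.
   Formalization: At ε=0 the L_k become not K_k but (1/12)K_k with every w^(j) replaced by 12w^(j), so K_1 becomes w^(3)+12w^(1)w^(0): with Φ as given, every limit commutes with w^(3)+12w^(1)w^(0), which w^(3)+w^(1)w^(0) does not. *)

(* Defs.v *)
From HB Require Import structures.
From mathcomp Require Import all_boot all_order all_algebra.
From mathcomp Require Export finmap.
From mathcomp.multinomials Require Export monalg.
From mathcomp Require Export boolp classical_sets fsbigop reals.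
From mathcomp Require Export complex.

Set Implicit Arguments.
Unset Strict Implicit.
Unset Printing Implicit Defensive.

Import Order.TTheory GRing.Theory Num.Theory.
Local Open Scope ring_scope.

(* Formal power series A[[eps]]; a wrapper is needed because [nat -> A] already
   carries the pointwise product. *)
Record series (A : Type) := Series { scoef : nat -> A }.

HB.instance Definition _ (A : Type) := gen_eqMixin (series A).
HB.instance Definition _ (A : Type) := gen_choiceMixin (series A).

Lemma seriesP (A : Type) (F G : series A) : scoef F =1 scoef G -> F = G.
Proof. by case: F => F; case: G => G /= /funext ->. Qed.

Section SeriesRing.
Context (A : comNzRingType).
Implicit Types F G H : series A.

Definition sconst (a : A) : series A := Series (fun n => if n == 0%N then a else 0).
Definition eps : series A := Series (fun n => (n == 1%N)%:R).
Definition sopp F := Series (fun n => - scoef F n).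
Definition sadd F G := Series (fun n => scoef F n + scoef G n).
Definition smul F G :=
  Series (fun n => \sum_(i < n.+1) scoef F i * scoef G (n - i)%N).

Let saddA : associative sadd.
Proof. by move=> F G H; apply: seriesP => n /=; rewrite addrA. Qed.
Let saddC : commutative sadd.
Proof. by move=> F G; apply: seriesP => n /=; rewrite addrC. Qed.
Let sadd0 : left_id (sconst 0) sadd.
Proof. by move=> F; apply: seriesP => n /=; rewrite if_same add0r. Qed.
Let saddN : left_inverse (sconst 0) sopp sadd.
Proof. by move=> F; apply: seriesP => n /=; rewrite if_same addNr. Qed.

HB.instance Definition _ :=
  GRing.isZmodule.Build (series A) saddA saddC sadd0 saddN.

Let trunc N F : {poly A} := \poly_(i < N.+1) scoef F i.

Let coef_smul N n F G : (n <= N)%N ->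
  scoef (smul F G) n = (trunc N F * trunc N G)`_n.
Proof.
move=> nN; rewrite coefM; apply: eq_bigr => -[i /= lti] _.
by rewrite !coef_poly !ltnS (leq_trans _ nN)// (leq_trans (leq_subr _ _) nN).
Qed.

Let smulA : associative smul.
Proof.
move=> F G H; apply: seriesP => n.
transitivity ((trunc n F * trunc n G * trunc n H)`_n).
  rewrite -mulrA coefM; apply: eq_bigr => -[i /= lti] _.
  by rewrite -coef_smul ?leq_subr// coef_poly lti.
rewrite coefM; apply: eq_bigr => -[i /= lti] _.
by rewrite -coef_smul// coef_poly ltnS leq_subr.
Qed.
Let smulC : commutative smul.
Proof. by move=> F G; apply: seriesP => n; rewrite !(@coef_smul n)// mulrC. Qed.
Let smul1 : left_id (sconst 1) smul.
Proof.
move=> F; apply: seriesP => n /=.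
by rewrite big_ord_recl big1 ?addr0 ?subn0 ?mul1r// => i _; rewrite mul0r.
Qed.
Let smulDl : left_distributive smul sadd.
Proof.
move=> F G H; apply: seriesP => n /=; rewrite -big_split.
by apply: eq_bigr => i _; rewrite mulrDl.
Qed.
Let sone_neq0 : sconst 1 != sconst 0.
Proof.
by apply/eqP => /(congr1 (fun F => scoef F 0)) /= /eqP; rewrite oner_eq0.
Qed.

HB.instance Definition _ := GRing.Zmodule_isComNzRing.Build (series A)
  smulA smulC smul1 smulDl sone_neq0.

End SeriesRing.
Arguments eps {A}.

Definition smap (A B : Type) (u : A -> B) (F : series A) : series B :=
  Series (fun n => u (scoef F n)).

(* The continuous extension F |-> \sum_n eps^n u(F_n) of u : A -> B[[eps]]. *)
Definition sext (A : Type) (B : nmodType) (u : A -> series B) (F : series A) :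
    series B :=
  Series (fun n => \sum_(i < n.+1) scoef (u (scoef F i)) (n - i)%N).

(* Polynomials over K in the commuting indeterminates [pX i], i : I. *)
Notation pol K I := {malg K[{cmonom I}]}.

(* Locked, so that unification does not compute with monomials. *)
HB.lock Definition pX (K : fieldType) (I : choiceType) (i : I) : pol K I := << ucm i >>.
Arguments pX {K I} i.

Section Polynomials.
Context (K : fieldType) (I : choiceType).

Definition pC (c : K) : pol K I := << c *g (mone : {cmonom I}) >>.

(* Value of f when pX i is replaced by x i and scalars are mapped by c. *)
Definition psubst (B : comNzRingType) (c : K -> B) (x : I -> B) (f : pol K I) : B :=
  mmap c (fun m : {cmonom I} => \prod_(i <- finsupp m) x i ^+ m i) f.

Definition pderiv (i : I) (f : pol K I) : pol K I :=
  \sum_(m <- msupp f) << f@_m *+ m i *g divcm m (ucm i) >>.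

(* The derivation f |-> \sum_i iota(df/dX_i) d_i along iota, sending pX i to d i. *)
Definition pder (B : comNzRingType) (iota : pol K I -> B) (d : I -> B)
    (f : pol K I) : B :=
  \sum_(i \in [set: I]%classic) iota (pderiv i f) * d i.

End Polynomials.
Arguments pC {K I}.

(* R0 = K[w^(0), w^(1), ...], R = K[v^(0), ...; w^(0), ...] and
   S1 = K[X_j, Y_j : j in Z]; in the index types inl stands for v, X and inr for
   w, Y. *)
Definition vw_index : choiceType := (nat + nat)%type.
Definition XY_index : choiceType := (int + int)%type.
Notation R0 K := (pol K nat).
Notation Rvw K := (pol K vw_index).
Notation S1 K := (pol K XY_index).

Section TodaKdV.
Context (K : fieldType).

Definition var_v (k : nat) : Rvw K := pX (inl k : vw_index).
Definition var_w (k : nat) : Rvw K := pX (inr k : vw_index).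
Definition var_X (j : int) : S1 K := pX (inl j : XY_index).
Definition var_Y (j : int) : S1 K := pX (inr j : XY_index).

(* The derivation w^(k) |-> w^(k+1) of R0. *)
Definition d0 : R0 K -> R0 K := pder id (fun k => pX k.+1).
(* The derivation v^(k) |-> v^(k+1), w^(k) |-> w^(k+1) of R. *)
Definition dvw : Rvw K -> Rvw K := pder id (fun i : vw_index =>
  match i with inl k => var_v k.+1 | inr k => var_w k.+1 end).

Definition sd0 : series (R0 K) -> series (R0 K) := smap d0.
Definition sdvw : series (Rvw K) -> series (Rvw K) := smap dvw.

Definition sv : series (Rvw K) := sconst (var_v 0).
Definition sw : series (Rvw K) := sconst (var_w 0).

(* The derivation of R0, resp. R0[[eps]], commuting with d0 that sends w^(0) to L. *)
Definition evol0 (L : R0 K) : R0 K -> R0 K := pder id (fun k => iter k d0 L).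
Definition sevol0 (L : series (R0 K)) : series (R0 K) -> series (R0 K) :=
  sext (pder (@sconst _) (fun k => iter k sd0 L)).

(* The derivation of R[[eps]] commuting with dvw that sends v^(0) to a and w^(0)
   to b. *)
Definition sevol (a b : series (Rvw K)) : series (Rvw K) -> series (Rvw K) :=
  sext (pder (@sconst _) (fun i : vw_index =>
    match i with inl k => iter k sdvw a | inr k => iter k sdvw b end)).

Definition bracket0 (L M : R0 K) : R0 K := evol0 L M - evol0 M L.
Definition sbracket0 (L M : series (R0 K)) : series (R0 K) :=
  sevol0 L M - sevol0 M L.

(* The d0-stable subring generated by the elements satisfying G. *)
Definition d_subring_gen (G : R0 K -> Prop) (f : R0 K) : Prop :=
  forall S : {pred R0 K}, GRing.subring_closed S ->
    (forall g, g \in S -> d0 g \in S) -> (forall g, G g -> g \in S) -> f \in S.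

Definition KdV_element : R0 K := pX 3%N + pX 1%N * pX 0%N.

(* The hierarchy is L 1, L 2, ...; the value L 0 is irrelevant. *)
Definition KdV_hierarchy (L : nat -> R0 K) : Prop :=
  [/\ L 1%N = KdV_element,
      forall j k, (0 < j)%N -> (0 < k)%N -> bracket0 (L j) (L k) = 0
    & forall n, (0 < n)%N ->
        ~ d_subring_gen (fun g => exists2 k, (0 < k <= n)%N & g = L k) (L n.+1)].

(* Z x Z matrices; the sums below are finite for the band matrices used here. *)
Definition zmx := int -> int -> S1 K.
Definition zmx_mul (E F : zmx) : zmx :=
  fun i j => \sum_(l \in [set: int]%classic) E i l * F l j.
Definition zmx_id : zmx := fun i j => (i == j)%:R.
Definition zmx_upper (E : zmx) : zmx := fun i j => if i < j then E i j else 0.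
Definition zmx_comm (E F : zmx) : zmx :=
  fun i j => zmx_mul E F i j - zmx_mul F E i j.

Definition todaC : zmx := fun i j =>
  if i == j + 1 then 1
  else if i == j then var_X i
  else if j == i + 1 then var_Y i
  else 0.

Definition toda_bracket (k : nat) : zmx :=
  zmx_comm todaC (zmx_upper (iter k (zmx_mul todaC) zmx_id)).
Definition todaP (k : nat) : S1 K := toda_bracket k 0 0.
Definition todaQ (k : nat) : S1 K := toda_bracket k 0 1.

(* exp (j eps d) *)
Definition shiftE (j : int) (F : series (Rvw K)) : series (Rvw K) :=
  Series (fun n => \sum_(i < n.+1)
    (j%:~R ^+ i / (i`!)%:R : K) *: iter i dvw (scoef F (n - i)%N)).

Definition spC (c : K) : series (Rvw K) := sconst (pC c).

Definition toda_subst : S1 K -> series (Rvw K) :=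
  psubst spC (fun i : XY_index =>
    match i with inl j => shiftE j sv | inr j => shiftE j sw end).

Definition Dprime (A B : S1 K) : series (Rvw K) -> series (Rvw K) :=
  sevol (toda_subst A) (toda_subst B).

Definition Phi : series (Rvw K) -> series (Rvw K) :=
  sext (psubst spC (fun i : vw_index => match i with
    | inl k => iter k sdvw (- 2%:R + eps ^+ 2 * sv)
    | inr k => iter k sdvw (1 + eps ^+ 2 * sw)
    end)).

Definition derivation_Reps (D : series (Rvw K) -> series (Rvw K)) : Prop :=
  [/\ forall F G, D (F + G) = D F + D G,
      forall F G, D (F * G) = D F * G + F * D G,
      forall c, D (spC c) = 0 /\ D eps = 0,
      forall F, D (sdvw F) = sdvw (D F)
    & forall n, exists m, forall F, (forall i, (i < m)%N -> scoef F i = 0) ->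
        forall i, (i < n)%N -> scoef (D F) i = 0].

(* D = Phi D'_(A, B) Phi^-1.  As eps is not a zero divisor and Phi maps v^(0),
   w^(0) to -2 + eps^2 v^(0), 1 + eps^2 w^(0), at most one D satisfies this. *)
Definition is_calD (A B : S1 K) (D : series (Rvw K) -> series (Rvw K)) : Prop :=
  derivation_Reps D /\ forall F, D (Phi F) = Phi (Dprime A B F).

(* The inclusion R0[[eps]] -> R[[eps]]. *)
Definition incl : series (R0 K) -> series (Rvw K) :=
  smap (psubst pC var_w).

(* F is in the closure, for the eps-topology, of the ideal generated by the
   derivatives of W = v^(0) - P. *)
Definition idealI (P : series (R0 K)) (F : series (Rvw K)) : Prop :=
  forall n, exists N (h : nat -> series (Rvw K)), forall i, (i < n)%N ->
    scoef F i = scoef (\sum_(k < N) h k * iter k sdvw (sv - incl P)) i.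

(* L is a linear combination of D 1, D 2, ... over K((eps)), the coefficients
   being written eps^-m * c k with c k in K[[eps]]. *)
Definition laurent_comb (D : nat -> series (R0 K)) (L : series (R0 K)) : Prop :=
  exists m N (c : nat -> series K),
    eps ^+ m * L = \sum_(1 <= k < N) smap pC (c k) * D k.

Definition at_eps0 (F : series (R0 K)) : R0 K := scoef F 0.

(* The derivation of R0 with value f at w^(0), conjugated by the automorphism
   w^(k) |-> c w^(k).  With Phi normalised as above, the Toda flows tend to the KdV
   flow of w^(3) + 12 w^(1) w^(0), which is [rescale 12 KdV_element] and is not
   KdV_element itself. *)
Definition rescale (c : K) (f : R0 K) : R0 K :=
  c^-1 *: psubst pC (fun k => c *: pX k) f.

End TodaKdV.

(* Main.v *)
(* Toda matrices are even-indexed blocks of squares of Volterra matrices: with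
   s = exp (eps d / 2), a = 1 + eps^2 b and a (s a) = 1 + eps^2 w, the substitution
   X_j = - (a_{2j-1} + a_{2j}), Y_j = a_{2j} a_{2j+1}, a_n = s^n a, turns the Toda flows into
   Volterra flows of the single field b.  Solving for b in terms of w gives the invariant
   ideal v = P with P = - (b + s^-1 b), and the induced flows D_k on w.

   The first flow is D_1 = eps w^(1) + eps^3 (w^(3) + 12 w^(1) w^(0)) / 24 + O(eps^4), where
   the eps-term commutes with everything.  Hence the leading coefficient of every G commuting
   with D_1 is a symmetry of KdV.  A KdV symmetry is determined by its linear part, and that
   part is odd.  So a series commuting with D_1 is determined by its linear part; by the
   Jacobi identity all combinations of the D_k commute.

   The linear part of D_k is a triangular combination of q^j - q^-j, 1 <= j <= k, with
   q = exp (eps X / 2).  The combinations with linear part (q - q^-1) (q + q^-1 - 2)^n are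
   therefore divisible by eps^(2n+1), and the leading coefficients of the quotients span the
   space of KdV symmetries, in particular the KdV hierarchy. *)

(* The ideal is handled through the homomorphism [gproj], which sends v to [redP] and fixes w: the
   closed ideal is its kernel, so invariance and the induced flows both follow once [gproj]
   intertwines each Toda derivation with a one-field evolution. On v and w, after multiplication by
   eps^2, this is an identity between entries of matrix powers.

   The obstacle is commutation. Only commutation with the first flow has a short direct proof,
   because only that flow has a Lax matrix with a single diagonal; all the rest comes from rigidity
   of KdV symmetries. The top-order derivative of a symmetry is killed by d, hence is a constant,
   hence is visible in the linear part. That the linear part is odd comes from Galilean invariance:
   d/dw^(0) maps symmetries to symmetries and ties the linear coefficient in degree n + 2 to the one
   in degree n.

   Linear parts behave as commuting symbols only for flows without constant term, which is why
   constant terms ([aug], [saug]) are followed along with linear parts. *)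
Require Import Defs.
From HB Require Import structures.
From mathcomp Require Import all_boot all_order all_algebra.
From mathcomp Require Import reals complex ring zify.

Set Implicit Arguments.
Unset Strict Implicit.
Unset Printing Implicit Defensive.

Import GRing.Theory Num.Theory.
Local Open Scope ring_scope.

(** * Polynomial rings *)

(* Ring identities are proved over an abstract ring: matching in a concrete monoid
   algebra unfolds its operations. *)
Lemma leibnizDl (A : comNzRingType) (D : A -> A) (f1 f2 g : A) :
    {morph D : f g / f + g} ->
    D (f1 * g) = D f1 * g + f1 * D g -> D (f2 * g) = D f2 * g + f2 * D g ->
  D ((f1 + f2) * g) = D (f1 + f2) * g + (f1 + f2) * D g.
Proof. by move=> DD D1 D2; rewrite mulrDl !DD D1 D2 !mulrDl addrACA. Qed.

Lemma leibnizC (A : comNzRingType) (D : A -> A) (f g : A) :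
  D (f * g) = D f * g + f * D g -> D (g * f) = D g * f + g * D f.
Proof. by move=> D1; rewrite mulrC D1 addrC mulrC (mulrC g). Qed.

Lemma leibnizU (A : comNzRingType) (D : A -> A) (u v c d x y : A) :
    D (c * d * (x * y)) = c * d * (u * y + x * v) ->
    D (c * x) = c * u -> D (d * y) = d * v ->
  D (c * x * (d * y)) = D (c * x) * (d * y) + c * x * D (d * y).
Proof. by move=> Dxy -> ->; rewrite mulrACA Dxy; ring. Qed.

Lemma mulrDACr (A : comNzRingType) (a b c d e : A) :
  (a * b + c * d) * e = a * e * b + c * (d * e).
Proof. by ring. Qed.

Section PolynomialAlgebra.
Context (K : fieldType) (I : choiceType).
Implicit Types (f g : pol K I) (i : I).

Lemma malg_ind (P : pol K I -> Prop) :
    P 0 -> (forall f g, P f -> P g -> P (f + g)) -> (forall c m, P << c *g m >>) ->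
  forall f, P f.
Proof.
move=> P0 PD PU f; rewrite [f]monalgE.
by elim/big_ind: _ => // m _; exact: PU.
Qed.

Lemma pol_ind (P : pol K I -> Prop) :
    (forall c, P (pC c)) -> (forall i, P (pX i)) ->
    (forall f g, P f -> P g -> P (f + g)) ->
    (forall f g, P f -> P g -> P (f * g)) ->
  forall f, P f.
Proof.
move=> PC PXi PD PM.
have PU (m : {cmonom I}) : P << m >>.
  have [n le_mn] := ubnP (mdeg m); elim: n m le_mn => // n IHn m.
  have [/eqP m0 _|[i mi]] : (m == mone) \/ exists i, i \in finsupp m.
  - case: (fset_0Vmem (finsupp m)) => [m0|[i mi]]; [left|by right; exists i].
    by apply/cmP => i; rewrite cm1; apply/eqP; rewrite cmE_eq0 m0.
  - by rewrite m0; exact: PC.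
  rewrite ltnS => le_mn.
  have mE : m = mmul (ucm i) (divcm m (ucm i)).
    apply/eqP/cmP => j; rewrite cmM divcmE cmU; case: eqVneq => [<-|_] /=.
      by rewrite subnKC // lt0n cmE_neq0.
    by rewrite add0n subn0.
  have -> : << m >> = (pX i : pol K I) * << divcm m (ucm i) >>.
    by rewrite {1}mE pX.unlock [RHS]fgmulUU mulr1.
  apply: PM => //; apply: IHn; apply: leq_trans le_mn.
  by rewrite [in X in (_ < X)%N]mE mdegM mdegU.
apply: malg_ind; [|exact: PD|move=> c m].
  suff <- : pC 0 = 0 :> pol K I by exact: PC.
  exact: (raddf0 (malgC : {additive K -> pol K I})).
suff -> : << c *g m >> = pC c * << m >> :> pol K I by exact: PM.
by rewrite [RHS]fgmulUU mulr1 mul1m.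
Qed.

Section Substitution.
Context (B : comNzRingType) (c : {rmorphism K -> B}) (x : I -> B).

Let h (m : {cmonom I}) : B := \prod_(i <- finsupp m) x i ^+ m i.

Let hE (E : {fset I}) (m : {cmonom I}) : fsubset (finsupp m) E -> h m = \prod_(i <- E) x i ^+ m i.
Proof.
move=> le; rewrite /h (big_fset_incl _ le) // => i _.
by rewrite -cmE_neq0 negbK => /eqP ->.
Qed.

Let h1 : h mone = 1.
Proof. by rewrite /h mdom1 big_seq_fset0. Qed.

Let hM m1 m2 : h (mmul m1 m2) = h m1 * h m2.
Proof.
rewrite (hE (E := fsetU (finsupp m1) (finsupp m2))) ?mdomD ?fsubset_refl //.
rewrite (hE (fsubsetUl (finsupp m1) (finsupp m2))).
rewrite (hE (fsubsetUr (finsupp m1) (finsupp m2))).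
by rewrite -big_split /=; apply: eq_bigr => i _; rewrite cmM exprD.
Qed.

HB.instance Definition _ :=
  monalg.isMultiplicative.Build {cmonom I} B h (hM, h1).
Let hm : {mmorphism {cmonom I} -> B} := h.

Lemma psubst_is_additive : additive (psubst c x).
Proof. exact: (@mmap_is_additive _ _ _ c hm). Qed.

Lemma psubst_is_multiplicative : multiplicative (psubst c x).
Proof. exact: (@mmap_is_multiplicative _ _ _ c hm). Qed.

Lemma psubstC a : psubst c x (pC a) = c a.
Proof. exact: (@mmapC _ _ _ c hm a). Qed.

Lemma psubstX i : psubst c x (pX i) = x i.
Proof.
rewrite pX.unlock; transitivity (c 1 * h (ucm i)).
  exact: (@mmapU _ _ _ c hm).
by rewrite rmorph1 mul1r /h mdomU big_seq_fset1 cmU eqxx expr1.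
Qed.

End Substitution.

Lemma divcm_mul i (m1 m2 : {cmonom I}) : m1 i != 0%N ->
  divcm (mmul m1 m2) (ucm i) = mmul (divcm m1 (ucm i)) m2.
Proof.
move=> m1i; apply/eqP/cmP => j; rewrite divcmE !cmM divcmE cmU.
by case: eqVneq => [<-|]; rewrite ?subn0 // addnBAC // lt0n.
Qed.

(** If [m i] is 0 the coefficient vanishes, so the truncated division [divcm] does no harm. *)
Let pdm i (m : {cmonom I}) : pol K I := << (m i)%:R *g divcm m (ucm i) >>.

Let pderivE i f : pderiv i f = mmap malgC (pdm i) f.
Proof.
by apply: eq_bigr => m _; rewrite [RHS]fgmulUU mul1m mulr_natr.
Qed.

Let pdmM i m1 m2 : pdm i (mmul m1 m2) = pdm i m1 * << m2 >> + << m1 >> * pdm i m2.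
Proof.
have half (p1 p2 : {cmonom I}) :
    << (p1 i)%:R *g divcm (mmul p1 p2) (ucm i) >> = pdm i p1 * << p2 >> :> pol K I.
  rewrite [RHS]fgmulUU mulr1; have [p10|p1i] := eqVneq (p1 i) 0%N.
    by rewrite p10 !monalgU0.
  by rewrite divcm_mul.
rewrite /pdm cmM natrD monalgUD half; congr (_ + _).
by rewrite (mulmC m1); apply: etrans (half m2 m1) _; exact: mulrC.
Qed.

Lemma pderivD i f g : pderiv i (f + g) = pderiv i f + pderiv i g.
Proof. by rewrite !pderivE; exact: (raddfD (@mmap _ _ _ malgC (pdm i) : {additive _ -> _})). Qed.

Lemma pderivM i f g : pderiv i (f * g) = pderiv i f * g + f * pderiv i g.
Proof.
have D0 : pderiv i 0 = 0 :> pol K I.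
  by apply: (addrI (pderiv i 0)); rewrite -pderivD !addr0.
have DU c (m : {cmonom I}) : pderiv i << c *g m >> = malgC c * pdm i m.
  by rewrite pderivE; exact: mmapU.
elim/malg_ind: f => [|f1 f2 IH1 IH2|c m].
- by rewrite D0 !mul0r D0 addr0.
- exact: (leibnizDl (pderivD i) IH1 IH2).
apply: leibnizC; elim/malg_ind: g => [|g1 g2 IH1 IH2|c' m'].
- by rewrite D0 !mul0r D0 addr0.
- exact: (leibnizDl (pderivD i) IH1 IH2).
have UE a (p : {cmonom I}) : << a *g p >> = malgC a * << p >> :> pol K I.
  by rewrite [RHS]fgmulUU mulr1 mul1m.
have UU : << c' * c *g mmul m' m >>
    = malgC c' * malgC c * (<< m' >> * << m >>) :> pol K I.
  rewrite UE; congr (_ * _); first exact: (rmorphM (malgC : {rmorphism K -> pol K I})).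
  by rewrite [RHS]fgmulUU mulr1.
rewrite UE (UE c); apply: (leibnizU (u := pdm i m') (v := pdm i m)).
- rewrite -UU DU pdmM; congr (_ * _).
  exact: (rmorphM (malgC : {rmorphism K -> pol K I})).
- by apply: etrans (DU _ _); rewrite [in RHS]UE.
- by apply: etrans (DU _ _); rewrite [in RHS]UE.
Qed.

Lemma pderivC i a : pderiv i (pC a) = 0 :> pol K I.
Proof.
by rewrite pderivE [LHS]mmapU /pdm cm1 monalgU0 mulr0.
Qed.

Lemma pderivX i j : pderiv i (pX j) = (i == j)%:R :> pol K I.
Proof.
rewrite pX.unlock pderivE [LHS]mmapU mul1r /pdm cmU eq_sym.
case: eqVneq => [->|]; last by rewrite monalgU0.
by have -> : divcm (ucm j) (ucm j) = mone by apply/eqP/cmP => k; rewrite divcmE subnn cm1.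
Qed.

(** The sum over all of [I] in [pder] is meaningful only with finite support, which this
    provides. *)
Lemma finite_vars f : exists E : {fset I}, forall i, i \notin E -> pderiv i f = 0.
Proof.
move: f; apply: pol_ind => [a|j|f g [E1 f0] [E2 g0]|f g [E1 f0] [E2 g0]].
- by exists fset0 => i _; rewrite pderivC.
- by exists [fset j]%fset => i; rewrite in_fset1 pderivX => /negPf ->.
- exists (fsetU E1 E2) => i; rewrite in_fsetU negb_or => /andP[i1 i2].
  by rewrite pderivD f0 // g0 // addr0.
- exists (fsetU E1 E2) => i; rewrite in_fsetU negb_or => /andP[i1 i2].
  by rewrite pderivM f0 // g0 // mul0r mulr0 addr0.
Qed.

Section Derivation.
Context (B : comNzRingType) (iota : {rmorphism pol K I -> B}) (d : I -> B).

Let pderE (E : {fset I}) f : (forall i, i \notin E -> pderiv i f = 0) ->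
  pder iota d f = \sum_(i <- E) iota (pderiv i f) * d i.
Proof.
by move=> f0; rewrite /pder (@fsbigTE _ _ _ _ E) // => i /f0 ->; rewrite rmorph0 mul0r.
Qed.

Let common_vars f g : exists E : {fset I},
  (forall i, i \notin E -> pderiv i f = 0) /\ (forall i, i \notin E -> pderiv i g = 0).
Proof.
have [[E1 f0] [E2 g0]] := (finite_vars f, finite_vars g).
exists (fsetU E1 E2); split=> i; rewrite in_fsetU negb_or => /andP[i1 i2].
  exact: f0.
exact: g0.
Qed.

Lemma pderD f g : pder iota d (f + g) = pder iota d f + pder iota d g.
Proof.
have [E [f0 g0]] := common_vars f g.
have fg0 i : i \notin E -> pderiv i (f + g) = 0.
  by move=> iE; rewrite pderivD f0 // g0 // addr0.
rewrite (pderE f0) (pderE g0) (pderE fg0) -big_split; apply: eq_bigr => i _.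
by rewrite pderivD rmorphD mulrDl.
Qed.

Lemma pderM f g : pder iota d (f * g) = pder iota d f * iota g + iota f * pder iota d g.
Proof.
have [E [f0 g0]] := common_vars f g.
have fg0 i : i \notin E -> pderiv i (f * g) = 0.
  by move=> iE; rewrite pderivM f0 // g0 // mul0r mulr0 addr0.
rewrite (pderE f0) (pderE g0) (pderE fg0) mulr_suml mulr_sumr -big_split.
apply: eq_bigr => i _.
have E1 : iota (pderiv i (f * g)) = iota (pderiv i f) * iota g + iota f * iota (pderiv i g).
  apply: etrans (congr1 iota (pderivM i f g)) _; apply: etrans (rmorphD iota _ _) _.
  exact: congr2 (rmorphM iota _ _) (rmorphM iota _ _).
apply: etrans (congr1 ( *%R^~ (d i)) E1) _.
exact: mulrDACr.
Qed.

Lemma pderC a : pder iota d (pC a) = 0.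
Proof. by rewrite /pder fsbig1 // => i _; rewrite pderivC rmorph0 mul0r. Qed.

Lemma pderX i : pder iota d (pX i) = d i.
Proof.
rewrite (@pderE [fset i]%fset) => [|j]; last by rewrite in_fset1 pderivX => /negPf ->.
by rewrite big_seq_fset1 pderivX eqxx rmorph1 mul1r.
Qed.

End Derivation.
End PolynomialAlgebra.

(** * Formal power series in eps *)

Section SeriesTheory.
Context (A : comNzRingType).
Implicit Types (F G : series A) (a b : A).

Lemma scoef0 n : scoef (0 : series A) n = 0.
Proof. by rewrite /= if_same. Qed.

Lemma scoefD n F G : scoef (F + G) n = scoef F n + scoef G n.
Proof. by []. Qed.

Lemma scoefN n F : scoef (- F) n = - scoef F n.
Proof. by []. Qed.

Lemma scoefB n F G : scoef (F - G) n = scoef F n - scoef G n.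
Proof. by []. Qed.

Lemma scoef_sum (J : Type) (s : seq J) (P : pred J) (F : J -> series A) n :
  scoef (\sum_(j <- s | P j) F j) n = \sum_(j <- s | P j) scoef (F j) n.
Proof.
elim/big_rec2: _ => [|j x y _ <-]; last by rewrite scoefD.
by rewrite scoef0.
Qed.

Lemma scoefM n F G : scoef (F * G) n = \sum_(i < n.+1) scoef F i * scoef G (n - i)%N.
Proof. by []. Qed.

Lemma scoefC a n : scoef (sconst a) n = if n == 0%N then a else 0.
Proof. by []. Qed.

Lemma scoefC0 a : scoef (sconst a) 0 = a.
Proof. by []. Qed.

Lemma sconstD a b : sconst (a + b) = sconst a + sconst b.
Proof. by apply: seriesP => -[|n]; rewrite scoefD !scoefC //= addr0. Qed.

Lemma scoefCM a F n : scoef (sconst a * F) n = a * scoef F n.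
Proof.
rewrite scoefM big_ord_recl big1 ?addr0 ?subn0 // => i _.
by rewrite scoefC /= mul0r.
Qed.

Lemma scoef0M F G : scoef (F * G) 0 = scoef F 0 * scoef G 0.
Proof. by rewrite scoefM big_ord1. Qed.

Lemma sconst_is_additive : additive (@sconst A).
Proof.
by move=> a b; rewrite sconstD; congr (_ + _); apply: seriesP => -[|n] //=; rewrite oppr0.
Qed.

HB.instance Definition _ := GRing.isAdditive.Build A (series A) (@sconst A) sconst_is_additive.

Lemma sconst_is_multiplicative : multiplicative (@sconst A).
Proof.
split=> // a b; apply: seriesP => n; rewrite scoefCM !scoefC.
by case: eqP; rewrite ?mulr0.
Qed.

HB.instance Definition _ :=
  GRing.isMultiplicative.Build A (series A) (@sconst A) sconst_is_multiplicative.

Lemma scoef_epsM F n : scoef (eps * F) n = if n is n'.+1 then scoef F n' else 0.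
Proof.
rewrite scoefM; case: n => [|n]; first by rewrite big_ord1 /= mul0r.
rewrite !big_ord_recl /= mul0r add0r mul1r big1 ?addr0 ?subSS ?subn0 // => i _.
by rewrite mul0r.
Qed.

Lemma scoef_epsXM k F n :
  scoef (eps ^+ k * F) n = if (n < k)%N then 0 else scoef F (n - k)%N.
Proof.
elim: k n => [|k IHk] n; first by rewrite expr0 mul1r subn0.
by rewrite exprS -mulrA scoef_epsM; case: n => // n; rewrite IHk ltnS subSS.
Qed.

Lemma scoef_epsXM_add k F n : scoef (eps ^+ k * F) (n + k)%N = scoef F n.
Proof. by rewrite scoef_epsXM ltnNge leq_addl addnK. Qed.

Lemma epsX_inj k F G : eps ^+ k * F = eps ^+ k * G -> F = G.
Proof.
by move=> FG; apply: seriesP => n; rewrite -(scoef_epsXM_add k F) FG scoef_epsXM_add.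
Qed.

Lemma epsX_eq0 k F : eps ^+ k * F = 0 -> F = 0.
Proof. by rewrite -[X in _ = X -> _](mulr0 (eps ^+ k)); exact: epsX_inj. Qed.

(** Division by eps^k. It is exact when the first k coefficients vanish ([sdropP]) and otherwise
    forgets them. *)
Definition sdrop k F : series A := Series (fun n => scoef F (n + k)%N).

Lemma sdropP k F : (forall i, (i < k)%N -> scoef F i = 0) -> F = eps ^+ k * sdrop k F.
Proof.
move=> F0; apply: seriesP => n; rewrite scoef_epsXM.
by case: ltnP => [/F0 //|le_kn] /=; rewrite subnK.
Qed.

Lemma sconst_sdrop F : F = sconst (scoef F 0) + eps * sdrop 1 F.
Proof.
by apply: seriesP => -[|n]; rewrite scoefD scoefC scoef_epsM /= ?addr0 // add0r addn1.
Qed.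

Lemma series_decomp k F :
  F = \sum_(i < k) eps ^+ i * sconst (scoef F i) + eps ^+ k * sdrop k F.
Proof.
elim: k => [|k IHk].
  by rewrite big_ord0 add0r expr0 mul1r; apply: seriesP => n /=; rewrite addn0.
rewrite [LHS]IHk big_ord_recr /= -addrA [X in _ = _ + X](_ : _ = eps ^+ k * sdrop k F) //.
rewrite exprSr -mulrA -mulrDr [in RHS](sconst_sdrop (sdrop k F)); congr (_ * (_ + eps * _)).
by apply: seriesP => n /=; rewrite -addnA add1n.
Qed.

Lemma eq_mod_epsX F G : (forall k, exists H, F - G = eps ^+ k * H) -> F = G.
Proof.
move=> FG; apply/eqP; rewrite -subr_eq0; apply/eqP; apply: seriesP => n.
by have [H ->] := FG n.+1; rewrite scoef_epsXM ltnS leqnn scoef0.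
Qed.

Lemma series_neq0 F : F <> 0 ->
  exists k G, F = eps ^+ k * G /\ scoef G 0 <> 0.
Proof.
move=> F0; have exF : exists n, scoef F n != 0.
  apply: contrapT => H; apply: F0; apply: seriesP => n; rewrite scoef0; apply: contrapT => Fn.
  by apply: H; exists n; apply/eqP.
exists (ex_minn exF), (sdrop (ex_minn exF) F); case: ex_minnP => n Fn n_min.
split; last by rewrite /= add0n; apply/eqP.
apply: sdropP => i lt_in; apply/eqP/contraT => /n_min; rewrite leqNgt lt_in //.
Qed.

End SeriesTheory.

Section EpsilonLinear.
Context (A B : comNzRingType).

(* Additivity and commutation with eps already give continuity. *)
Definition epslinear (T : series A -> series B) : Prop :=
  {morph T : F G / F + G} /\ forall F, T (eps * F) = eps * T F.

Lemma epslinear0 T : epslinear T -> T 0 = 0.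
Proof. by case=> TD _; apply: (addrI (T 0)); rewrite -TD !addr0. Qed.

Lemma epslinearB T F G : epslinear T -> T (F - G) = T F - T G.
Proof.
by move=> lT; apply: (addIr (T G)); rewrite -(proj1 lT) !subrK.
Qed.

Lemma epslinear_sum T (J : Type) (s : seq J) (P : pred J) (F : J -> series A) :
  epslinear T -> T (\sum_(j <- s | P j) F j) = \sum_(j <- s | P j) T (F j).
Proof.
move=> lT; elim/big_rec2: _ => [|j x y _ <-]; first exact: epslinear0.
by rewrite (proj1 lT).
Qed.

Lemma epslinearX T k F : epslinear T -> T (eps ^+ k * F) = eps ^+ k * T F.
Proof.
move=> [_ Te]; elim: k => [|k IHk]; first by rewrite !expr0 !mul1r.
by rewrite !exprS -!mulrA Te IHk.
Qed.

(** Cutting F after k terms shows that the two maps agree modulo eps^k, for every k. *)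
Lemma epslinear_ext T T' : epslinear T -> epslinear T' ->
  (forall a, T (sconst a) = T' (sconst a)) -> T =1 T'.
Proof.
move=> lT lT' eqT F; apply: eq_mod_epsX => k; exists (T (sdrop k F) - T' (sdrop k F)).
rewrite {1 2}(series_decomp k F) (proj1 lT) (proj1 lT') !epslinear_sum // !epslinearX //.
rewrite opprD addrACA -sumrB big1 ?add0r ?mulrBr // => i _.
by rewrite !epslinearX // eqT subrr.
Qed.

Lemma epslinear_hom (T : {rmorphism series A -> series B}) : T eps = eps -> epslinear T.
Proof. by move=> Te; split=> [F G|F]; rewrite ?rmorphD ?rmorphM ?Te. Qed.

Lemma scoef_sext (u : A -> series B) F n :
  scoef (sext u F) n = \sum_(i < n.+1) scoef (u (scoef F i)) (n - i)%N.
Proof. by []. Qed.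

Lemma epslinear_sext (u : A -> series B) : {morph u : a b / a + b} -> epslinear (sext u).
Proof.
move=> uD; have u0 : u 0 = 0 by apply: (addrI (u 0)); rewrite -uD !addr0.
split=> [F G|F]; apply: seriesP => n.
  rewrite scoefD !scoef_sext -big_split; apply: eq_bigr => i _.
  by rewrite scoefD uD.
rewrite scoef_epsM; case: n => [|n]; rewrite !scoef_sext.
  by rewrite big_ord1 scoef_epsM u0 scoef0.
rewrite big_ord_recl scoef_epsM u0 scoef0 add0r; apply: eq_bigr => i _.
by rewrite scoef_epsM subSS.
Qed.

Lemma sextC (u : A -> series B) a : {morph u : a b / a + b} -> sext u (sconst a) = u a.
Proof.
move=> uD; have u0 : u 0 = 0 by apply: (addrI (u 0)); rewrite -uD !addr0.
apply: seriesP => n /=; rewrite big_ord_recl big1 ?addr0 ?subn0 // => i _.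
by rewrite u0 scoef0.
Qed.

Lemma sext0 (u : A -> series B) F : scoef (sext u F) 0 = scoef (u (scoef F 0)) 0.
Proof. by rewrite /= big_ord1. Qed.

Lemma smap_sext (u : A -> B) : {morph u : a b / a + b} ->
  smap u =1 sext (fun a => sconst (u a)).
Proof.
move=> uD F; apply: seriesP => n /=; rewrite big_ord_recr /= subnn eqxx big1 ?add0r // => i _.
by rewrite subn_eq0 leqNgt ltn_ord.
Qed.

Lemma epslinear_smap (u : A -> B) : {morph u : a b / a + b} -> epslinear (smap u).
Proof.
move=> uD; have lu : epslinear (sext (fun a => sconst (u a))).
  by apply: epslinear_sext => a b; rewrite uD sconstD.
by split=> [F G|F]; rewrite !(smap_sext uD) ?(proj1 lu) ?(proj2 lu).
Qed.

Lemma smapC (u : A -> B) a : {morph u : a b / a + b} -> smap u (sconst a) = sconst (u a).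
Proof.
by move=> uD; rewrite smap_sext // sextC // => b b'; rewrite uD sconstD.
Qed.

End EpsilonLinear.

Lemma epslinear_comp (A B C : comNzRingType) (T : series B -> series C)
    (T' : series A -> series B) : epslinear T -> epslinear T' -> epslinear (T \o T').
Proof.
by move=> lT lT'; split=> [F G|F] /=; rewrite ?(proj1 lT', proj2 lT') ?(proj1 lT, proj2 lT).
Qed.

Lemma epslinear_add (A B : comNzRingType) (T T' : series A -> series B) :
  epslinear T -> epslinear T' -> epslinear (fun F => T F + T' F).
Proof.
move=> lT lT'; split=> [F G|F]; first by rewrite (proj1 lT) (proj1 lT') addrACA.
by rewrite (proj2 lT) (proj2 lT') mulrDr.
Qed.

Lemma epslinear_mul (A B : comNzRingType) (T : series A -> series B) H :
  epslinear T -> epslinear (fun F => T F * H).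
Proof.
by move=> lT; split=> [F G|F]; rewrite ?(proj1 lT) ?(proj2 lT) ?mulrDl ?mulrA.
Qed.

(** One statement for derivations along a homomorphism ([S] and [S''] equal to [T]) and for
    homomorphisms ([S] and [S'] equal to [T], [S''] zero): the product rule passes from constant
    series to all series. *)
Lemma epslinear_leibniz (A B : comNzRingType) (T S S' : series A -> series B)
    (S'' : series A -> series B) :
    epslinear T -> epslinear S -> epslinear S' -> epslinear S'' ->
    (forall a b, T (sconst (a * b)) = S (sconst a) * S' (sconst b)
                                      + S' (sconst a) * S'' (sconst b)) ->
  forall F G, T (F * G) = S F * S' G + S' F * S'' G.
Proof.
move=> lT lS lS' lS'' Tab F G.
have lTM H : epslinear (fun F => T (F * H)).
  by split=> [F1 F2|F1]; rewrite ?mulrDl ?(proj1 lT) // -mulrA (proj2 lT).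
apply: (epslinear_ext (T' := fun F => S F * S' G + S' F * S'' G) (lTM G)).
  exact: (epslinear_add (epslinear_mul _ lS) (epslinear_mul _ lS')).
move=> a; have lTC : epslinear (fun G => T (sconst a * G)).
  by have [lD lE] := lT; split=> [G1 G2|G1]; rewrite ?mulrDr ?lD // mulrCA lE.
apply: (epslinear_ext (T' := fun G => S (sconst a) * S' G + S' (sconst a) * S'' G) lTC).
  have lM (V : series A -> series B) H : epslinear V -> epslinear (fun G => H * V G).
    by move=> lV; split=> [G1 G2|G1]; rewrite ?(proj1 lV) ?(proj2 lV) ?mulrDr // mulrCA.
  exact: (epslinear_add (lM _ _ lS') (lM _ _ lS'')).
by move=> b; rewrite -rmorphM Tab.
Qed.

Lemma epslinear_multiplicative (A B : comNzRingType) (T : series A -> series B) :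
    epslinear T ->
    (forall a b, T (sconst (a * b)) = T (sconst a) * T (sconst b)) ->
  forall F G, T (F * G) = T F * T G.
Proof.
move=> lT Tab F G.
have l0 : epslinear (fun _ : series A => 0 : series B).
  by split=> [F1 F2|F1]; rewrite ?addr0 ?mulr0.
have Tab' a b : T (sconst (a * b)) = T (sconst a) * T (sconst b) + T (sconst a) * 0.
  by rewrite mulr0 addr0.
by rewrite (epslinear_leibniz lT lT lT l0 Tab') mulr0 addr0.
Qed.

(** * Abstract polynomial algebras *)

(* The universal property of polynomial rings.  Working with an abstract model keeps
   unification away from the concrete monoid algebra. *)
Record free_algebra (K : fieldType) (I : choiceType) := FreeAlgebra {
  fa_ring :> comNzRingType;
  fa_C : {rmorphism K -> fa_ring};
  fa_X : I -> fa_ring;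
  fa_subst : forall B : comNzRingType, (K -> B) -> (I -> B) -> fa_ring -> B;
  fa_der : forall B : comNzRingType, (fa_ring -> B) -> (I -> B) -> fa_ring -> B;
  fa_ind : forall P : fa_ring -> Prop,
    (forall c, P (fa_C c)) -> (forall i, P (fa_X i)) ->
    (forall f g, P f -> P g -> P (f + g)) -> (forall f g, P f -> P g -> P (f * g)) ->
    forall f, P f;
  fa_subst_additive : forall (B : comNzRingType) (c : {rmorphism K -> B}) x,
    additive (fa_subst c x);
  fa_subst_multiplicative : forall (B : comNzRingType) (c : {rmorphism K -> B}) x,
    multiplicative (fa_subst c x);
  fa_substC : forall (B : comNzRingType) (c : {rmorphism K -> B}) x a,
    fa_subst c x (fa_C a) = c a;
  fa_substX : forall (B : comNzRingType) (c : {rmorphism K -> B}) x i,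
    fa_subst c x (fa_X i) = x i;
  fa_derD : forall (B : comNzRingType) (iota : {rmorphism fa_ring -> B}) d,
    {morph fa_der iota d : f g / f + g};
  fa_derM : forall (B : comNzRingType) (iota : {rmorphism fa_ring -> B}) d f g,
    fa_der iota d (f * g) = fa_der iota d f * iota g + iota f * fa_der iota d g;
  fa_derC : forall (B : comNzRingType) (iota : {rmorphism fa_ring -> B}) d a,
    fa_der iota d (fa_C a) = 0;
  fa_derX : forall (B : comNzRingType) (iota : {rmorphism fa_ring -> B}) d i,
    fa_der iota d (fa_X i) = d i;
  fa_der_eq : forall (B : comNzRingType) (iota : {rmorphism fa_ring -> B}) d d' f,
    (forall i, fa_der id (fun j => (i == j)%:R) f <> 0 -> d i = d' i) ->
    fa_der iota d f = fa_der iota d' f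
}.

Lemma pder_pderiv (K : fieldType) (I : choiceType) i :
  pder id (fun j => (i == j)%:R) =1 @pderiv K I i.
Proof.
apply: pol_ind => [c|j|f g|f g].
- by rewrite (pderC (idfun : {rmorphism _ -> _})) pderivC.
- by rewrite (pderX (idfun : {rmorphism _ -> _})) pderivX.
- by rewrite (pderD (idfun : {rmorphism _ -> _})) pderivD => -> ->.
- by rewrite (pderM (idfun : {rmorphism _ -> _})) pderivM => -> ->.
Qed.

Lemma pder_eq (K : fieldType) (I : choiceType) (B : comNzRingType)
    (iota : {rmorphism pol K I -> B}) d d' f :
    (forall i, pder id (fun j => (i == j)%:R) f <> 0 -> d i = d' i) ->
  pder iota d f = pder iota d' f.
Proof.
move=> dd'; apply: eq_fsbigr => i _; have := dd' i; rewrite pder_pderiv.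
have [-> _|/eqP fi /(_ fi) -> //] := eqVneq (pderiv i f) 0.
by rewrite rmorph0 !mul0r.
Qed.

Definition pol_free_algebra (K : fieldType) (I : choiceType) : free_algebra K I :=
  @FreeAlgebra K I (pol K I) (malgC : {rmorphism K -> pol K I}) pX
    (fun B c x => psubst c x) (fun B iota d => pder iota d) (@pol_ind K I)
    (@psubst_is_additive K I) (@psubst_is_multiplicative K I)
    (@psubstC K I) (@psubstX K I)
    (@pderD K I) (@pderM K I) (@pderC K I) (@pderX K I) (@pder_eq K I).

Section FreeAlgebraTheory.
Context (K : fieldType) (I : choiceType) (A : free_algebra K I).
Implicit Types (f g : A) (i : I).

Definition cC (c : K) : A := fa_C A c.
HB.instance Definition _ := GRing.RMorphism.on cC.

Section Substitution.
Context (B : comNzRingType) (c : {rmorphism K -> B}) (x : I -> B).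

HB.instance Definition _ := GRing.isAdditive.Build A B (@fa_subst _ _ A B c x)
  (@fa_subst_additive _ _ A B c x).
HB.instance Definition _ := GRing.isMultiplicative.Build A B (@fa_subst _ _ A B c x)
  (@fa_subst_multiplicative _ _ A B c x).

End Substitution.

Lemma fa_hom_ext (B : comNzRingType) (u v : {rmorphism A -> B}) :
  (forall c, u (cC c) = v (cC c)) -> (forall i, u (fa_X A i) = v (fa_X A i)) -> u =1 v.
Proof.
move=> uvC uvX; apply: fa_ind => // f g uf ug; first by rewrite !rmorphD uf ug.
by rewrite !rmorphM uf ug.
Qed.

Definition derivation_along (B : comNzRingType) (phi D : A -> B) : Prop :=
  {morph D : f g / f + g} /\ forall f g, D (f * g) = D f * phi g + phi f * D g.

Lemma fa_der_ext (B : comNzRingType) (phi D D' : A -> B) :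
    derivation_along phi D -> derivation_along phi D' ->
    (forall c, D (cC c) = D' (cC c)) -> (forall i, D (fa_X A i) = D' (fa_X A i)) ->
  D =1 D'.
Proof.
move=> [DD DM] [DD' DM'] eqC eqX; apply: fa_ind => // f g Df Dg.
  by rewrite DD DD' Df Dg.
by rewrite DM DM' Df Dg.
Qed.

Lemma fa_der_along (B : comNzRingType) (iota : {rmorphism A -> B}) d :
  derivation_along iota (fa_der iota d).
Proof. by split; [exact: fa_derD | exact: fa_derM]. Qed.

Definition der (x : I -> A) : A -> A := fa_der id x.

Lemma der_along x : derivation_along id (der x).
Proof. exact: (fa_der_along (idfun : {rmorphism A -> A})). Qed.

Lemma derD x : {morph der x : f g / f + g}.
Proof. exact: (proj1 (der_along x)). Qed.

Lemma derM x f g : der x (f * g) = der x f * g + f * der x g.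
Proof. exact: (proj2 (der_along x)). Qed.

Lemma derC x c : der x (cC c) = 0.
Proof. exact: (fa_derC (idfun : {rmorphism A -> A})). Qed.

Lemma derX x i : der x (fa_X A i) = x i.
Proof. exact: (fa_derX (idfun : {rmorphism A -> A})). Qed.

Lemma der_is_additive x : additive (der x).
Proof.
move=> f g; apply: (addIr (der x g)).
by rewrite -derD !subrK.
Qed.

HB.instance Definition _ x := GRing.isAdditive.Build A A (der x) (der_is_additive x).

Definition fpart i : A -> A := der (fun j => (i == j)%:R).
HB.instance Definition _ i := GRing.Additive.on (fpart i).

Lemma der_eq x y f : (forall i, fpart i f <> 0 -> x i = y i) -> der x f = der y f.
Proof. exact: (fa_der_eq (idfun : {rmorphism A -> A})). Qed.

Lemma der_comm x y f : der x (der y f) - der y (der x f)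
  = der (fun i => der x (y i) - der y (x i)) f.
Proof.
move: f; apply: (@fa_der_ext _ id (fun f => der x (der y f) - der y (der x f))).
- split=> f g; first by rewrite !derD opprD addrACA.
  rewrite !derM !derD !derM; ring.
- exact: der_along.
- by move=> c; rewrite !derC !raddf0 ?addr0.
- by move=> i; rewrite !derX.
Qed.

Lemma derCM x c f : der x (cC c * f) = cC c * der x f.
Proof. by rewrite derM derC mul0r add0r. Qed.

End FreeAlgebraTheory.

Arguments cC {K I A} c.
Arguments der {K I A} x f.
Arguments fpart {K I A} i f.

(** * Derivations, homomorphisms and shifts of A[[eps]] *)

Section SeriesDerivations.
Context (K : fieldType) (I : choiceType) (A : free_algebra K I) (B : comNzRingType).

Definition sderivation (phi D : series A -> series B) : Prop :=
  epslinear D /\ forall F G, D (F * G) = D F * phi G + phi F * D G.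

Lemma sderivation_ext (phi D D' : series A -> series B) :
    sderivation phi D -> sderivation phi D' ->
    (forall c, D (sconst (cC c)) = D' (sconst (cC c))) ->
    (forall i, D (sconst (fa_X A i)) = D' (sconst (fa_X A i))) ->
  D =1 D'.
Proof.
move=> [lD DM] [lD' DM'] eqC eqX; apply: epslinear_ext => //.
by apply: (@fa_der_ext _ _ _ _ (phi \o @sconst A) (D \o @sconst A) (D' \o @sconst A));
  rewrite //=; split=> a b /=; rewrite ?rmorphD ?rmorphM ?(proj1 lD) ?(proj1 lD') ?DM ?DM'.
Qed.

Lemma shom_ext (u v : {rmorphism series A -> series B}) : u eps = eps -> v eps = eps ->
    (forall c, u (sconst (cC c)) = v (sconst (cC c))) ->
    (forall i, u (sconst (fa_X A i)) = v (sconst (fa_X A i))) ->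
  u =1 v.
Proof.
move=> ue ve eqC eqX; apply: epslinear_ext; [exact: epslinear_hom..|].
exact: (@fa_hom_ext _ _ _ _ (u \o @sconst A) (v \o @sconst A)).
Qed.

Lemma sderivation_add (phi D D' : series A -> series B) :
  sderivation phi D -> sderivation phi D' -> sderivation phi (fun F => D F + D' F).
Proof.
move=> [lD DM] [lD' DM']; split=> [|F G]; first exact: epslinear_add.
by rewrite DM DM' !mulrDl !mulrDr addrACA.
Qed.

End SeriesDerivations.

Lemma sderivation_comm (K : fieldType) (I : choiceType) (A : free_algebra K I)
    (D D' : series A -> series A) : sderivation id D -> sderivation id D' ->
  sderivation id (fun F => D (D' F) - D' (D F)).
Proof.
move=> [lD DM] [lD' DM']; split=> [|F G].
  split=> [F G|F]; last by rewrite !(proj2 lD, proj2 lD') mulrBr.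
  by rewrite !(proj1 lD, proj1 lD') opprD addrACA.
by rewrite DM DM' !(proj1 lD, proj1 lD') !DM !DM'; ring.
Qed.

Section Homomorphisms.
Context (K : fieldType) (I : choiceType) (A : free_algebra K I).

Definition scC (c : K) : series A := sconst (cC c).
HB.instance Definition _ := GRing.RMorphism.copy scC (@sconst A \o cC).

Definition gevol (x : I -> series A) : series A -> series A :=
  sext (fa_der (@sconst A) x).

Let along x := fa_der_along (@sconst A : {rmorphism A -> series A}) x.

Lemma epslinear_gevol x : epslinear (gevol x).
Proof. exact: epslinear_sext (proj1 (along x)). Qed.

Lemma gevol_is_additive x : additive (gevol x).
Proof. by move=> F G; rewrite (epslinearB _ _ (epslinear_gevol x)). Qed.

HB.instance Definition _ x := GRing.isAdditive.Build _ _ (gevol x) (gevol_is_additive x).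

Lemma gevol_const x a : gevol x (sconst a) = fa_der (@sconst A) x a.
Proof. exact: sextC (proj1 (along x)). Qed.

Lemma gevolM x F G : gevol x (F * G) = gevol x F * G + F * gevol x G.
Proof.
have lid : epslinear (id : series A -> series A) by [].
apply: (epslinear_leibniz (S' := id)) => [||//||a b]; try exact: epslinear_gevol.
by rewrite !gevol_const; exact: (proj2 (along x)).
Qed.

Lemma gevol_sder x : sderivation id (gevol x).
Proof. by split; [exact: epslinear_gevol|exact: gevolM]. Qed.

Lemma gevolC x c : gevol x (scC c) = 0.
Proof. by rewrite gevol_const; exact: (fa_derC (@sconst A : {rmorphism A -> series A})). Qed.

Lemma gevolX x i : gevol x (sconst (fa_X A i)) = x i.
Proof. by rewrite gevol_const; exact: (fa_derX (@sconst A : {rmorphism A -> series A})). Qed.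

Lemma gevol_epsX x k F : gevol x (eps ^+ k * F) = eps ^+ k * gevol x F.
Proof. exact: epslinearX (epslinear_gevol x). Qed.

Lemma gevolCM x c F : gevol x (scC c * F) = scC c * gevol x F.
Proof. by rewrite gevolM gevolC mul0r add0r. Qed.

Lemma scoef_gevol0 x F :
  scoef (gevol x F) 0 = der (fun i => scoef (x i) 0) (scoef F 0).
Proof.
rewrite sext0; move: (scoef F 0) => a; move: a.
apply: (@fa_der_ext _ _ _ _ id (fun a => scoef (fa_der (@sconst A) x a) 0)).
- by split=> a b; rewrite ?(proj1 (along x)) // (proj2 (along x)) scoefD !scoef0M !scoefC0.
- exact: der_along.
- by move=> c; rewrite derC (fa_derC (@sconst A : {rmorphism A -> series A})).
- by move=> i; rewrite derX (fa_derX (@sconst A : {rmorphism A -> series A})).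
Qed.

End Homomorphisms.

Section HomomorphismsBetween.
Context (K : fieldType) (I J : choiceType) (A : free_algebra K I) (B : free_algebra K J).
Implicit Types x : I -> series B.

Definition ghom x : series A -> series B := sext (fa_subst (@scC _ _ B) x).

Let substD x : {morph @fa_subst _ _ A _ (@scC _ _ B) x : f g / f + g}.
Proof. by move=> f g; rewrite rmorphD. Qed.

Lemma epslinear_ghom x : epslinear (ghom x).
Proof. exact: epslinear_sext (@substD x). Qed.

Lemma ghom_const x a : ghom x (sconst a) = fa_subst (@scC _ _ B) x a.
Proof. exact: sextC (@substD x). Qed.

Lemma ghom_is_additive x : additive (ghom x).
Proof. by move=> F G; rewrite (epslinearB _ _ (epslinear_ghom x)). Qed.

HB.instance Definition _ x := GRing.isAdditive.Build _ _ (ghom x) (ghom_is_additive x).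

Lemma ghom_is_multiplicative x : multiplicative (ghom x).
Proof.
split; last by rewrite -(rmorph1 (@sconst A)) ghom_const rmorph1.
apply: epslinear_multiplicative => [|a b]; first exact: epslinear_ghom.
by rewrite !ghom_const rmorphM.
Qed.

HB.instance Definition _ x :=
  GRing.isMultiplicative.Build _ _ (ghom x) (ghom_is_multiplicative x).

Lemma ghomC x c : ghom x (scC _ c) = scC _ c.
Proof. by rewrite ghom_const; exact: fa_substC. Qed.

Lemma ghomX x i : ghom x (sconst (fa_X A i)) = x i.
Proof. by rewrite ghom_const; exact: fa_substX. Qed.

Lemma ghom_epsX x k F : ghom x (eps ^+ k * F) = eps ^+ k * ghom x F.
Proof. exact: epslinearX (epslinear_ghom x). Qed.

(** Both sides are derivations along [ghom x], so generators decide. All intertwining statements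
    below reduce to this. *)
Lemma ghom_gevol x y z :
    (forall i, ghom x (y i) = gevol z (x i)) ->
  forall F, ghom x (gevol y F) = gevol z (ghom x F).
Proof.
move=> xy; apply: (@sderivation_ext _ _ _ _ (ghom x) (ghom x \o gevol y) (gevol z \o ghom x)).
- split=> [|F G] /=; last by rewrite gevolM rmorphD !rmorphM.
  exact: epslinear_comp (epslinear_ghom x) (epslinear_gevol y).
- split=> [|F G] /=; last by rewrite rmorphM gevolM.
  exact: epslinear_comp (epslinear_gevol z) (epslinear_ghom x).
- by move=> c /=; rewrite [sconst _]/(scC _ c) gevolC ghomC gevolC rmorph0.
- by move=> i /=; rewrite gevolX ghomX.
Qed.

End HomomorphismsBetween.

Section Differential.
Context (K : numFieldType) (I : choiceType) (A : free_algebra K I) (nx : I -> I).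
Implicit Types (F G : series A) (a b : A).

Definition dd : A -> A := der (fun i => fa_X A (nx i)).
HB.instance Definition _ := GRing.Additive.on dd.

Definition sdd : series A -> series A := smap dd.

Lemma epslinear_sdd : epslinear sdd.
Proof. by apply: epslinear_smap => a b; rewrite raddfD. Qed.

Lemma sdd_is_additive : additive sdd.
Proof. by move=> F G; rewrite (epslinearB _ _ epslinear_sdd). Qed.

HB.instance Definition _ := GRing.isAdditive.Build _ _ sdd sdd_is_additive.

Lemma sdd_const a : sdd (sconst a) = sconst (dd a).
Proof. by rewrite /sdd smapC // => b b'; rewrite raddfD. Qed.

Lemma scoef_sdd F n : scoef (sdd F) n = dd (scoef F n).
Proof. by []. Qed.

(* sdd is itself an evolution, so that it commutes with homomorphisms as in [ghom_gevol]. *)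
Lemma sdd_gevol : sdd =1 gevol (fun i => sconst (fa_X A (nx i))).
Proof.
apply: epslinear_ext => [||a]; [exact: epslinear_sdd|exact: epslinear_gevol|].
rewrite sdd_const gevol_const; move: a.
apply: (@fa_der_ext _ _ _ _ (@sconst A) (@sconst A \o dd)).
- by split=> a b /=; rewrite ?raddfD //= /dd derM rmorphD !rmorphM.
- exact: fa_der_along.
- by move=> c /=; rewrite /dd derC (fa_derC (@sconst A : {rmorphism A -> series A})) rmorph0.
- by move=> i /=; rewrite /dd derX (fa_derX (@sconst A : {rmorphism A -> series A})).
Qed.

Lemma sddM F G : sdd (F * G) = sdd F * G + F * sdd G.
Proof. by rewrite !sdd_gevol gevolM. Qed.

Lemma sddC c : sdd (scC _ c) = 0.
Proof. by rewrite sdd_gevol gevolC. Qed.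

Definition equivariant (x : I -> series A) := forall i, x (nx i) = sdd (x i).

Lemma gevol_sdd x : equivariant x -> forall F, gevol x (sdd F) = sdd (gevol x F).
Proof.
move=> eqx F; apply/eqP; rewrite !sdd_gevol -subr_eq0; apply/eqP; move: F.
have D0 : sderivation id (fun F : series A => 0 : series A).
  by split=> [|F G]; [split=> [G H|G]; rewrite ?addr0 ?mulr0 | rewrite mul0r mulr0 addr0].
apply: (sderivation_ext (sderivation_comm (gevol_sder x) (gevol_sder _)) D0).
  by move=> c /=; rewrite [sconst _]/(scC _ c) !gevolC !raddf0 addr0.
by move=> i; rewrite !gevolX -sdd_gevol eqx subrr.
Qed.

Lemma iter_ddD n a b : iter n dd (a + b) = iter n dd a + iter n dd b.
Proof. by elim: n => //= n ->; rewrite raddfD. Qed.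

Lemma iter_dd0 n : iter n dd 0 = 0.
Proof. by elim: n => //= n ->; rewrite raddf0. Qed.

Lemma iter_ddCM n c a : iter n dd (cC c * a) = cC c * iter n dd a.
Proof. by elim: n => //= n ->; rewrite /dd derCM. Qed.

Lemma iter_ddM n a b :
  iter n dd (a * b) = \sum_(i < n.+1) iter i dd a * iter (n - i) dd b *+ 'C(n, i).
Proof.
elim: n => [|n IHn]; first by rewrite big_ord1 /= bin0.
rewrite iterS IHn raddf_sum.
under eq_bigr => i _ do rewrite raddfMn /= {1}/dd derM mulrnDl -/dd.
rewrite big_split /= [RHS]big_ord_recl /=.
under [in RHS]eq_bigr => i _ do rewrite /= add0n binS mulrnDr subSS.
rewrite big_split /= addrC addrA; congr (_ + _) => //.
rewrite big_ord_recl [in RHS]big_ord_recr /= (@bin_small n n.+1) ?leqnn // mulr0n addr0.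
rewrite !bin0 subn0; congr (_ + _); apply: eq_bigr => -[i /= lti] _.
by rewrite /bump leq0n add1n -[dd (iter (n - _) dd b)]iterS subnSK.
Qed.

Definition expcoef (c : K) n : K := c ^+ n / n`!%:R.

Lemma expcoefM c n i : (i <= n)%N ->
  expcoef c n *+ 'C(n, i) = expcoef c i * expcoef c (n - i).
Proof.
move=> le_in; rewrite /expcoef -(bin_fact le_in) -{1}(subnKC le_in) exprD.
have nz m : m`!%:R != 0 :> K by rewrite pnatr_eq0 -lt0n fact_gt0.
have nzb : 'C(n, i)%:R != 0 :> K by rewrite pnatr_eq0 -lt0n bin_gt0.
rewrite !natrM -mulr_natr; have := nz i; have := nz (n - i)%N.
by move: nzb (i`!%:R : K) ((n - i)`!%:R : K) => nzb u v v0 u0; field; rewrite nzb u0 v0.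
Qed.

Lemma expcoefD c c' n :
  \sum_(i < n.+1) expcoef c i * expcoef c' (n - i) = expcoef (c + c') n.
Proof.
rewrite {3}/expcoef addrC exprDn mulr_suml; apply: eq_bigr => i _.
have le_in : (i <= n)%N by rewrite -ltnS.
have nz m : m`!%:R != 0 :> K by rewrite pnatr_eq0 -lt0n fact_gt0.
have nzb : 'C(n, i)%:R != 0 :> K by rewrite pnatr_eq0 -lt0n bin_gt0.
rewrite /expcoef -(bin_fact le_in) !natrM -[_ *+ 'C(n, i)]mulr_natr.
have := nz i; have := nz (n - i)%N.
by move: nzb (i`!%:R : K) ((n - i)`!%:R : K) => nzb u v v0 u0; field; rewrite nzb u0 v0.
Qed.

(* exp (c eps d) *)
Definition gshift (c : K) F : series A :=
  Series (fun n => \sum_(i < n.+1) cC (expcoef c i) * iter i dd (scoef F (n - i)%N)).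

Let eshift c a : series A := Series (fun n => cC (expcoef c n) * iter n dd a).

Let eshiftD c : {morph eshift c : a b / a + b}.
Proof. by move=> a b; apply: seriesP => n; rewrite scoefD /= iter_ddD mulrDr. Qed.

Let gshift_sext c : gshift c =1 sext (eshift c).
Proof.
move=> F; apply: seriesP => n; rewrite scoef_sext (reindex_inj rev_ord_inj) /=.
by apply: eq_bigr => i _; rewrite subSS subKn // -ltnS.
Qed.

Lemma epslinear_gshift c : epslinear (gshift c).
Proof.
have l := epslinear_sext (eshiftD c).
by split=> [F G|F]; rewrite !gshift_sext ?(proj1 l) ?(proj2 l).
Qed.

Lemma gshift_const c a n : scoef (gshift c (sconst a)) n = cC (expcoef c n) * iter n dd a.
Proof. by rewrite gshift_sext sextC. Qed.

Lemma gshift_is_additive c : additive (gshift c).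
Proof. by move=> F G; rewrite (epslinearB _ _ (epslinear_gshift c)). Qed.

HB.instance Definition _ c := GRing.isAdditive.Build _ _ (gshift c) (gshift_is_additive c).

Lemma gshiftC c c' : gshift c (scC _ c') = scC _ c'.
Proof.
apply: seriesP => -[|n]; rewrite gshift_const.
  by rewrite /expcoef /= fact0 divr1 rmorph1 mul1r.
by rewrite scoefC iterSr [X in iter n dd X]derC iter_dd0 mulr0.
Qed.

(** The exponential of a derivation is a homomorphism: the higher Leibniz rule [iter_ddM] matches
    the Taylor coefficients by [expcoefM]. *)
Lemma gshift_is_multiplicative c : multiplicative (gshift c).
Proof.
split; last by rewrite -(rmorph1 (@scC _ _ A)) gshiftC.
apply: epslinear_multiplicative => [|a b]; first exact: epslinear_gshift.
apply: seriesP => n; rewrite scoefM gshift_const iter_ddM mulr_sumr.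
apply: eq_bigr => i _; rewrite !gshift_const mulrnAr -mulrnAl -rmorphMn.
by rewrite expcoefM -1?ltnS // rmorphM mulrACA.
Qed.

HB.instance Definition _ c :=
  GRing.isMultiplicative.Build _ _ (gshift c) (gshift_is_multiplicative c).

Lemma gshift_epsX c k F : gshift c (eps ^+ k * F) = eps ^+ k * gshift c F.
Proof. exact: epslinearX (epslinear_gshift c). Qed.

Lemma scoef_gshift0 c F : scoef (gshift c F) 0 = scoef F 0.
Proof. by rewrite /= big_ord1 /expcoef fact0 divr1 rmorph1 mul1r. Qed.

Lemma gshift0 F : gshift 0 F = F.
Proof.
apply: seriesP => n; rewrite /= big_ord_recl big1 ?addr0 => [|i _].
  by rewrite /expcoef /= fact0 divr1 rmorph1 mul1r subn0.
by rewrite /expcoef /= expr0n /= mul0r rmorph0 mul0r.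
Qed.

Lemma gshift_gshift c c' F : gshift c (gshift c' F) = gshift (c + c') F.
Proof.
move: F; apply: epslinear_ext => [||a]; try exact: epslinear_gshift.
  exact: epslinear_comp (epslinear_gshift c) (epslinear_gshift c').
apply: seriesP => n; rewrite gshift_const -expcoefD rmorph_sum mulr_suml; apply: eq_bigr => i _.
have le_in : (i <= n)%N by rewrite -ltnS.
by rewrite gshift_const iter_ddCM mulrA -rmorphM -iterD subnKC.
Qed.

Lemma iter_sdd n F k : scoef (iter n sdd F) k = iter n dd (scoef F k).
Proof. by elim: n => //= n ->. Qed.

(** Modulo eps^N the shift is a polynomial in d; hence whatever is eps-linear and commutes with
    scalars and d also commutes with shifts ([gshift_natural]). *)
Lemma gshift_trunc c N F : exists G,
  gshift c F = \sum_(i < N) eps ^+ i * (scC _ (expcoef c i) * iter i sdd F) + eps ^+ N * G.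
Proof.
set S := \sum_(i < N) _; have S0 n : (n < N)%N -> scoef (gshift c F - S) n = 0.
  move=> lt_nN; apply/eqP; rewrite scoefB scoef_sum subr_eq0; apply/eqP.
  transitivity (\sum_(i < n.+1) cC (expcoef c i) * iter i dd (scoef F (n - i)%N)).
    by [].
  rewrite (big_ord_widen N (fun i => cC (expcoef c i) * iter i dd (scoef F (n - i)%N))) //.
  rewrite big_mkcond; apply: eq_bigr => i _.
  by rewrite scoef_epsXM ltnS ltnNge; case: leqP => // _; rewrite scoefCM iter_sdd.
by exists (sdrop N (gshift c F - S)); rewrite -(sdropP S0) addrC subrK.
Qed.

End Differential.

Arguments dd {K I A} nx a.
Arguments sdd {K I A} nx F.
Arguments gshift {K I A} nx c F.

Lemma gshift_natural (K : numFieldType) (I J : choiceType) (A : free_algebra K I)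
    (B : free_algebra K J) nx nx' (T : series A -> series B) c :
    epslinear T -> (forall a F, T (scC _ a * F) = scC _ a * T F) ->
    (forall F, T (sdd nx F) = sdd nx' (T F)) ->
  forall F, T (gshift nx c F) = gshift nx' c (T F).
Proof.
move=> lT TC Tdd F; apply: eq_mod_epsX => N.
have [G ->] := gshift_trunc nx c N F; have [H ->] := gshift_trunc nx' c N (T F).
exists (T G - H); rewrite (proj1 lT) epslinear_sum // epslinearX // mulrBr opprD addrACA.
rewrite -sumrB big1 ?add0r // => i _; rewrite epslinearX // TC.
have -> : T (iter i (sdd nx) F) = iter i (sdd nx') (T F) by elim: (i : nat) => //= n <-.
by rewrite subrr.
Qed.

(** * Differential polynomials in one variable *)

Section OneVariable.
Context (K : numFieldType) (A : free_algebra K nat).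
Implicit Types (f g L M : A).

Local Notation d := (dd (A := A) succn).
Local Notation X k := (fa_X A k).

Lemma der0 f : der (fun=> 0) f = 0.
Proof.
move: f; apply: (@fa_der_ext _ _ _ _ id) => [||c|i].
- exact: der_along.
- by split=> [f g|f g]; rewrite ?addr0 // mul0r mulr0 addr0.
- exact: derC.
- exact: derX.
Qed.

Lemma der_scale a x f : der (fun i => a * x i) f = a * der x f.
Proof.
move: f; apply: (@fa_der_ext _ _ _ _ id _ (fun f => a * der x f)) => [||c|i].
- exact: der_along.
- split=> [f g|f g]; first by rewrite derD mulrDr.
  by rewrite derM; ring.
- by rewrite !derC mulr0.
- by rewrite !derX.
Qed.

Lemma derN x f : der (fun i => - x i) f = - der x f.
Proof. by rewrite -mulN1r -der_scale; congr der; apply/funext => i; rewrite mulN1r. Qed.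

Lemma der_add x y f : der (fun i => x i + y i) f = der x f + der y f.
Proof.
move: f; apply: (@fa_der_ext _ _ _ _ id _ (fun f => der x f + der y f)) => [||c|i].
- exact: der_along.
- split=> [f g|f g]; first by rewrite !derD addrACA.
  by rewrite !derM; ring.
- by rewrite !derC addr0.
- by rewrite !derX.
Qed.

Lemma fpartX k i : fpart k (X i) = (k == i)%:R.
Proof. exact: derX. Qed.

Lemma fpartC k c : fpart k (cC c) = 0 :> A.
Proof. exact: derC. Qed.

Lemma fpartD k f g : fpart k (f + g) = fpart k f + fpart k g.
Proof. exact: derD. Qed.

Lemma fpartCM k c f : fpart k (cC c * f) = cC c * fpart k f.
Proof. exact: derCM. Qed.

Lemma fpartM k f g : fpart k (f * g) = fpart k f * g + f * fpart k g.
Proof. exact: derM. Qed.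

Lemma der_bool x (b : bool) : der x (b%:R : A) = 0.
Proof. by case: b; rewrite ?raddf0 // -(rmorph1 (@cC _ _ A)) derC. Qed.

Lemma fpart_bool k (b : bool) : fpart k (b%:R : A) = 0.
Proof. exact: der_bool. Qed.

Lemma fpart_der k x f :
  fpart k (der x f) = der x (fpart k f) + der (fun i => fpart k (x i)) f.
Proof.
apply/eqP; rewrite addrC -subr_eq; apply/eqP; rewrite der_comm; congr der.
by apply/funext => i; rewrite der_bool subr0.
Qed.

Lemma fpart_comm i j f : fpart i (fpart j f) = fpart j (fpart i f).
Proof.
rewrite fpart_der addrC -[RHS]add0r; congr (_ + _); rewrite -[RHS](der0 f); congr der.
by apply/funext => k; rewrite [fpart _ _]der_bool.
Qed.

(** The derivative by X (k - 1), read as 0 for k = 0. This is the correction term in commuting d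
    past [fpart k]. *)
Definition fprev k : A -> A := der (fun i => (k == i.+1)%:R).

Lemma fprevS k f : fprev k.+1 f = fpart k f. Proof. by []. Qed.

Lemma fprev0 f : fprev 0 f = 0. Proof. exact: der0. Qed.

Lemma fpart_d k f : fpart k (d f) = d (fpart k f) + fprev k f.
Proof.
by rewrite fpart_der; congr (_ + _); congr der; apply/funext => i; rewrite fpartX.
Qed.

Lemma dX k : d (X k) = X k.+1.
Proof. exact: derX. Qed.

Lemma iter_dX n k : iter n d (X k) = X (n + k)%N.
Proof. by elim: n => //= n ->; rewrite dX. Qed.

Lemma dC c : d (cC c) = 0 :> A.
Proof. exact: derC. Qed.

Lemma dCM c f : d (cC c * f) = cC c * d f.
Proof. exact: derCM. Qed.

Lemma dM f g : d (f * g) = d f * g + f * d g.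
Proof. exact: derM. Qed.

Definition aug : A -> K := fa_subst (idfun : {rmorphism K -> K}) (fun=> 0).
HB.instance Definition _ := GRing.RMorphism.on aug.

Lemma augC c : aug (cC c) = c. Proof. exact: fa_substC. Qed.

Lemma augX k : aug (X k) = 0. Proof. exact: fa_substX. Qed.

Lemma augD f g : aug (f + g) = aug f + aug g. Proof. exact: rmorphD. Qed.

Lemma augM f g : aug (f * g) = aug f * aug g. Proof. exact: rmorphM. Qed.

Lemma aug_bool (b : bool) : aug b%:R = b%:R. Proof. exact: rmorph_nat. Qed.

Lemma aug_d f : aug (d f) = 0.
Proof.
move: f; apply: (@fa_der_ext _ _ _ _ aug (aug \o d) (fun=> 0)) => [||c|i] /=.
- by split=> [f g|f g] /=; rewrite ?raddfD // dM rmorphD !rmorphM.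
- by split=> [f g|f g]; rewrite ?addr0 // mul0r mulr0 addr0.
- by rewrite dC raddf0.
- by rewrite dX augX.
Qed.

Lemma aug_der0 x f : (forall i, aug (x i) = 0) -> aug (der x f) = 0.
Proof.
move=> x0; move: f; apply: (@fa_der_ext _ _ _ _ aug (aug \o der x) (fun=> 0)) => [||c|i] /=.
- by split=> [f g|f g] /=; rewrite ?raddfD // derM rmorphD !rmorphM.
- by split=> [f g|f g]; rewrite ?addr0 // mul0r mulr0 addr0.
- by rewrite derC raddf0.
- by rewrite derX x0.
Qed.

Lemma aug_der n x f : (forall i, i != n -> aug (x i) = 0) ->
  aug (der x f) = aug (x n) * aug (fpart n f).
Proof.
move=> x0; move: f.
apply: (@fa_der_ext _ _ _ _ aug (aug \o der x) (fun f => aug (x n) * aug (fpart n f)))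
    => [||c|i] /=.
- by split=> [f g|f g] /=; rewrite ?raddfD // derM rmorphD !rmorphM.
- split=> [f g|f g]; first by rewrite !raddfD /= mulrDr.
  by rewrite fpartM rmorphD !rmorphM; ring.
- by rewrite derC fpartC !raddf0 mulr0.
- rewrite derX fpartX rmorph_nat; have [->|ni] := eqVneq n i; first by rewrite mulr1.
  by rewrite mulr0 x0 // eq_sym.
Qed.

(* The linear part, with the generator k read as 'X^k. *)
Definition lin : A -> {poly K} :=
  fa_der (polyC \o aug : {rmorphism A -> {poly K}}) (fun k => 'X^k).

Lemma lin_along : derivation_along (polyC \o aug) lin.
Proof. exact: fa_der_along. Qed.

Lemma linD f g : lin (f + g) = lin f + lin g.
Proof. exact: (proj1 lin_along). Qed.

Lemma lin_is_additive : additive lin.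
Proof. by move=> f g; apply: (addIr (lin g)); rewrite -linD !subrK. Qed.
HB.instance Definition _ := GRing.isAdditive.Build _ _ lin lin_is_additive.

Lemma linM f g : lin (f * g) = lin f * (aug g)%:P + (aug f)%:P * lin g.
Proof. exact: (proj2 lin_along). Qed.

Lemma linC c : lin (cC c) = 0.
Proof. exact: (fa_derC (polyC \o aug : {rmorphism A -> {poly K}})). Qed.

Lemma linX k : lin (X k) = 'X^k.
Proof. exact: (fa_derX (polyC \o aug : {rmorphism A -> {poly K}})). Qed.

Lemma linCM c f : lin (cC c * f) = c%:P * lin f.
Proof. by rewrite linM linC mul0r add0r augC. Qed.

Lemma lin_d f : lin (d f) = 'X * lin f.
Proof.
move: f; apply: (@fa_der_ext _ _ _ _ (polyC \o aug) (lin \o d) (fun f => 'X * lin f))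
    => [||c|i] /=.
- by split=> [f g|f g] /=; rewrite ?raddfD //= dM linD !linM !aug_d !polyC0 mulr0 mul0r add0r addr0.
- split=> [f g|f g]; first by rewrite linD mulrDr.
  by rewrite linM /=; ring.
- by rewrite dC linC raddf0 mulr0.
- by rewrite dX !linX exprS.
Qed.

Lemma lin_iter_d n f : lin (iter n d f) = 'X^n * lin f.
Proof. by elim: n => [|n IHn] /=; rewrite ?expr0 ?mul1r // lin_d IHn exprS mulrA. Qed.

Lemma coef_lin f k : (lin f)`_k = aug (fpart k f).
Proof.
move: f; apply: (@fa_der_ext _ _ _ _ aug (fun f => (lin f)`_k) (fun f => aug (fpart k f)))
    => [||c|i] /=.
- by split=> [f g|f g]; rewrite ?linD ?coefD // linM coefD coefMC coefCM.
- by split=> [f g|f g]; rewrite ?raddfD // fpartM rmorphD !rmorphM.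
- by rewrite linC fpartC raddf0 coef0.
- by rewrite linX fpartX rmorph_nat coefXn.
Qed.

Lemma order_finite f : exists n, forall k, (n <= k)%N -> fpart k f = 0.
Proof.
move: f; apply: fa_ind => [c|i|f g [n fn] [m gm]|f g [n fn] [m gm]].
- by exists 0%N => k _; rewrite fpartC.
- by exists i.+1 => k ik; rewrite fpartX gtn_eqF.
- exists (maxn n m) => k; rewrite geq_max => /andP[nk mk].
  by rewrite raddfD /= fn // gm // addr0.
- exists (maxn n m) => k; rewrite geq_max => /andP[nk mk].
  by rewrite fpartM fn // gm // mul0r mulr0 addr0.
Qed.

(** Descending induction on the order, started by [order_finite]. *)
Lemma order_ind f :
    (forall n, (forall k, (n < k)%N -> fpart k f = 0) -> fpart n f = 0) ->
  forall k, fpart k f = 0.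
Proof.
move=> step; have [n fn] := order_finite f.
suff H m : (m <= n)%N -> forall k, (n - m <= k)%N -> fpart k f = 0.
  by move=> k; apply: (H n) => //; rewrite subnn.
elim: m => [|m IHm] le_mn k; first by rewrite subn0; exact: fn.
rewrite leq_eqVlt => /orP[/eqP <-|].
  by apply: step => j; rewrite -subSS subnSK //; apply: IHm; exact: ltnW.
by rewrite subnSK //; apply: IHm; exact: ltnW.
Qed.

Lemma cCK_mulrn n f : f *+ n.+1 = 0 -> f = 0.
Proof.
rewrite -mulr_natl -(rmorph_nat (@cC _ _ A)) => f0.
have nz : n.+1%:R != 0 :> K by rewrite pnatr_eq0.
by rewrite -[f]mul1r -(rmorph1 (@cC _ _ A)) -(mulVf nz) rmorphM -mulrA f0 mulr0.
Qed.

(* With [h] the substitution X k := X k * t, Euler's identity reads t (h f)' = h (E f). *)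
Lemma fpart_eq0_const f : (forall k, fpart k f = 0) -> f = cC (aug f).
Proof.
move=> f0.
pose cP : {rmorphism K -> {poly A}} := polyC \o @cC _ _ A.
pose h : {rmorphism A -> {poly A}} := fa_subst cP (fun k => (X k)%:P * 'X).
have hC c : h (cC c) = (cC c)%:P by exact: (@fa_substC _ _ A _ cP).
have hX k : h (X k) = (X k)%:P * 'X by exact: (@fa_substX _ _ A _ cP).
have euler g : (h g)^`() * 'X = h (der (fun k => X k) g).
  move: g; apply: (@fa_der_ext _ _ _ _ h (fun g => (h g)^`() * 'X)
    (h \o der (fun k => X k))) => [||c|i] /=.
  - split=> [g1 g2|g1 g2]; first by rewrite rmorphD derivD mulrDl.
    by rewrite rmorphM derivM; ring.
  - by split=> [g1 g2|g1 g2] /=; rewrite ?raddfD // derM rmorphD !rmorphM.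
  - by rewrite hC derivC mul0r derC raddf0.
  - by rewrite derX !hX derivM derivC derivX mul0r add0r mulr1.
have hf0 : (h f)^`() = 0.
  have : (h f)^`() * 'X = 0.
    rewrite euler (_ : der _ f = 0) ?raddf0 // -[RHS](der0 f).
    by apply: der_eq => i; rewrite f0.
  by move/polyP => H; apply/polyP => i; have := H i.+1; rewrite coefMX !coef0.
have hfE : h f = ((h f)`_0)%:P.
  apply/polyP => -[|i]; rewrite coefC //=; apply: (@cCK_mulrn i).
  by rewrite -coef_deriv hf0 coef0.
(* [h f] does not depend on t; at t = 1 it is f and at t = 0 it is the constant term of f. *)
have e1 : horner_eval 1 (h f) = f.
  apply: (@fa_hom_ext _ _ _ _ (horner_eval 1 \o h) idfun) => [c|k] /=.
    by rewrite hC /horner_eval hornerC.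
  by rewrite hX /horner_eval hornerM hornerC hornerX mulr1.
have e0 : horner_eval 0 (h f) = cC (aug f).
  apply: (@fa_hom_ext _ _ _ _ (horner_eval 0 \o h) (@cC _ _ A \o aug)) => [c|k] /=.
    by rewrite hC /horner_eval hornerC augC.
  by rewrite hX /horner_eval hornerM hornerC hornerX mulr0 augX rmorph0.
by rewrite -{1}e1 -e0 hfE /horner_eval !hornerC.
Qed.

(** If f has order at most n, the derivative of d f by X (n + 1) is that of f by X n, so the order
    drops until nothing but a constant remains. *)
Lemma d_eq0_const f : d f = 0 -> f = cC (aug f).
Proof.
move=> df; apply: fpart_eq0_const; apply: order_ind => n fn.
by have := fpart_d n.+1 f; rewrite fprevS df (fn n.+1) // !raddf0 add0r.
Qed.

Definition evol L : A -> A := der (fun k => iter k d L).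

Lemma evolD L M f : evol (L + M) f = evol L f + evol M f.
Proof. by rewrite /evol -der_add; congr der; apply/funext => k; rewrite iter_ddD. Qed.

Lemma evolCl c L f : evol (cC c * L) f = cC c * evol L f.
Proof. by rewrite /evol -der_scale; congr der; apply/funext => k; rewrite iter_ddCM. Qed.

Lemma aug_iter_d n f : aug f = 0 -> aug (iter n d f) = 0.
Proof. by case: n => //= n _; rewrite aug_d. Qed.

End OneVariable.

Arguments aug {K A} f.
Arguments lin {K A} f.
Arguments evol {K A} L f.

(** * Symmetries of the KdV equation *)

Section KdVSymmetries.
Context (K : numFieldType) (A : free_algebra K nat) (c : K).
Implicit Types (f g L M : A).

Local Notation d := (dd (A := A) succn).
Local Notation X k := (fa_X A k).

Definition kdv : A := X 3 + cC c * (X 1 * X 0).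

Definition kdv_symmetry M : Prop := evol kdv M = evol M kdv.

Lemma evol_kdv M : evol M kdv = d (d (d M)) + cC c * (d M * X 0 + X 1 * M).
Proof. by rewrite /evol derD derX derCM derM !derX. Qed.

Lemma order_iter_d p f : (forall j, (p <= j)%N -> fpart j f = 0) ->
  forall k j, (p + k <= j)%N -> fpart j (iter k d f) = 0.
Proof.
move=> f0; elim=> [|k IHk] j; first by rewrite addn0; exact: f0.
rewrite addnS; case: j => // j; rewrite ltnS => pkj.
by rewrite iterS fpart_d fprevS !IHk ?raddf0 ?addr0 // leqW.
Qed.

Lemma iter_d_kdv k : iter k d kdv = X (k + 3)%N + cC c * iter k d (X 1 * X 0).
Proof. by rewrite iter_ddD iter_dX iter_ddCM. Qed.

Lemma order_X1X0 j : (2 <= j)%N -> fpart j (X 1 * X 0) = 0 :> A.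
Proof.
by case: j => [|[|j]] // _; rewrite fpartM !fpartX mul0r mulr0 addr0.
Qed.

(* Compare the derivatives of both sides of the symmetry equation by the variable n + 2. *)
Lemma kdv_symmetry_fpart_const M n : kdv_symmetry M ->
  (forall k, (n < k)%N -> fpart k M = 0) -> d (fpart n M) = 0.
Proof.
move=> /(congr1 (fpart n.+2)) sM Mn; move: sM.
have M1 : fpart n.+1 M = 0 by exact: Mn.
have M2 : fpart n.+2 M = 0 by apply: Mn; exact: leqW.
rewrite evol_kdv fpart_der M2 raddf0 add0r.
(* For k <= n only the term X (k + 3) of the k-th derivative of [kdv] reaches order n + 2; the
   product term has order k + 1. *)
have -> : der (fun k => fpart n.+2 (iter k d kdv)) M = fprev n M.
  apply: der_eq => k /eqP kM; have le_kn : (k <= n)%N.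
    by rewrite leqNgt; apply: contraNN kM => /Mn ->.
  rewrite iter_d_kdv raddfD /= fpartX fpartCM (order_iter_d order_X1X0) ?add2n ?ltnS //.
  by rewrite mulr0 addr0 addn3 !eqSS.
rewrite raddfD /= fpartCM raddfD /= !fpartM !fpartX M2 !fpart_d !fprevS !raddfD /=.
rewrite !fpart_d !fprevS !raddfD /= M1 M2 !raddf0.
rewrite !(mul0r, mulr0, addr0, add0r) fpart_d; move: (d _) (fprev n M) => D P H.
(* What is left is P = 3 D + P. The argument 2 of [cCK_mulrn] stands for the multiplier 3. *)
by apply: (@cCK_mulrn _ _ 2); apply: (addIr P); rewrite add0r {2}H; ring.
Qed.

(** The derivative of M by its highest variable is a constant, hence a coefficient of the linear
    part, hence 0. By descent M is a constant m, and then the symmetry equation reads 0 = c m X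
    1. *)
Lemma kdv_symmetry_eq0 M : c != 0 -> kdv_symmetry M -> lin M = 0 -> M = 0.
Proof.
move=> c0 sM lM.
have /fpart_eq0_const M0 : forall k, fpart k M = 0.
  apply: order_ind => n Mn.
  have := d_eq0_const (kdv_symmetry_fpart_const sM Mn).
  by rewrite -coef_lin lM coef0 rmorph0.
move: sM; rewrite M0; set m := aug M => sM.
suff /eqP : c * m = 0.
  by rewrite mulf_eq0 (negPf c0) => /eqP ->; rewrite rmorph0.
have := congr1 (fun f => aug (fpart 1 f)) sM.
rewrite /evol derC -/(evol _ _) evol_kdv !dC !raddf0 mul0r !add0r fpartCM fpartM fpartX fpartC.
by rewrite mul1r mulr0 addr0 -rmorphM augC => <-.
Qed.

(* Galilean invariance: the bracket of d/dw^(0) with the KdV flow is a multiple of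
   the translation. *)
Lemma kdv_symmetry_fpart0 M : kdv_symmetry M -> kdv_symmetry (fpart 0 M).
Proof.
move=> /(congr1 (fpart 0)); rewrite /kdv_symmetry !evol_kdv fpart_der.
have fpart0_iter k f : fpart 0 (iter k d f) = iter k d (fpart 0 f).
  by elim: k => //= k <-; rewrite fpart_d fprev0 addr0.
have -> : (fun k => fpart 0 (iter k d kdv)) = (fun k => cC c * X k.+1).
  apply/funext => k; rewrite fpart0_iter raddfD /= fpartX fpartCM fpartM !fpartX.
  by rewrite mul0r mulr1 !add0r iter_ddCM iter_dX addn1.
rewrite der_scale -/(dd succn M) raddfD /= fpartCM raddfD /= !fpartM !fpartX.
have dE f : fpart 0 (d f) = d (fpart 0 f) by exact: (fpart0_iter 1).
rewrite !dE -/(evol _ _) /= mulr1n mulr0n => H.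
by apply: (addIr (cC c * d M)); rewrite H; ring.
Qed.

(** The coefficient of the quadratic monomial X i * X n, doubled when i = n. *)
Let T i n f : K := aug (fpart i (fpart n f)).

Let T0d n f : T 0 n (d f) = aug (fpart 0 (fprev n f)).
Proof. by rewrite /T fpart_d raddfD /= rmorphD /= fpart_d fprev0 addr0 aug_d add0r. Qed.

Let T1d n f : T 1 n (d f) = T 0 n f + aug (fpart 1 (fprev n f)).
Proof. by rewrite /T fpart_d raddfD /= rmorphD /= fpart_d fprevS rmorphD /= aug_d add0r. Qed.

Let T0_X1X0 k n : T 0 n (iter k d (X 1 * X 0)) = (n == k.+1)%:R.
Proof.
elim: k n => [|k IHk] n /=.
  rewrite /T fpartM !fpartX raddfD /= !fpartM !fpart_bool !fpartX.
  case: n => [|[|n]] /=; rewrite ?mulr1n ?mulr0n !(mul0r, mulr0, addr0, add0r, mulr1, mul1r);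
    by rewrite ?rmorph0 ?rmorph1.
rewrite T0d; case: n => [|n]; first by rewrite fprev0 !raddf0.
by rewrite fprevS -/(T 0 n _) IHk.
Qed.

(** In accordance with X 1 * X 0 = d (X 0 ^ 2) / 2: the factor k + 1 is the binomial coefficient of
    the (k + 1)-st derivative of a square. *)
Let T1_X1X0 k n : T 1 n (iter k d (X 1 * X 0)) = (n == k)%:R * k.+1%:R.
Proof.
elim: k n => [|k IHk] n /=.
  rewrite /T fpartM !fpartX raddfD /= !fpartM !fpart_bool !fpartX.
  case: n => [|[|n]] /=; rewrite ?mulr1n ?mulr0n !(mul0r, mulr0, addr0, add0r, mulr1, mul1r);
    by rewrite ?rmorph0 ?rmorph1.
rewrite T1d T0_X1X0; case: n => [|n]; first by rewrite fprev0 !raddf0 addr0 mul0r.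
rewrite fprevS -/(T 1 n _) IHk !eqSS; case: eqP => _; last by rewrite !mul0r addr0.
by rewrite !mul1r -natrD add1n.
Qed.

Let aug_fpart_kdv j k : aug (fpart j (iter k d kdv)) = (j == k + 3)%N%:R.
Proof.
rewrite -coef_lin lin_iter_d linD linX linCM linM !augX !polyC0 mulr0 mul0r addr0.
by rewrite mulr0 addr0 -exprD coefXn.
Qed.

Let T_kdv n k : T 1 n (iter k d kdv) = c * ((n == k)%:R * k.+1%:R).
Proof.
rewrite -T1_X1X0 iter_d_kdv /T !raddfD /= !fpartCM rmorphM /= augC.
by rewrite fpartX fpart_bool rmorph0 add0r.
Qed.

Let aug_der_eq x y f : (forall i, aug (x i) = aug (y i)) -> aug (der x f) = aug (der y f).
Proof.
move=> xy; apply/eqP; rewrite -subr_eq0 -rmorphB /= -derN -der_add aug_der0 // => i.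
by rewrite rmorphB /= xy subrr.
Qed.

(* The coefficients of the quadratic monomial X 1 * X (n + 2) in the symmetry equation. *)
Lemma kdv_symmetry_lin M n : kdv_symmetry M ->
  n.+2%:R * c * (lin M)`_n.+2 = 3%:R * (lin (fpart 0 M))`_n.
Proof.
move=> /(congr1 (T 1 n.+2)); rewrite evol_kdv => sM; rewrite !coef_lin.
have e0 k : aug (iter k d kdv) = 0.
  by apply: aug_iter_d; rewrite rmorphD !rmorphM /= !augX !mulr0 addr0.
(* Two sources: the quadratic part of M moved by the linear part of [kdv], and the linear part of M
   moved by the quadratic part of [kdv]. *)
have lhs : T 1 n.+2 (evol kdv M)
    = aug (fpart 1 (fprev n M)) + c * n.+3%:R * aug (fpart n.+2 M).
  rewrite /T /evol (fpart_der n.+2) raddfD /= (fpart_der 1 _ (fpart n.+2 M)) !rmorphD /=.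
  rewrite [Y in Y + _ + _]aug_der0 // add0r [Y in Y + _]aug_der0 ?add0r => [|i]; last first.
    by rewrite aug_fpart_kdv addnC.
  rewrite (fpart_der 1) rmorphD /= [Y in _ + Y = _](@aug_der _ _ n.+2) => [|i ni].
    have := T_kdv n.+2 n.+2; rewrite /T eqxx mul1r => ->; congr (_ + _).
    rewrite (@aug_der_eq _ (fun i => (n == i.+1)%:R)) => [|i]; last first.
      by rewrite aug_fpart_kdv rmorph_nat addnC.
    rewrite -/(fprev n _); case: n {sM} => [|n]; first by rewrite !fprev0 !raddf0.
    by rewrite !fprevS fpart_comm.
  by have := T_kdv n.+2 i; rewrite /T eq_sym (negPf ni) mul0r mulr0.
have rhs : T 1 n.+2 (d (d (d M)) + cC c * (d M * X 0 + X 1 * M))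
    = 3%:R * T 0 n M + aug (fpart 1 (fprev n M)) + c * aug (fpart n.+2 M).
  have -> : T 1 n.+2 (d (d (d M)) + cC c * (d M * X 0 + X 1 * M))
      = T 1 n.+2 (d (d (d M))) + c * T 1 n.+2 (d M * X 0 + X 1 * M).
    by rewrite /T raddfD /= fpartCM raddfD /= fpartCM rmorphD /= rmorphM /= augC.
  congr (_ + c * _).
    rewrite T1d fprevS -/(T 1 _ _) T0d fprevS -/(T 0 _ _) T0d fprevS -/(T 0 _ _).
    rewrite T1d fprevS -/(T 1 _ _) T0d fprevS -/(T 0 _ _) T1d; ring.
  rewrite /T raddfD /= !fpartM !fpartX !mulr0 mul0r addr0 add0r raddfD /= !fpartM !fpartX.
  by rewrite !rmorphD !rmorphM /= !augX /= rmorph0 rmorph1 !(mulr0, mul0r, addr0, add0r) mul1r.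
move: sM; rewrite lhs rhs -addrA [Y in _ = Y]addrCA => /addrI; rewrite {1}/T fpart_comm.
move: (aug (fpart n.+2 M)) (aug (fpart n (fpart 0 M))) => u v.
rewrite -[n.+3%:R]natr1 => H; apply: (addIr (c * u)); rewrite -H; ring.
Qed.

(** Compare the coefficients of X 1: the constant term m of M contributes c m through X 1 * M, and
    all other linear terms in the equation have order at least 3. *)
Lemma kdv_symmetry_aug M : c != 0 -> kdv_symmetry M -> aug M = 0.
Proof.
move=> c0 /(congr1 (aug \o fpart 1)) /=; rewrite /evol fpart_der rmorphD /=.
have e0 k : aug (iter k d kdv) = 0.
  by apply: aug_iter_d; rewrite rmorphD !rmorphM /= !augX !mulr0 addr0.
rewrite aug_der0 // add0r aug_der0 => [|i]; last by rewrite aug_fpart_kdv addnC.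
rewrite -[der _ kdv]/(evol M kdv) evol_kdv fpartD fpartCM fpartD !fpartM !fpartX !fpart_d !fprevS.
rewrite !fpart_d !fprev0.
rewrite !addr0 !(augD, augM, augX, augC, aug_bool, aug_d) /=.
rewrite !(mulr0, mul0r, addr0, add0r) mul1r => /esym/eqP.
by rewrite mulf_eq0 (negPf c0) => /eqP.
Qed.

(** Descent by two degrees along [kdv_symmetry_lin]; at the bottom stands the constant term of the
    symmetry [fpart 0 M]. *)
Lemma kdv_symmetry_even M n : c != 0 -> kdv_symmetry M -> (lin M)`_(n.*2) = 0.
Proof.
move=> c0; elim: n M => [|n IHn] M sM; have sM0 := kdv_symmetry_fpart0 sM.
  by rewrite coef_lin kdv_symmetry_aug.
have := kdv_symmetry_lin n.*2 sM; rewrite -doubleS IHn // mulr0 => /eqP.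
by rewrite !mulf_eq0 (negPf c0) pnatr_eq0 orbF => /orP[|/eqP].
Qed.

End KdVSymmetries.

Arguments kdv {K A} c.

(** * The Volterra lattice *)

Section VolterraLattice.
Context (R : comNzRingType).
Implicit Types (a : int -> R) (n m : int).

(* Entries of the p-th power of the matrix with entries 1 below the diagonal and - a n
   at (n, n + 1). *)
Fixpoint vmx a p n m : R :=
  if p is p'.+1 then vmx a p' (n - 1) m - a n * vmx a p' (n + 1) m else (n == m)%:R.

Lemma vmxS a p n m : vmx a p.+1 n m = vmx a p (n - 1) m - a n * vmx a p (n + 1) m.
Proof. by []. Qed.

(** A matrix commutes with its powers: [vmx] multiplies on the left, this recursion on the right. *)
Lemma vmxSr a p n m : vmx a p.+1 n m = vmx a p n (m + 1) - a (m - 1) * vmx a p n (m - 1).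
Proof.
elim: p n => [|p IHp] n; last first.
  by rewrite [LHS]vmxS !IHp !vmxS; ring.
rewrite /= subr_eq; congr (_ - _).
have -> : (n + 1 == m) = (n == m - 1) by rewrite eq_sym -subr_eq eq_sym.
by have [->|] := eqVneq n (m - 1); rewrite ?mulr0.
Qed.

(** The square couples only sites of equal parity, so its even rows form a tridiagonal matrix of
    their own. *)
Lemma vmxSS a p n m : vmx a p.+2 n m
  = vmx a p (n - 2) m - (a (n - 1) + a n) * vmx a p n m + a n * a (n + 1) * vmx a p (n + 2) m.
Proof.
rewrite !vmxS; have -> : n - 1 - 1 = n - 2 by ring.
have -> : n + 1 + 1 = n + 2 by ring.
by rewrite subrK addrK; ring.
Qed.

Lemma vmx_band a p n m : n + p%:Z < m -> vmx a p n m = 0.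
Proof.
elim: p n => [|p IHp] n lt_npm.
  by rewrite /= (_ : n == m = false) //; apply/eqP; lia.
by rewrite vmxS !IHp ?mulr0 ?subr0 //; lia.
Qed.

Lemma vmx_shift a c p n m : vmx a p (n + c) (m + c) = vmx (fun i => a (i + c)) p n m.
Proof.
elim: p n => [|p IHp] n /=; first by rewrite (inj_eq (addIr c)).
by rewrite -!IHp (addrAC n (-1)) (addrAC n 1).
Qed.

(** The unit on the outermost diagonal that makes the linear parts of the flows triangular in
    [lin_span_Qodd]. *)
Lemma vmx_top p n : vmx (fun=> 1) p n (n + p%:Z) = (-1) ^+ p.
Proof.
elim: p n => [|p IHp] n; first by rewrite addr0 /= eqxx.
rewrite vmxS vmx_band ?sub0r ?mul1r; last by lia.
have -> : n + p.+1%:Z = n + 1 + p%:Z by rewrite intS; ring.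
by rewrite IHp exprS mulN1r.
Qed.

(* The flow of the 2k-th power on the variable a n. *)
Definition volterra a k n : R := vmx a k.*2 n (n + 2) - vmx a k.*2 (n - 1) (n + 1).

(** Left and right multiplication compared at the entry (n, n + 1) of the next power. *)
Lemma volterraE a k n :
  volterra a k n = a n * (vmx a k.*2 n n - vmx a k.*2 (n + 1) (n + 1)).
Proof.
have := vmxSr a k.*2 n (n + 1); rewrite vmxS addrK.
have -> : n + 1 + 1 = n + 2 by ring.
by move=> /eqP; rewrite /volterra -subr_eq0 => /eqP H; apply/eqP;
  rewrite -subr_eq0 -oppr_eq0; apply/eqP; rewrite -H; ring.
Qed.

Lemma vmx_perturb e (b : int -> R) p n m :
  exists h, vmx (fun i => 1 + e * b i) p n m = vmx (fun=> 1) p n m + e * h.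
Proof.
elim: p n => [|p IHp] n; first by exists 0; rewrite mulr0 addr0.
have [[h1 h1E] [h2 h2E]] := (IHp (n - 1), IHp (n + 1)).
exists (h1 - b n * vmx (fun=> 1) p (n + 1) m - (1 + e * b n) * h2).
by rewrite !vmxS h1E h2E; ring.
Qed.

(** On the constant lattice the two entries in [volterra] are translates of each other and cancel.
    With e = eps^2 this makes the division in [beta] exact. *)
Lemma volterra_perturb e (b : int -> R) k n :
  exists h, volterra (fun i => 1 + e * b i) k n = e * h.
Proof.
rewrite /volterra.
have [h1 ->] := vmx_perturb e b k.*2 n (n + 2).
have [h2 ->] := vmx_perturb e b k.*2 (n - 1) (n + 1).
have -> : n + 1 = n + 2 + (-1) by ring.
by rewrite (vmx_shift _ (-1) k.*2 n (n + 2)); exists (h1 - h2); ring.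
Qed.

Section Toda.
Context (a : int -> R) (C : nat -> int -> int -> R).
Hypothesis C0 : forall i j, C 0 i j = (i == j)%:R.
Hypothesis CS : forall k i j, C k.+1 i j =
  C k (i - 1) j - (a (2 * i - 1) + a (2 * i)) * C k i j
  + a (2 * i) * a (2 * i + 1) * C k (i + 1) j.

Lemma toda_vmx k i j : C k i j = vmx a k.*2 (2 * i) (2 * j).
Proof.
elim: k i => [|k IHk] i.
  by rewrite C0 /= (inj_eq (mulfI _)).
by rewrite doubleS vmxSS CS !IHk mulrBr mulrDr mulr1.
Qed.

(** On the left stands P_k, on the right the Volterra derivative of X_0 = - (a_{-1} + a_0). *)
Lemma toda_volterra0 k : C k (-1) 0 - C k 0 1 = - (volterra a k (-1) + volterra a k 0).
Proof. by rewrite !toda_vmx /volterra; ring. Qed.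

(** On the left stands Q_k, on the right the Leibniz derivative of Y_0 = a_0 a_1. *)
Lemma toda_volterra1 k :
  C k (-1) 1 - C k 0 2 + (- (a (-1) + a 0) + (a 1 + a 2)) * C k 0 1
  = volterra a k 0 * a 1 + a 0 * volterra a k 1.
Proof.
rewrite !toda_vmx /volterra.
(* The entries (-1, 2) and (0, 3) of the (2k + 1)-st power, each computed by left and by right
   multiplication, supply the two missing relations. *)
have := vmxSr a k.*2 (-1) 2; rewrite vmxS => /eqP; rewrite -subr_eq0 => /eqP e1.
have := vmxSr a k.*2 0 3; rewrite vmxS => /eqP; rewrite -subr_eq0 => /eqP e2.
apply/eqP; rewrite -subr_eq0; apply/eqP.
rewrite -[RHS](addr0 0) -{1}e1 -e2 /=.
ring.
Qed.

End Toda.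

Section FlowsCommute.
Context (a : int -> R) (D : R -> R).
Hypothesis DD : {morph D : f g / f + g}.
Hypothesis DM : forall f g, D (f * g) = D f * g + f * D g.

Let D0 : D 0 = 0. Proof. by apply: (addrI (D 0)); rewrite -DD !addr0. Qed.
Let D1 : D 1 = 0.
Proof. by apply: (addrI (D 1)); rewrite addr0 -{3}(mulr1 1) DM mulr1 mul1r. Qed.
Let DB f g : D (f - g) = D f - D g.
Proof. by apply: (addIr (D g)); rewrite -DD !subrK. Qed.

(** The Lax equation D (M^p) = M^p B - B M^p, where B has the entries a n * a (n + 1) at (n, n + 2),
    the upper part of M^2. It passes from p to p + 1 by the recursion. *)
Lemma first_flow_vmx : (forall n, D (a n) = a n * (a (n + 1) - a (n - 1))) ->
  forall p n m, D (vmx a p n m)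
    = vmx a p n (m - 2) * (a (m - 2) * a (m - 1)) - a n * a (n + 1) * vmx a p (n + 2) m.
Proof.
move=> Da; elim=> [|p IHp] n m.
  rewrite /= (_ : D _ = 0); last by case: eqP; rewrite ?D0 ?D1.
  rewrite eq_sym subr_eq eq_sym; case: eqP => [<-|_]; last by rewrite mulr0 mul0r subrr.
  have -> : n + 2 - 2 = n by ring.
  have -> : n + 2 - 1 = n + 1 by ring.
  by rewrite mul1r mulr1 subrr.
rewrite !vmxS DB DM Da !IHp.
have -> : n + 2 - 1 = n + 1 by ring.
have -> : n - 1 + 1 = n by ring.
have -> : n - 1 + 2 = n + 1 by ring.
have -> : n + 1 + 1 = n + 2 by ring.
have -> : n + 2 + 1 = n + 1 + 2 by ring.
ring.
Qed.

(** Applied to the off-diagonal form of [volterra], the Lax equation leaves only diagonal entries of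
    M^(2k); [volterraE] writes the other order of derivations in the same entries. *)
Lemma volterra_flows_commute (D' : R -> R) k :
    {morph D' : f g / f + g} -> (forall f g, D' (f * g) = D' f * g + f * D' g) ->
    (forall n, D (a n) = a n * (a (n + 1) - a (n - 1))) ->
    (forall n, D' (a n) = volterra a k n) ->
  forall n, D (D' (a n)) = D' (D (a n)).
Proof.
move=> DD' DM' Da Da' n.
have DB' f g : D' (f - g) = D' f - D' g.
  by apply: (addIr (D' g)); rewrite -DD' !subrK.
rewrite Da' Da DM' DB' !Da' {1}/volterra DB !(first_flow_vmx Da) !volterraE.
have -> : n + 2 - 2 = n by ring.
have -> : n + 2 - 1 = n + 1 by ring.
have -> : n - 1 + 1 = n by ring.
have -> : n + 1 - 2 = n - 1 by ring.
have -> : n + 1 - 1 = n by ring.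
have -> : n - 1 + 2 = n + 1 by ring.
have -> : n + 1 + 1 = n + 2 by ring.
ring.
Qed.

End FlowsCommute.

Lemma volterra1 a n : volterra a 1 n = a n * (a (n + 1) - a (n - 1)).
Proof.
rewrite volterraE !vmxS /=.
rewrite !(addrK, subrK) !eqxx.
have -> : (n - 1 - 1 == n) = false by apply/eqP; lia.
have -> : (n + 1 + 1 == n) = false by apply/eqP; lia.
have -> : (n - 1 == n + 1) = false by apply/eqP; lia.
have -> : (n + 1 + 1 + 1 == n + 1) = false by apply/eqP; lia.
by rewrite /= mulr1n mulr0n; ring.
Qed.

End VolterraLattice.

Lemma rmorph_vmx (R S : comNzRingType) (f : {rmorphism R -> S}) a p n m :
  f (vmx a p n m) = vmx (f \o a) p n m.
Proof.
elim: p n => [|p IHp] n /=; first by rewrite rmorph_nat.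
by rewrite rmorphB rmorphM !IHp.
Qed.

(** * The reduction to one field *)

Section Reduction.
Context (K : numFieldType) (A : free_algebra K nat).
Implicit Types (F G H L M : series A) (n : int).

Local Notation sd := (sdd (A := A) succn).
Local Notation w := (sconst (fa_X A 0)).

(** The fixed point theorem for the eps-adic distance: coefficient n of the iterates is stable from
    step n + 1 on, so the limit is read off diagonally. *)
Lemma contraction_fixpoint (Psi : series A -> series A) :
    (forall k F G H, F - G = eps ^+ k * H -> exists H', Psi F - Psi G = eps ^+ k.+1 * H') ->
  exists b, Psi b = b.
Proof.
move=> contr; pose x := fun m => iter m Psi 0.
have agree F G k : (forall i, (i < k)%N -> scoef F i = scoef G i) ->
    forall i, (i < k.+1)%N -> scoef (Psi F) i = scoef (Psi G) i.
  move=> FG; have /sdropP/contr[H' PsiE] i : (i < k)%N -> scoef (F - G) i = 0.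
    by move=> /FG; rewrite scoefB => ->; rewrite subrr.
  move=> i lt_ik; apply/eqP; rewrite -subr_eq0 -scoefB PsiE scoef_epsXM lt_ik //.
have xS m : forall i, (i < m)%N -> scoef (x m) i = scoef (x m.+1) i.
  by elim: m => // m IHm; apply: agree.
have x_stable i m : (i < m)%N -> scoef (x m) i = scoef (x i.+1) i.
  elim: m => // m IHm; rewrite ltnS leq_eqVlt => /orP[/eqP -> //|lt_im].
  by rewrite -xS // IHm.
pose b := Series (fun n : nat => scoef (x n.+1) n).
exists b; apply: seriesP => n.
have -> : scoef b n = scoef (Psi (x n)) n by [].
by apply: (agree _ _ n) => // i lt_in; rewrite [LHS]/= x_stable.
Qed.

(* exp (n eps d / 2) *)
Definition hs n : series A -> series A := gshift succn (n%:~R / 2%:R).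
HB.instance Definition _ n := GRing.RMorphism.on (hs n).

Lemma hs_hs m n F : hs m (hs n F) = hs (m + n) F.
Proof. by rewrite /hs gshift_gshift -mulrDl -rmorphD. Qed.

Lemma hs0 F : hs 0 F = F.
Proof. by rewrite /hs mul0r gshift0. Qed.

Lemma hsD n F G : hs n (F + G) = hs n F + hs n G. Proof. exact: rmorphD. Qed.
Lemma hsB n F G : hs n (F - G) = hs n F - hs n G. Proof. exact: rmorphB. Qed.
Lemma hsM n F G : hs n (F * G) = hs n F * hs n G. Proof. exact: rmorphM. Qed.
Lemma hs1 n : hs n 1 = 1. Proof. exact: rmorph1. Qed.

Lemma hs_epsX n k F : hs n (eps ^+ k * F) = eps ^+ k * hs n F.
Proof. exact: gshift_epsX. Qed.

Lemma scoef_hs0 n F : scoef (hs n F) 0 = scoef F 0.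
Proof. exact: scoef_gshift0. Qed.

Lemma hs_sub n F : exists G, hs n F - F = eps * G.
Proof.
exists (sdrop 1 (hs n F - F)); rewrite -[eps]expr1 -sdropP // => -[|//] _.
by rewrite scoefB scoef_hs0 subrr.
Qed.

(* The series b with (1 + eps^2 b) (1 + eps^2 s b) = 1 + eps^2 w, where s = exp (eps d / 2). *)
Lemma quadratic_exists :
  exists b : series A, b + hs 1 b + eps ^+ 2 * (b * hs 1 b) = w.
Proof.
have nz : 2%:R != 0 :> K by rewrite pnatr_eq0.
(* The equation solved for 2 b, with s b written as b + (s b - b); as s b - b is divisible by eps,
   [Psi] contracts. *)
pose Psi F := scC A 2%:R^-1 * (w - (hs 1 F - F) - eps ^+ 2 * (F * hs 1 F)).
have [k F G H FG|b bE] := @contraction_fixpoint Psi.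
  have FE : F = G + eps ^+ k * H by rewrite -FG addrC subrK.
  have [H' H'E] := hs_sub 1 H.
  exists (- scC A 2%:R^-1 * (H' + eps * (H * hs 1 G + G * hs 1 H + eps ^+ k * H * hs 1 H))).
  by rewrite exprS /Psi FE hsD hs_epsX -(subrK H (hs 1 H)) H'E; ring.
exists b; have : scC A 2%:R * Psi b = scC A 2%:R * b by rewrite bE.
rewrite /Psi mulrA -rmorphM divff // rmorph1 mul1r rmorph_nat => e.
apply/eqP; rewrite -subr_eq0 -(subrr (2%:R * b)) -{2}e; apply/eqP; ring.
Qed.

(** The linearised quadratic equation has no kernel: a leading coefficient of F would be annihilated
    by 2. *)
Lemma half_eq0 H H' F : F + hs 1 F + eps ^+ 2 * (F * H + H' * hs 1 F) = 0 -> F = 0.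
Proof.
move=> e; apply: contrapT => /series_neq0[k [G [FE G0]]]; apply: G0.
have : eps ^+ k * (G + hs 1 G + eps * (eps * (G * H + H' * hs 1 G))) = 0.
  by rewrite -[RHS]e FE hs_epsX; ring.
move=> /epsX_eq0 /(congr1 (fun F => scoef F 0)).
rewrite scoefD scoef_epsM addr0 scoefD scoef_hs0 scoef0 -mulr2n.
exact: (@cCK_mulrn _ _ 1).
Qed.

Definition redb : series A := xget 0 [set F | F + hs 1 F + eps ^+ 2 * (F * hs 1 F) = w]%classic.

Lemma redbE : redb + hs 1 redb + eps ^+ 2 * (redb * hs 1 redb) = w.
Proof.
by rewrite /redb; case: xgetP => [_ _ //|/(_ _)]; have [c cE] := quadratic_exists => /(_ c).
Qed.

Definition bs n := hs n redb.
Definition av n : series A := 1 + eps ^+ 2 * bs n.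

Lemma hs_bs m n : hs m (bs n) = bs (m + n). Proof. exact: hs_hs. Qed.

Lemma hs_av m n : hs m (av n) = av (m + n).
Proof. by rewrite /av hsD hs1 hs_epsX hs_bs. Qed.

Lemma hs_w n : hs n w = bs n + bs (n + 1) + eps ^+ 2 * (bs n * bs (n + 1)).
Proof. by rewrite -redbE !hsD hs_epsX hsM !hs_hs. Qed.

Lemma av_mul n : av n * av (n + 1) = 1 + eps ^+ 2 * hs n w.
Proof. by rewrite hs_w /av; ring. Qed.

Lemma hs_vmx c p m n : hs c (vmx av p m n) = vmx av p (m + c) (n + c).
Proof.
rewrite vmx_shift rmorph_vmx; congr vmx; apply/funext => i /=.
by rewrite hs_av addrC.
Qed.

Lemma hs_volterra c k n : hs c (volterra av k n) = volterra av k (n + c).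
Proof. by rewrite /volterra hsB !hs_vmx -!(addrA n) !(addrC c) !addrA. Qed.

(** The flow on b, since a_0 = 1 + eps^2 b. *)
Definition beta k : series A := sdrop 2 (volterra av k 0).

Lemma betaE k n : volterra av k n = eps ^+ 2 * hs n (beta k).
Proof.
rewrite -[n in LHS]add0r -hs_volterra -hs_epsX /beta; congr (hs n _).
have [h hE] : exists h, volterra av k 0 = eps ^+ 2 * h := volterra_perturb _ _ _ _.
by apply: sdropP => i i2; rewrite hE scoef_epsXM i2.
Qed.

(* The image of w = b + s b + eps^2 b (s b) under the derivation sending b to [beta k]. *)
Definition redflow k : series A :=
  beta k + hs 1 (beta k) + eps ^+ 2 * (beta k * bs 1 + redb * hs 1 (beta k)).

Lemma redflowE k :
  eps ^+ 2 * redflow k = volterra av k 0 * av 1 + av 0 * volterra av k 1.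
Proof. by rewrite !betaE /av /redflow /bs !hs0; ring. Qed.

Definition sevo L : series A -> series A := gevol (fun k => iter k sd L).
HB.instance Definition _ L := GRing.Additive.on (sevo L).

Lemma sevoD L F G : sevo L (F + G) = sevo L F + sevo L G. Proof. exact: raddfD. Qed.
Lemma sevoM L F G : sevo L (F * G) = sevo L F * G + F * sevo L G. Proof. exact: gevolM. Qed.
Lemma sevo_epsX L k F : sevo L (eps ^+ k * F) = eps ^+ k * sevo L F.
Proof. exact: gevol_epsX. Qed.
Lemma sevoC L c : sevo L (scC A c) = 0. Proof. exact: gevolC. Qed.
Lemma sevo1 L : sevo L 1 = 0.
Proof. by rewrite -(rmorph1 (scC A)) sevoC. Qed.
Lemma sevo_w L : sevo L w = L. Proof. exact: gevolX. Qed.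

Lemma sevo_sd L F : sevo L (sd F) = sd (sevo L F).
Proof. exact: (@gevol_sdd _ _ _ succn). Qed.

Lemma sevo_hs L n F : sevo L (hs n F) = hs n (sevo L F).
Proof.
apply: gshift_natural; [exact: epslinear_gevol|exact: gevolCM|exact: sevo_sd].
Qed.

(** The evolution is prescribed on w, so its effect on b must be recovered: differentiating the
    equation of b gives a linear equation that [beta k] solves, and [half_eq0] makes the solution
    unique. *)
Lemma redflow_b k : sevo (redflow k) redb = beta k.
Proof.
have := congr1 (sevo (redflow k)) redbE.
rewrite !sevoD sevo_epsX sevoM sevo_hs sevo_w.
move: (sevo (redflow k) redb) => x /eqP; rewrite -subr_eq0 /redflow /bs => /eqP e.
apply/eqP; rewrite -subr_eq0; apply/eqP; apply: (@half_eq0 (hs 1 redb) redb).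
by rewrite hsB -[RHS]e; ring.
Qed.

Lemma redflow_av k n : sevo (redflow k) (av n) = volterra av k n.
Proof.
by rewrite betaE /av sevoD sevo1 add0r sevo_epsX sevo_hs redflow_b.
Qed.

Definition sbr L M : series A := sevo L M - sevo M L.

(** Commutation holds on the Volterra variables, hence on a_0 a_1 = 1 + eps^2 w, hence on w. *)
Lemma redflow_commute1 k : sbr (redflow 1) (redflow k) = 0.
Proof.
pose D := sevo (redflow 1); pose D' := sevo (redflow k).
have DD : {morph D : f g / f + g} by exact: sevoD.
have DD' : {morph D' : f g / f + g} by exact: sevoD.
have DM : forall f g, D (f * g) = D f * g + f * D g by exact: sevoM.
have DM' : forall f g, D' (f * g) = D' f * g + f * D' g by exact: sevoM.
have avC n : D (D' (av n)) = D' (D (av n)).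
  apply: (volterra_flows_commute (k := k) DD DM DD' DM') => m; last exact: redflow_av.
  by rewrite -volterra1; exact: redflow_av.
apply: (@epsX_eq0 _ 2); rewrite /sbr mulrBr -!sevo_epsX.
have epsw L : sevo L (av 0 * av 1) = eps ^+ 2 * L.
  by rewrite av_mul hs0 sevoD sevo1 add0r sevo_epsX sevo_w.
rewrite -(epsw (redflow 1)) -(epsw (redflow k)) -/D -/D'.
have commM f g : D (D' f) = D' (D f) -> D (D' g) = D' (D g) -> D (D' (f * g)) = D' (D (f * g)).
  by move=> fC gC; rewrite DM DM' DD DD' !DM !DM' fC gC; ring.
by rewrite commM ?subrr.
Qed.

(* With v = [redP], - 2 + eps^2 v is minus the sum of two consecutive Volterra variables. *)
Definition redP : series A := - (redb + bs (-1)).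

Lemma av_redP : - (av (-1) + av 0) = - 2%:R + eps ^+ 2 * redP.
Proof. by rewrite /av /redP /bs hs0; ring. Qed.

Lemma redflow_redP k :
  eps ^+ 2 * sevo (redflow k) redP = - (volterra av k (-1) + volterra av k 0).
Proof.
have := congr1 (sevo (redflow k)) av_redP.
have -> : - 2%:R = scC A (- 2%:R) by rewrite rmorphN rmorph_nat.
by rewrite sevoD sevo_epsX sevoC add0r => <-; rewrite raddfN /= sevoD !redflow_av.
Qed.

End Reduction.

Arguments hs {K A} n F.
Arguments sevo {K A} L F.

(** * Toda derivations *)

Section TodaDerivations.
Context (K : numFieldType) (A : free_algebra K nat) (B : free_algebra K vw_index)
  (C : free_algebra K XY_index).

Definition vw_next (i : vw_index) : vw_index :=
  match i with inl k => inl k.+1 | inr k => inr k.+1 end.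

Local Notation sd := (sdd (A := A) succn).
Local Notation sd2 := (sdd (A := B) vw_next).
Local Notation v := (sconst (fa_X B (inl 0%N : vw_index))).
Local Notation w := (sconst (fa_X B (inr 0%N : vw_index))).

Section Values.
Context (T : Type) (d : T -> T).

Definition vw_values (x y : T) (i : vw_index) : T :=
  match i with inl k => iter k d x | inr k => iter k d y end.

End Values.

Lemma vw_ghom_sd x y F : ghom (vw_values sd x y) (sd2 F) = sd (ghom (vw_values sd x y) F).
Proof.
by rewrite !sdd_gevol; apply: ghom_gevol => i; rewrite ghomX -sdd_gevol; case: i.
Qed.

Lemma vw_ghom_sd2 x y F : ghom (vw_values sd2 x y) (sd2 F) = sd2 (ghom (vw_values sd2 x y) F).
Proof.
by rewrite !sdd_gevol; apply: ghom_gevol => i; rewrite ghomX -sdd_gevol; case: i.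
Qed.

Lemma vw_gevol_sd2 x y F : gevol (vw_values sd2 x y) (sd2 F) = sd2 (gevol (vw_values sd2 x y) F).
Proof. by apply: gevol_sdd; case. Qed.

Lemma vw_values_ext (T T' : Type) (d : T -> T) (d' : T' -> T') (f : T -> T') x y x' y' :
    (forall t, f (d t) = d' (f t)) -> f x = x' -> f y = y' ->
  forall i, f (vw_values d x y i) = vw_values d' x' y' i.
Proof.
by move=> fd <- <- [k|k] /=; elim: k => //= k <-; rewrite fd.
Qed.

Definition gPhi : series B -> series B :=
  ghom (vw_values sd2 (- 2%:R + eps ^+ 2 * v) (1 + eps ^+ 2 * w)).
HB.instance Definition _ := GRing.RMorphism.on gPhi.

Definition XY_values (i : XY_index) : series B :=
  match i with
  | inl j => gshift vw_next j%:~R v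
  | inr j => gshift vw_next j%:~R w
  end.

Definition gtoda : C -> series B := fa_subst (scC B) XY_values.
HB.instance Definition _ := GRing.RMorphism.on gtoda.

(** The quotient map modulo the invariant ideal, which is identified with its kernel in
    [in_ideal_proj] and [proj_in_ideal]. *)
Definition gproj : series B -> series A := ghom (vw_values sd (redP A) (sconst (fa_X A 0))).
HB.instance Definition _ := GRing.RMorphism.on gproj.

Lemma gPhi_shift c F : gPhi (gshift vw_next c F) = gshift vw_next c (gPhi F).
Proof.
apply: gshift_natural; [exact: epslinear_ghom| |exact: vw_ghom_sd2].
by move=> a G; rewrite rmorphM /= [gPhi (scC _ _)]ghomC.
Qed.

(** One Toda step exp (eps d) is two Volterra half steps. *)
Lemma gproj_shift n F : gproj (gshift vw_next n%:~R F) = hs (2 * n) (gproj F).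
Proof.
rewrite /hs intrM mulrAC divff ?pnatr_eq0 // mul1r.
apply: gshift_natural; [exact: epslinear_ghom| |exact: vw_ghom_sd].
by move=> a G; rewrite rmorphM /= [gproj (scC _ _)]ghomC.
Qed.

Lemma gPhi_v : gPhi v = - 2%:R + eps ^+ 2 * v. Proof. exact: ghomX. Qed.
Lemma gPhi_w : gPhi w = 1 + eps ^+ 2 * w. Proof. exact: ghomX. Qed.
Lemma gproj_v : gproj v = redP A. Proof. exact: ghomX. Qed.
Lemma gproj_w : gproj w = sconst (fa_X A 0). Proof. exact: ghomX. Qed.

Lemma gPhi_X j : gPhi (gtoda (fa_X C (inl j : XY_index)))
  = - 2%:R + eps ^+ 2 * gshift vw_next j%:~R v.
Proof.
rewrite [gtoda _]fa_substX gPhi_shift gPhi_v rmorphD rmorphN rmorph_nat /=.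
by rewrite gshift_epsX.
Qed.

Lemma gPhi_Y j : gPhi (gtoda (fa_X C (inr j : XY_index)))
  = 1 + eps ^+ 2 * gshift vw_next j%:~R w.
Proof. by rewrite [gtoda _]fa_substX gPhi_shift gPhi_w rmorphD rmorph1 /= gshift_epsX. Qed.

Lemma gproj_epsX k F : gproj (eps ^+ k * F) = eps ^+ k * gproj F.
Proof. exact: ghom_epsX. Qed.

Lemma gproj_X j : gproj (gPhi (gtoda (fa_X C (inl j : XY_index))))
  = - (av A (2 * j - 1) + av A (2 * j)).
Proof.
rewrite gPhi_X rmorphD rmorphN rmorph_nat /= gproj_epsX gproj_shift gproj_v.
rewrite -(rmorph_nat (hs (2 * j))) -rmorphN -hs_epsX -rmorphD -av_redP /=.
by rewrite rmorphN rmorphD /= !hs_av addr0.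
Qed.

Lemma gproj_Y j : gproj (gPhi (gtoda (fa_X C (inr j : XY_index))))
  = av A (2 * j) * av A (2 * j + 1).
Proof. by rewrite gPhi_Y rmorphD rmorph1 /= gproj_epsX gproj_shift gproj_w av_mul. Qed.

(* Powers of the Toda matrix, by rows. *)
Fixpoint gmx k (i j : int) : C :=
  if k is k'.+1 then
    gmx k' (i - 1) j + fa_X C (inl i : XY_index) * gmx k' i j
      + fa_X C (inr i : XY_index) * gmx k' (i + 1) j
  else (i == j)%:R.

(** [gP] and [gQ] are the entries (0, 0) and (0, 1) of the commutator [C, (C^k)^+], with the
    products by the tridiagonal C written out. *)
Definition gP k : C := gmx k (-1) 0 - gmx k 0 1.
Definition gQ k : C := gmx k (-1) 1 - gmx k 0 2
  + (fa_X C (inl 0 : XY_index) - fa_X C (inl 1 : XY_index)) * gmx k 0 1.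

(** Modulo eps^2, Phi puts X_j = -2 and Y_j = 1, the Toda matrix of the constant Volterra lattice.
    Translation invariance of that lattice then makes Phi (P_k) and Phi (Q_k) divisible by eps^2. *)
Lemma gPhi_gmx k i j : exists h,
  gPhi (gtoda (gmx k i j)) = vmx (fun=> 1) k.*2 (2 * i) (2 * j) + eps ^+ 2 * h.
Proof.
elim: k i => [|k IHk] i.
  by exists 0; rewrite /= !rmorph_nat mulr0 addr0 (inj_eq (mulfI _)).
have [h1 e1] := IHk (i - 1); have [h0 e0] := IHk i; have [h2 e2] := IHk (i + 1).
rewrite doubleS vmxSS /= !rmorphD !rmorphM /= e1 e0 e2 gPhi_X gPhi_Y.
have -> : 2 * (i - 1) = 2 * i - 2 by ring.
have -> : 2 * (i + 1) = 2 * i + 2 by ring.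
set x := gshift _ _ _; set y := gshift _ _ _.
set u0 := vmx _ _ (2 * i - 2) _; set u1 := vmx _ _ (2 * i) _; set u2 := vmx _ _ (_ + _) _.
exists (h1 + x * u1 - 2%:R * h0 + eps ^+ 2 * x * h0 + h2 + y * u2 + eps ^+ 2 * y * h2).
ring.
Qed.

Lemma gPhi_gP k : exists h, gPhi (gtoda (gP k)) = eps ^+ 2 * h.
Proof.
have [h1 e1] := gPhi_gmx k (-1) 0; have [h2 e2] := gPhi_gmx k 0 1.
exists (h1 - h2); rewrite /gP !rmorphB /= e1 e2.
by rewrite (vmx_shift _ (-2) k.*2 0 2); ring.
Qed.

Lemma gPhi_gQ k : exists h, gPhi (gtoda (gQ k)) = eps ^+ 2 * h.
Proof.
have [h1 e1] := gPhi_gmx k (-1) 1; have [h2 e2] := gPhi_gmx k 0 2.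
exists (h1 - h2
  + (gshift vw_next 0%:~R v - gshift vw_next 1%:~R v) * gPhi (gtoda (gmx k 0 1))).
rewrite /gQ rmorphD rmorphM !rmorphB rmorphD rmorphM !rmorphB /= e1 e2 !gPhi_X.
by rewrite (vmx_shift _ (-2) k.*2 0 4); ring.
Qed.

Let red : {rmorphism C -> series A} := gproj \o (gPhi \o gtoda).

Let red0 i j : red (gmx 0 i j) = (i == j)%:R.
Proof. by rewrite rmorph_nat. Qed.

Let redS k i j : red (gmx k.+1 i j) =
  red (gmx k (i - 1) j) - (av A (2 * i - 1) + av A (2 * i)) * red (gmx k i j)
  + av A (2 * i) * av A (2 * i + 1) * red (gmx k (i + 1) j).
Proof. by rewrite !rmorphD !rmorphM /= gproj_X gproj_Y mulNr. Qed.

Lemma gproj_gP k :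
  gproj (gPhi (gtoda (gP k))) = - (volterra (av A) k (-1) + volterra (av A) k 0).
Proof. by rewrite -(toda_volterra0 red0 redS) -rmorphB. Qed.

Lemma gproj_gQ k : gproj (gPhi (gtoda (gQ k)))
  = volterra (av A) k 0 * av A 1 + av A 0 * volterra (av A) k 1.
Proof.
rewrite -(toda_volterra1 red0 redS); apply: etrans (rmorphD red _ _) _.
congr (_ + _); first exact: rmorphB.
apply: etrans (rmorphM red _ _) _; congr (_ * _).
by rewrite rmorphB /= !gproj_X mulr0 mulr1 add0r opprK.
Qed.

(** From Phi v^(0) = -2 + eps^2 v^(0), the conjugated derivation must send v^(0) to Phi (P_k)
    divided by eps^2. *)
Definition flow_v k : series B := sdrop 2 (gPhi (gtoda (gP k))).
Definition flow_w k : series B := sdrop 2 (gPhi (gtoda (gQ k))).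

Lemma flow_vE k : gPhi (gtoda (gP k)) = eps ^+ 2 * flow_v k.
Proof.
by have [h hE] := gPhi_gP k; apply: sdropP => i i2; rewrite hE scoef_epsXM i2.
Qed.

Lemma flow_wE k : gPhi (gtoda (gQ k)) = eps ^+ 2 * flow_w k.
Proof.
by have [h hE] := gPhi_gQ k; apply: sdropP => i i2; rewrite hE scoef_epsXM i2.
Qed.

Definition vw_evol x y : series B -> series B := gevol (vw_values sd2 x y).

Definition calD k : series B -> series B := vw_evol (flow_v k) (flow_w k).

Lemma calD_epsX k n F : calD k (eps ^+ n * F) = eps ^+ n * calD k F.
Proof. exact: gevol_epsX. Qed.

Lemma calD_derivation k :
  [/\ forall F G, calD k (F + G) = calD k F + calD k G,
      forall F G, calD k (F * G) = calD k F * G + F * calD k G,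
      forall c, calD k (scC B c) = 0 /\ calD k eps = 0,
      forall F, calD k (sd2 F) = sd2 (calD k F)
    & forall n, exists m, forall F, (forall i, (i < m)%N -> scoef F i = 0) ->
        forall i, (i < n)%N -> scoef (calD k F) i = 0].
Proof.
split; [exact: (proj1 (epslinear_gevol _))|exact: gevolM| |exact: vw_gevol_sd2|].
  move=> c; split; first exact: gevolC.
  have := calD_epsX k 1 1; rewrite mulr1 expr1 => ->.
  by rewrite -(rmorph1 (scC B)) [calD _ _]gevolC mulr0.
by move=> n; exists n => F /sdropP -> i lt_in; rewrite calD_epsX scoef_epsXM lt_in.
Qed.

Lemma calD_Phi k F :
  calD k (gPhi F) = gPhi (vw_evol (gtoda (gP k)) (gtoda (gQ k)) F).
Proof.
symmetry; apply: ghom_gevol => i.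
apply: etrans (vw_values_ext (f := gPhi) (vw_ghom_sd2 _ _) (flow_vE k) (flow_wE k) i) _.
symmetry; apply: (vw_values_ext (f := calD k)) => [t||]; first exact: vw_gevol_sd2.
  rewrite -(rmorph_nat (scC B)) -rmorphN /calD /vw_evol raddfD /= gevolC add0r gevol_epsX.
  by rewrite gevolX.
by rewrite -(rmorph1 (scC B)) /calD /vw_evol raddfD /= gevolC add0r gevol_epsX gevolX.
Qed.

(** The intertwining behind invariance. On generators, after multiplication by eps^2, both sides are
    the Volterra derivatives of - (a_{-1} + a_0) and of a_0 a_1. *)
Lemma gproj_calD k F : gproj (calD k F) = sevo (redflow A k) (gproj F).
Proof.
apply: ghom_gevol => i.
apply: etrans (vw_values_ext (f := gproj) (vw_ghom_sd _ _) (erefl _) (erefl _) i) _.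
symmetry; apply: (vw_values_ext (f := sevo (redflow A k))) => [t||]; first exact: sevo_sd.
  apply: (@epsX_inj _ 2); rewrite redflow_redP -gproj_epsX -flow_vE.
  exact/esym/gproj_gP.
by rewrite sevo_w; apply: (@epsX_inj _ 2); rewrite redflowE -gproj_epsX -flow_wE gproj_gQ.
Qed.

End TodaDerivations.

(** * The invariant ideal *)

Section InvariantIdeal.
Context (K : numFieldType) (A : free_algebra K nat) (B : free_algebra K vw_index).
Implicit Types (F G H : series B).

Local Notation sd := (sdd (A := A) succn).
Local Notation sd2 := (sdd (A := B) vw_next).
Local Notation v := (sconst (fa_X B (inl 0%N : vw_index))).
Local Notation proj := (@gproj _ A B).

Definition gincl : series A -> series B :=
  smap (fa_subst (@cC _ _ B) (fun k => fa_X B (inr k : vw_index))).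

Lemma gincl_ghom : gincl =1 ghom (fun k => sconst (fa_X B (inr k : vw_index))).
Proof.
have lin_incl : epslinear gincl by apply: epslinear_smap => a b; rewrite rmorphD.
apply: (epslinear_ext lin_incl); first exact: epslinear_ghom.
move=> a; rewrite /gincl smapC => [|b b']; last by rewrite rmorphD.
move: a; apply: (@fa_hom_ext _ _ _ _
  (@sconst B \o fa_subst (@cC _ _ B) (fun k => fa_X B (inr k : vw_index)))
  (ghom (fun k => sconst (fa_X B (inr k : vw_index))) \o @sconst A)) => [c|k] /=.
  by rewrite [fa_subst _ _ _]fa_substC [RHS]ghomC.
by rewrite [fa_subst _ _ _]fa_substX [RHS]ghomX.
Qed.

Lemma gincl_is_additive : additive gincl.
Proof. by move=> F G; rewrite !gincl_ghom rmorphB. Qed.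
Lemma gincl_is_multiplicative : multiplicative gincl.
Proof. by split=> [F G|]; rewrite !gincl_ghom ?rmorphM ?rmorph1. Qed.
HB.instance Definition _ := GRing.isAdditive.Build _ _ gincl gincl_is_additive.
HB.instance Definition _ := GRing.isMultiplicative.Build _ _ gincl gincl_is_multiplicative.

Lemma gincl_epsX k (F : series A) : gincl (eps ^+ k * F) = eps ^+ k * gincl F.
Proof. by rewrite !gincl_ghom ghom_epsX. Qed.

Lemma ginclX k : gincl (sconst (fa_X A k)) = sconst (fa_X B (inr k : vw_index)).
Proof. by rewrite gincl_ghom ghomX. Qed.

Lemma ginclC c : gincl (scC A c) = scC B c.
Proof. by rewrite gincl_ghom ghomC. Qed.

Lemma gincl_sd (F : series A) : gincl (sd F) = sd2 (gincl F).
Proof.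
rewrite !gincl_ghom !sdd_gevol; apply: ghom_gevol => k.
by rewrite ghomX gevolX.
Qed.

Lemma iter_sd_X k : iter k sd (sconst (fa_X A 0)) = sconst (fa_X A k).
Proof. by elim: k => //= k ->; rewrite sdd_const [dd _ _]derX. Qed.

Lemma iter_sd2_v k : iter k sd2 v = sconst (fa_X B (inl k : vw_index)).
Proof. by elim: k => //= k ->; rewrite sdd_const [dd _ _]derX. Qed.

Lemma iter_sd2B k F G : iter k sd2 (F - G) = iter k sd2 F - iter k sd2 G.
Proof. by elim: k => //= k ->; rewrite raddfB. Qed.

Lemma proj_incl (F : series A) : proj (gincl F) = F.
Proof.
apply: (@shom_ext _ _ _ _ (proj \o gincl) idfun) => [||c|k] //=.
- by rewrite -[eps]mulr1 -[eps]expr1 gincl_epsX gproj_epsX !rmorph1.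
- by rewrite ginclC [proj _]ghomC.
- by rewrite ginclX [proj _]ghomX /= iter_sd_X.
Qed.

Definition Wgen : series B := v - gincl (redP A).

Lemma proj_Wgen k : proj (iter k sd2 Wgen) = 0.
Proof.
elim: k => [|k IHk]; first by rewrite rmorphB /= proj_incl [proj _]ghomX subrr.
by rewrite iterS [proj _]vw_ghom_sd -/(proj _) IHk raddf0.
Qed.

Definition in_ideal F := forall n, exists N (h : nat -> series B) G,
  F = \sum_(k < N) h k * iter k sd2 Wgen + eps ^+ n * G.

Lemma in_ideal_proj F : in_ideal F -> proj F = 0.
Proof.
move=> idF; apply: eq_mod_epsX => n; have [N [h [G ->]]] := idF n.
exists (proj G); rewrite subr0 rmorphD /= gproj_epsX rmorph_sum big1 ?add0r // => k _.
by rewrite rmorphM /= proj_Wgen mulr0.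
Qed.

Lemma in_ideal0 : in_ideal 0.
Proof. by move=> n; exists 0%N, (fun=> 0), 0; rewrite big_ord0 mulr0 addr0. Qed.

Lemma in_idealW k : in_ideal (iter k sd2 Wgen).
Proof.
move=> n; exists k.+1, (fun j => (j == k)%:R), 0.
rewrite big_ord_recr /= eqxx mul1r mulr0 addr0 big1 ?add0r // => j _.
by rewrite ltn_eqF // mul0r.
Qed.

Lemma in_idealD F G : in_ideal F -> in_ideal G -> in_ideal (F + G).
Proof.
move=> idF idG n; have [N [h [F' FE]]] := idF n; have [M [g [G' GE]]] := idG n.
exists (maxn N M), (fun k => (if (k < N)%N then h k else 0) + (if (k < M)%N then g k else 0)).
exists (F' + G'); rewrite FE GE addrACA -mulrDr; congr (_ + _).
rewrite (big_ord_widen _ (fun k => h k * iter k sd2 Wgen) (leq_maxl N M)).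
rewrite (big_ord_widen _ (fun k => g k * iter k sd2 Wgen) (leq_maxr N M)).
rewrite big_mkcond [X in _ + X]big_mkcond -big_split; apply: eq_bigr => k _ /=.
by rewrite mulrDl; congr (_ + _); case: ifP => // _; rewrite mul0r.
Qed.

Lemma in_idealM F G : in_ideal F -> in_ideal (G * F).
Proof.
move=> idF n; have [N [h [F' ->]]] := idF n.
exists N, (fun k => G * h k), (G * F'); rewrite mulrDr mulr_sumr mulrCA.
by congr (_ + _); apply: eq_bigr => k _; rewrite mulrA.
Qed.

(** Modulo the ideal each v^(k) may be replaced by d^k P. This passes to polynomials by induction
    and to series by truncation; it gives the inclusion of the kernel of [proj] in the ideal. *)
Lemma in_ideal_sub F : in_ideal (F - gincl (proj F)).
Proof.
have const (a : B) : in_ideal (sconst a - gincl (proj (sconst a))).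
  move: a; apply: fa_ind => [c|[k|k]|f g If Ig|f g If Ig].
  - by rewrite -/(scC B c) [proj _]ghomC ginclC subrr; exact: in_ideal0.
  - have -> : gincl (proj (sconst (fa_X B (inl k : vw_index)))) = iter k sd2 (gincl (redP A)).
      by rewrite [proj _]ghomX /=; elim: k => //= k <-; rewrite gincl_sd.
    by rewrite -iter_sd2_v -iter_sd2B; exact: in_idealW.
  - by rewrite [proj _]ghomX /= iter_sd_X ginclX subrr; exact: in_ideal0.
  - by rewrite !rmorphD opprD addrACA; exact: in_idealD.
  rewrite !rmorphM /=; set f' := gincl _; set g' := gincl _.
  have -> : sconst f * sconst g - f' * g'
      = sconst g * (sconst f - f') + f' * (sconst g - g') by ring.
  by apply: in_idealD; apply: in_idealM.
move=> n; suff [N [h [G e]]] : exists N (h : nat -> series B) G,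
    \sum_(i < n) eps ^+ i * (sconst (scoef F i) - gincl (proj (sconst (scoef F i))))
    = \sum_(k < N) h k * iter k sd2 Wgen + eps ^+ n * G.
  exists N, h, (G + (sdrop n F - gincl (proj (sdrop n F)))).
  rewrite mulrDr addrA -e {1 2}(series_decomp n F) !rmorphD /= gproj_epsX gincl_epsX mulrBr.
  rewrite opprD addrACA; congr (_ + _); rewrite !rmorph_sum /= -sumrB.
  by apply: eq_bigr => i _; rewrite gproj_epsX gincl_epsX mulrBr.
apply: (_ : in_ideal _); apply: big_ind => [||i _]; first exact: in_ideal0.
  exact: in_idealD.
exact: in_idealM.
Qed.

Lemma proj_calD_incl (C : free_algebra K XY_index) k (f : series A) :
  proj (calD C k (gincl f) - gincl (sevo (redflow A k) f)) = 0.
Proof. by rewrite raddfB /= gproj_calD !proj_incl subrr. Qed.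

Lemma proj_in_ideal F : proj F = 0 -> in_ideal F.
Proof. by move=> F0; have := in_ideal_sub F; rewrite F0 raddf0 subr0. Qed.

End InvariantIdeal.

(** * Linear parts of the reduced flows *)

Section LinearPart.
Context (K : numFieldType) (A : free_algebra K nat).
Implicit Types (F G L M : series A) (n m : int).

Local Notation sd := (sdd (A := A) succn).
Local Notation w := (sconst (fa_X A 0)).

Definition slin : series A -> series {poly K} := smap lin.
(** Constants are put into {poly K} so that the product rule [slinM] lives in a single ring. *)
Definition saug : series A -> series {poly K} := smap (polyC \o aug).

Lemma epslinear_slin : epslinear slin.
Proof. by apply: epslinear_smap => a b; rewrite linD. Qed.

Lemma epslinear_saug : epslinear saug.
Proof. by apply: epslinear_smap => a b; rewrite rmorphD. Qed.

Lemma slin_const a : slin (sconst a) = sconst (lin a).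
Proof. by apply: smapC => b c; rewrite linD. Qed.

Lemma saug_const a : saug (sconst a) = sconst (aug a)%:P.
Proof. by rewrite /saug smapC => [|b c]; rewrite ?rmorphD. Qed.

Lemma slin_is_additive : additive slin.
Proof. by move=> F G; rewrite (epslinearB _ _ epslinear_slin). Qed.
HB.instance Definition _ := GRing.isAdditive.Build _ _ slin slin_is_additive.

Lemma saug_is_additive : additive saug.
Proof. by move=> F G; rewrite (epslinearB _ _ epslinear_saug). Qed.
HB.instance Definition _ := GRing.isAdditive.Build _ _ saug saug_is_additive.

Lemma saug_is_multiplicative : multiplicative saug.
Proof.
split; last by rewrite -(rmorph1 (@sconst A)) saug_const rmorph1.
apply: epslinear_multiplicative => [|a b]; first exact: epslinear_saug.
by rewrite !saug_const !rmorphM.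
Qed.
HB.instance Definition _ := GRing.isMultiplicative.Build _ _ saug saug_is_multiplicative.

Lemma slinM F G : slin (F * G) = slin F * saug G + saug F * slin G.
Proof.
apply: epslinear_leibniz => [|||| a b]; try exact: epslinear_slin; try exact: epslinear_saug.
by rewrite !slin_const !saug_const linM rmorphD !rmorphM.
Qed.

Lemma slin_epsX k F : slin (eps ^+ k * F) = eps ^+ k * slin F.
Proof. exact: epslinearX epslinear_slin. Qed.

Lemma saug_epsX k F : saug (eps ^+ k * F) = eps ^+ k * saug F.
Proof. exact: epslinearX epslinear_saug. Qed.

Lemma slin1 : slin 1 = 0.
Proof. by rewrite -(rmorph1 (@scC _ _ A)) slin_const linC rmorph0. Qed.

Lemma slinCM c F : slin (scC A c * F) = sconst c%:P * slin F.
Proof. by rewrite slinM slin_const linC rmorph0 mul0r add0r saug_const augC. Qed.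

Lemma slin_sd F : slin (sd F) = sconst 'X * slin F.
Proof. by apply: seriesP => n; rewrite scoefCM /= lin_d. Qed.

Lemma saug_sd F : saug (sd F) = 0.
Proof. by apply: seriesP => n; rewrite scoef0 /= aug_d. Qed.

(* exp (n eps X / 2), the symbol of [hs n]. *)
Definition qexp n : series {poly K} := Series (fun i => (expcoef (n%:~R / 2%:R) i)%:P * 'X^i).

Lemma qexp0 : qexp 0 = 1.
Proof.
apply: seriesP => -[|i] /=; first by rewrite /expcoef fact0 divr1 expr0 mulr1.
by rewrite /expcoef mul0r expr0n mul0r mul0r.
Qed.

Lemma qexpD m n : qexp (m + n) = qexp m * qexp n.
Proof.
apply: seriesP => k; rewrite scoefM /= rmorphD mulrDl -expcoefD rmorph_sum mulr_suml.
apply: eq_bigr => i _; have le_ik : (i <= k)%N by rewrite -ltnS.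
by rewrite [RHS]mulrACA -exprD subnKC // rmorphM.
Qed.

Lemma slin_hs n F : slin (hs n F) = qexp n * slin F.
Proof.
apply: seriesP => k; rewrite scoefM /= raddf_sum; apply: eq_bigr => i _.
by rewrite /= linCM lin_iter_d mulrA.
Qed.

Lemma saug_hs n F : saug (hs n F) = saug F.
Proof.
have lT : epslinear (@hs K A n) by exact: epslinear_gshift.
have lS := epslinear_saug.
move: F; apply: (epslinear_ext (epslinear_comp lS lT) lS) => a.
apply: seriesP => i; rewrite saug_const.
have -> : scoef (saug (hs n (sconst a))) i = (aug (scoef (hs n (sconst a)) i))%:P by [].
rewrite gshift_const.
case: i => [|i]; first by rewrite /expcoef fact0 divr1 rmorph1 mul1r.
by rewrite rmorphM /= aug_d mulr0.
Qed.

(** The constant term x of b satisfies 2 x + eps^2 x^2 = 0, so it has no leading coefficient. *)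
Lemma saug_redb : saug (redb A) = 0.
Proof.
have e : saug (redb A) + saug (redb A) + eps ^+ 2 * (saug (redb A) * saug (redb A)) = 0.
  have := congr1 saug (redbE A); rewrite !rmorphD /= saug_epsX rmorphM /= saug_hs => ->.
  by rewrite saug_const augX rmorph0.
move: (saug (redb A)) e => x e; apply: contrapT => /series_neq0[k [G [xE G0]]]; apply: G0.
have : eps ^+ k * (G + G + eps * (eps * (eps ^+ k * (G * G)))) = 0.
  by rewrite -[RHS]e xE; ring.
move=> /epsX_eq0 /(congr1 (fun F : series {poly K} => scoef F 0)).
rewrite scoefD scoef_epsM addr0 scoefD scoef0 -mulr2n => /polyP G2.
by apply/polyP => i; have /eqP := G2 i; rewrite coefMn coef0 mulrn_eq0 => /eqP.
Qed.

Lemma saug_av n : saug (av A n) = 1.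
Proof.
by rewrite /av rmorphD rmorph1 /= saug_epsX [saug _]saug_hs saug_redb mulr0 addr0.
Qed.

Lemma saug_vmx p m n : saug (vmx (av A) p m n) = vmx (fun=> 1) p m n.
Proof. by rewrite rmorph_vmx; congr vmx; apply/funext => i /=; rewrite saug_av. Qed.

Lemma saug_volterra k n : saug (volterra (av A) k n) = 0.
Proof.
rewrite /volterra rmorphB /= !saug_vmx.
have -> : n + 1 = n + 2 + (-1) by ring.
by rewrite (vmx_shift _ (-1)) subrr.
Qed.

Lemma saug_redflow k : saug (redflow A k) = 0.
Proof.
apply: (@epsX_eq0 _ 2); rewrite -saug_epsX redflowE rmorphD !rmorphM /= !saug_volterra.
by rewrite mul0r mulr0 addr0.
Qed.

Lemma slin_av n : slin (av A n) = qexp n * slin (av A 0).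
Proof. by rewrite -slin_hs hs_av addr0. Qed.

(** Linear part of a_0 a_1 = 1 + eps^2 w, where w itself reads as 'X^0 = 1. *)
Lemma slin_av_sum : (1 + qexp 1) * slin (av A 0) = eps ^+ 2.
Proof.
have := congr1 slin (av_mul A 0); rewrite hs0 add0r slinM !saug_av mulr1 mul1r (slin_av 1).
rewrite [RHS]raddfD /= slin1 add0r slin_epsX slin_const linX expr0 rmorph1 mulr1 => <-.
by rewrite mulrDl mul1r.
Qed.

Section PowerRow.
Variable p : nat.

(** Multiplication by 1 - q^-1 subtracts the entry (-1, m - 1); at m = 2 this gives the linear part
    of the Volterra flow at site 0. *)
Let U m := (1 - qexp (-1)) * slin (vmx (av A) p 0 m).
Let t m : series {poly K} := vmx (fun=> 1) p 0 m.

(* Linear part of the identity M * M^p = M^p * M at the entry (0, m). *)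
Lemma slin_vmx_rec m :
  U (m + 1) + qexp 1 * U (m - 1) = (qexp (m - 1) - 1) * t (m - 1) * slin (av A 0).
Proof.
have := vmxSr (av A) p 0 m; rewrite vmxS add0r.
have -> : vmx (av A) p (0 - 1) m = hs (-1) (vmx (av A) p 0 (m + 1)).
  by rewrite hs_vmx addrK.
have -> : vmx (av A) p 1 m = hs 1 (vmx (av A) p 0 (m - 1)).
  by rewrite hs_vmx add0r subrK.
move=> /(congr1 slin); rewrite !raddfB /= !slinM !slin_hs !saug_hs !saug_vmx !saug_av !mul1r.
rewrite -/(t (m - 1)) (slin_av (m - 1)) /U.
have Q1 : qexp 1 * qexp (-1) = 1 by rewrite -qexpD qexp0.
move: (slin (vmx _ _ _ (m + 1))) (slin (vmx _ _ _ (m - 1))) => x y /eqP.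
rewrite -subr_eq0 => /eqP e; apply/eqP; rewrite -subr_eq0; apply/eqP.
transitivity (- (qexp (-1) * x - (slin (av A 0) * t (m - 1) + qexp 1 * y)
  - (x - (qexp (m - 1) * slin (av A 0) * t (m - 1) + y))) + (1 - qexp 1 * qexp (-1)) * y).
  by ring.
by rewrite e Q1 subrr mul0r oppr0 addr0.
Qed.

(** [slin_vmx_rec] solved upwards in steps of two: at m = 2 j + 3 the weight (-1)^j q^-(j+1) turns
    q^(2j+2) - 1 into q^(j+1) - q^-(j+1). The remainder vanishes once 2 J + 2 exceeds the band width
    p. *)
Lemma slin_vmx_telescope J : U 2 = \sum_(j < J)
    (-1) ^+ j * (qexp j.+1 - qexp (- j.+1%:Z)) * t (2 * j.+1%:Z) * slin (av A 0)
  + (-1) ^+ J * qexp (- J%:Z) * U (2 * J.+1%:Z).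
Proof.
elim: J => [|J IHJ]; first by rewrite big_ord0 add0r expr0 mul1r oppr0 qexp0 mul1r.
rewrite big_ord_recr /= [LHS]IHJ -addrA; congr (_ + _).
have := slin_vmx_rec (2 * J.+1%:Z + 1); rewrite addrK.
have -> : 2 * J.+1%:Z + 1 + 1 = 2 * J.+2%:Z by lia.
have -> : 2 * J.+1%:Z = J.+1%:Z + J.+1%:Z by ring.
have -> : qexp (- J%:Z) = qexp (- J.+1%:Z) * qexp 1 by rewrite -qexpD; congr qexp; lia.
have QQ : qexp J.+1 * qexp (- J.+1%:Z) = 1 by rewrite -qexpD subrr qexp0.
rewrite qexpD; move: (U _) (U _) (t _) (slin _) QQ => x y z s QQ e.
have ->: (-1) ^+ J.+1 = - (-1) ^+ J :> series {poly K} by rewrite exprS mulN1r.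
transitivity ((-1) ^+ J * qexp (- J.+1%:Z) * ((y + qexp 1 * x) - y)); first by ring.
rewrite e; transitivity ((-1) ^+ J * ((qexp J.+1 * qexp (- J.+1%:Z)) * qexp J.+1 - qexp (- J.+1%:Z)) * z * s
  - (-1) ^+ J * qexp (- J.+1%:Z) * y); first by ring.
by rewrite QQ mul1r; ring.
Qed.

End PowerRow.

Definition qodd j : series {poly K} := qexp j%:Z - qexp (- j%:Z).

(** eps^2 times the flow has linear part (1 + q) U 2, and 1 + q cancels against the linear part of
    a_0 by [slin_av_sum]. *)
Lemma slin_redflow k : slin (redflow A k) =
  \sum_(j < k) (-1) ^+ j * qodd j.+1 * vmx (fun=> 1) k.*2 0 (2 * j.+1%:Z).
Proof.
apply: (@epsX_inj _ 2); rewrite -slin_epsX redflowE raddfD /= !slinM !saug_volterra !saug_av.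
rewrite !mulr0 !mul0r !mulr1 !mul1r addr0 add0r.
have -> : volterra (av A) k 1 = hs 1 (volterra (av A) k 0) by rewrite hs_volterra.
set T := slin (volterra (av A) k 0); have TE : T = (1 - qexp (-1)) * slin (vmx (av A) k.*2 0 2).
  by rewrite /T /volterra raddfB /= mulrBl mul1r -slin_hs hs_vmx.
rewrite slin_hs -/T TE (slin_vmx_telescope k.*2 k) vmx_band; last by lia.
rewrite raddf0 !mulr0 addr0 -slin_av_sum -mulr_suml.
by move: (\sum_(j < k) _) (slin _) => x y; ring.
Qed.

End LinearPart.

(** * Brackets and Laurent combinations *)

Section EvolutionAlgebra.
Context (K : numFieldType) (A : free_algebra K nat).
Implicit Types (F G L M N : series A) (c : series K).

Local Notation sd := (sdd (A := A) succn).
Local Notation w := (sconst (fa_X A 0)).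

Lemma sevo_ext (D : series A -> series A) L : sderivation id D ->
    (forall a, D (scC A a) = 0) -> (forall F, D (sd F) = sd (D F)) -> D w = L ->
  D =1 sevo L.
Proof.
move=> DD DC Dsd Dw.
apply: (sderivation_ext DD (gevol_sder _)) => [a|k]; first by rewrite gevolC DC.
rewrite gevolX -Dw -iter_sd_X; elim: k => //= k <-; exact: Dsd.
Qed.

Lemma sevo_sder L : sderivation id (sevo L). Proof. exact: gevol_sder. Qed.

Lemma sevo_comm L M F : sevo L (sevo M F) - sevo M (sevo L F) = sevo (sbr L M) F.
Proof.
apply: (sevo_ext (D := fun F => sevo L (sevo M F) - sevo M (sevo L F))) => [|a|{}F|].
- exact: sderivation_comm (sevo_sder L) (sevo_sder M).
- by rewrite !sevoC !raddf0 addr0.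
- by rewrite !sevo_sd raddfB.
- by rewrite !sevo_w.
Qed.

Lemma sbr_jacobi N L M : sbr N (sbr L M) = sbr (sbr N L) M + sbr L (sbr N M).
Proof.
rewrite {1}/sbr -sevo_comm [in RHS]/sbr -!sevo_comm /sbr !raddfB /=; ring.
Qed.

Definition sk c : series A := smap cC c.

Lemma sk_is_additive : additive sk.
Proof. by move=> c c'; apply: seriesP => n /=; rewrite raddfB. Qed.
Lemma sk_is_multiplicative : multiplicative sk.
Proof.
split; last by apply: seriesP => -[|n] /=; rewrite ?rmorph1 ?rmorph0.
by move=> c c'; apply: seriesP => n /=; rewrite rmorph_sum; apply: eq_bigr => i _; rewrite rmorphM.
Qed.
HB.instance Definition _ := GRing.isAdditive.Build _ _ sk sk_is_additive.
HB.instance Definition _ := GRing.isMultiplicative.Build _ _ sk sk_is_multiplicative.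

Lemma sk_eps : sk eps = eps.
Proof. by apply: seriesP => -[|[|n]] /=; rewrite ?rmorph1 ?rmorph0. Qed.

Lemma sk_epsX k : sk (eps ^+ k) = eps ^+ k.
Proof. by rewrite rmorphXn /= sk_eps. Qed.

Lemma sk_const a : sk (sconst a) = scC A a.
Proof. by apply: seriesP => -[|n] //=; rewrite rmorph0. Qed.

Lemma sd_skM c F : sd (sk c * F) = sk c * sd F.
Proof.
apply: seriesP => n; rewrite scoef_sdd !scoefM raddf_sum; apply: eq_bigr => i _.
exact: derCM.
Qed.

Lemma sevo_sk L c : sevo L (sk c) = 0.
Proof.
apply: eq_mod_epsX => n; exists (sevo L (sk (sdrop n c))).
rewrite subr0 {1}(series_decomp n c) rmorphD rmorphM /= sk_epsX sevoD sevo_epsX rmorph_sum raddf_sum.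
rewrite big1 ?add0r // => i _.
by rewrite rmorphM /= sk_epsX sevo_epsX sk_const sevoC mulr0.
Qed.

Lemma sevo_skMr L c F : sevo L (sk c * F) = sk c * sevo L F.
Proof. by rewrite sevoM sevo_sk mul0r add0r. Qed.

Lemma sevo_skMl L c F : sevo (sk c * L) F = sk c * sevo L F.
Proof.
symmetry; apply: (sevo_ext (D := fun F => sk c * sevo L F)) => [|a|{}F|].
- split=> [|F1 F2]; last by rewrite sevoM; ring.
  split=> [F1 F2|F1]; first by rewrite sevoD mulrDr.
  by rewrite -[eps]expr1 sevo_epsX mulrCA.
- by rewrite sevoC mulr0.
- by rewrite sevo_sd sd_skM.
- by rewrite sevo_w.
Qed.

Lemma sevo_addl L M F : sevo (L + M) F = sevo L F + sevo M F.
Proof.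
symmetry; apply: (sevo_ext (D := fun F => sevo L F + sevo M F)) => [|a|{}F|].
- exact: sderivation_add (sevo_sder L) (sevo_sder M).
- by rewrite !sevoC addr0.
- by rewrite !sevo_sd raddfD.
- by rewrite !sevo_w.
Qed.

Lemma sbr_skMr L c M : sbr L (sk c * M) = sk c * sbr L M.
Proof. by rewrite /sbr sevo_skMr sevo_skMl mulrBr. Qed.

Lemma sbr_addr L M N : sbr L (M + N) = sbr L M + sbr L N.
Proof. by rewrite /sbr sevoD sevo_addl; ring. Qed.

Lemma sbrN L M : sbr M L = - sbr L M.
Proof. by rewrite /sbr opprB. Qed.

Lemma sbr_skMl L c M : sbr (sk c * L) M = sk c * sbr L M.
Proof. by rewrite sbrN sbr_skMr sbrN mulrN opprK. Qed.

Lemma sbr_addl L M N : sbr (L + M) N = sbr L N + sbr M N.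
Proof. by rewrite sbrN sbr_addr opprD -!sbrN. Qed.

Lemma sbr0r L : sbr L 0 = 0.
Proof. by have := sbr_skMr L 0 0; rewrite rmorph0 !mul0r. Qed.

Lemma sbr_epsXr L k M : sbr L (eps ^+ k * M) = eps ^+ k * sbr L M.
Proof. by rewrite -sk_epsX sbr_skMr. Qed.

Lemma sbr_epsXl L k M : sbr (eps ^+ k * L) M = eps ^+ k * sbr L M.
Proof. by rewrite -sk_epsX sbr_skMl. Qed.

Lemma iter_sd_coef n L k : scoef (iter n sd L) k = iter n (dd succn) (scoef L k).
Proof. by elim: n => //= n ->. Qed.

Lemma scoef_sevo0 L F : scoef (sevo L F) 0 = evol (scoef L 0) (scoef F 0).
Proof.
by rewrite scoef_gevol0; congr der; apply/funext => k; rewrite iter_sd_coef.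
Qed.

(** The evolution with value w^(1) is d, and every evolution commutes with d. *)
Lemma sbr_translation G : sbr (sconst (fa_X A 1)) G = 0.
Proof.
have <- : sd w = sconst (fa_X A 1) by exact: (iter_sd_X A 1).
rewrite /sbr sevo_sd sevo_w; apply/eqP; rewrite subr_eq0; apply/eqP; symmetry.
move: G; apply: (sevo_ext (D := sd)) => [|a||] //; last by rewrite sddC.
by split; [exact: epslinear_sdd|exact: sddM].
Qed.

Lemma saug_sevo L F : saug L = 0 -> saug (sevo L F) = 0.
Proof.
move=> L0; have lS := epslinear_saug A; have lL : epslinear (sevo L) by exact: epslinear_gevol.
move: F; apply: (@sderivation_ext _ _ _ _ (@saug _ A) (@saug _ A \o sevo L) (fun=> 0)) => [||c|k] /=.
- split=> [|F G /=]; first exact: epslinear_comp.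
  by rewrite sevoM rmorphD !rmorphM.
- by split=> [|F G]; [split=> [F G|F]; rewrite ?addr0 ?mulr0 | rewrite mul0r mulr0 addr0].
- by rewrite [sevo _ _]sevoC raddf0.
- by rewrite [sevo _ _]gevolX; case: k => //= k; rewrite saug_sd.
Qed.

(** Without constant terms, evolution acts on linear parts as multiplication by a symbol; hence
    linear parts of brackets vanish. *)
Lemma slin_sevo L F : saug L = 0 -> slin (sevo L F) = slin L * slin F.
Proof.
move=> L0; have lS := epslinear_slin A; have lL : epslinear (sevo L) by exact: epslinear_gevol.
move: F; apply: (@sderivation_ext _ _ _ _ (@saug _ A) (@slin _ A \o sevo L)
  (fun F => slin L * slin F)) => [||c|k] /=.
- split=> [|F G /=]; first exact: epslinear_comp.
  by rewrite sevoM raddfD /= !slinM !saug_sevo // mulr0 mul0r add0r addr0.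
- split=> [|F G]; last by rewrite slinM; ring.
  by split=> [F G|F]; rewrite ?raddfD ?mulrDr //= -[eps]expr1 slin_epsX mulrCA.
- by rewrite [sevo _ _]sevoC raddf0 slin_const linC rmorph0 mulr0.
- rewrite [sevo _ _]gevolX slin_const linX.
  elim: k => [|k IHk] /=; first by rewrite expr0 rmorph1 mulr1.
  by rewrite slin_sd IHk exprS rmorphM mulrCA.
Qed.

Lemma slin_sbr L M : saug L = 0 -> saug M = 0 -> slin (sbr L M) = 0.
Proof. by move=> L0 M0; rewrite raddfB /= !slin_sevo // mulrC subrr. Qed.

Section Combinations.
Variable D : nat -> series A.

Definition lcomb L : Prop := exists m (N : nat) (c : nat -> series K),
  eps ^+ m * L = \sum_(1 <= k < N) sk (c k) * D k.

Lemma lcomb_widen (M N : nat) (c : nat -> series K) : (N <= M)%N ->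
  \sum_(1 <= k < N) sk (c k) * D k
  = \sum_(1 <= k < M) sk (if (k < N)%N then c k else 0) * D k.
Proof.
move=> leNM; rewrite (big_nat_widen _ _ _ _ _ leNM) big_mkcond.
by apply: eq_bigr => k _ /=; case: ifP => // _; rewrite rmorph0 mul0r.
Qed.

Lemma lcomb_gen k : (0 < k)%N -> lcomb (D k).
Proof.
move=> k0; exists 0%N, k.+1, (fun j => (j == k)%:R).
rewrite mul1r big_nat_recr //= eqxx rmorph1 mul1r big_nat big1 ?add0r // => j /andP[_ jk].
by rewrite ltn_eqF // rmorph0 mul0r.
Qed.

Lemma lcomb_sk c L : lcomb L -> lcomb (sk c * L).
Proof.
move=> [m [N [h hE]]]; exists m, N, (fun k => c * h k).
rewrite mulrCA hE mulr_sumr; apply: eq_bigr => k _.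
by rewrite rmorphM mulrA.
Qed.

Lemma lcombD L M : lcomb L -> lcomb M -> lcomb (L + M).
Proof.
move=> [m [N [c cE]]] [m' [N' [c' cE']]].
exists (m + m')%N, (maxn N N'), (fun k => eps ^+ m' * (if (k < N)%N then c k else 0)
  + eps ^+ m * (if (k < N')%N then c' k else 0)).
under eq_bigr => k _ do rewrite rmorphD !rmorphM /= !sk_epsX mulrDl -!mulrA.
rewrite big_split /= -!mulr_sumr -!lcomb_widen ?leq_maxl ?leq_maxr // -cE -cE'.
by rewrite exprD; ring.
Qed.

Lemma lcomb_div k L : lcomb (eps ^+ k * L) -> lcomb L.
Proof.
by move=> [m [N [c cE]]]; exists (m + k)%N, N, c; rewrite exprD -mulrA.
Qed.

Lemma lcomb0 : lcomb 0.
Proof. by exists 0%N, 0%N, (fun=> 0); rewrite mulr0 big_geq. Qed.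

Lemma lcomb_sum (J : Type) (s : seq J) (F : J -> series A) :
  (forall j, lcomb (F j)) -> lcomb (\sum_(j <- s) F j).
Proof.
move=> FL; apply: big_ind => [||j _]; [exact: lcomb0|exact: lcombD|exact: FL].
Qed.

Lemma sbr_lcomb L M : (forall k, (0 < k)%N -> sbr L (D k) = 0) -> lcomb M -> sbr L M = 0.
Proof.
move=> LD [m [N [c cE]]]; apply: (@epsX_eq0 _ m); rewrite -sbr_epsXr cE big_nat.
apply: (big_ind (fun F => sbr L F = 0)) => [|F G F0 G0|k /andP[k1 _]]; first exact: sbr0r.
  by rewrite sbr_addr F0 G0 addr0.
by rewrite sbr_skMr LD // mulr0.
Qed.

Lemma saug_lcomb M : (forall k, saug (D k) = 0) -> lcomb M -> saug M = 0.
Proof.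
move=> D0 [m [N [c cE]]]; apply: (@epsX_eq0 _ m); rewrite -saug_epsX cE raddf_sum big1 // => k _.
by rewrite /= rmorphM /= D0 mulr0.
Qed.

End Combinations.
End EvolutionAlgebra.

Arguments sk {K A} c.

(** * Deformation of KdV symmetries *)

Section FirstFlow.
Context (K : numFieldType) (A : free_algebra K nat).
Implicit Types (F G L M : series A).

Local Notation sd := (sdd (A := A) succn).
Local Notation X k := (fa_X A k).
Local Notation w := (sconst (X 0)).

(** A central difference of half steps: the even orders cancel, and the cubic coefficient is 2
    (1/2)^3 / 3! = 1/24. *)
Lemma hs_diff F : exists G, hs 1 F - hs (-1) F
  = eps * sd F + eps ^+ 3 * (scC A 24%:R^-1 * sd (sd (sd F))) + eps ^+ 4 * G.
Proof.
have [G1 e1] := gshift_trunc succn (1%:~R / 2%:R) 4 F.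
have [G2 e2] := gshift_trunc succn ((-1)%:~R / 2%:R) 4 F.
exists (G1 - G2); rewrite /hs e1 e2 !big_ord_recr !big_ord0 /= !add0r.
have c0 c : expcoef c 0 = 1 :> K by rewrite /expcoef fact0 divr1.
have c1 : expcoef ((-1)%:~R / 2%:R) 1 = expcoef (1%:~R / 2%:R) 1 - 1 :> K.
  by rewrite /expcoef !factS fact0 !muln1 /=; field.
have c2 : expcoef ((-1)%:~R / 2%:R) 2 = expcoef (1%:~R / 2%:R) 2 :> K.
  by rewrite /expcoef; congr (_ / _); rewrite mulrN1z mulr1z mulNr sqrrN.
have c3 : expcoef ((-1)%:~R / 2%:R) 3 = expcoef (1%:~R / 2%:R) 3 - 24%:R^-1 :> K.
  by rewrite /expcoef (_ : 3`! = 6)%N //; field.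
rewrite !c0 c1 c2 c3 !rmorphB !rmorph1 /=.
by move: (scC A _) (scC A _) (scC A _) => x y z; ring.
Qed.

Lemma redb_coef0 : scoef (redb A) 0 + scoef (redb A) 0 = X 0.
Proof.
have := congr1 (fun F => scoef F 0) (redbE A).
by rewrite !scoefD scoef_hs0 scoef_epsXM /= addr0.
Qed.

Let u24 : 24%:R * cC 24%:R^-1 = 1 :> A.
Proof. by rewrite -(rmorph_nat (@cC _ _ A)) -rmorphM divff ?rmorph1 ?pnatr_eq0. Qed.

Lemma first_flow_expansion : exists T,
  redflow A 1 = eps * sconst (X 1) + eps ^+ 3 * T
  /\ scoef T 0 = cC 24%:R^-1 * kdv 12%:R.
Proof.
pose q := redb A * hs 1 (redb A).
(* The derivative of a_0 a_1 is a_0 a_1 (a_1 + a_2 - a_{-1} - a_0), and b_n + b_{n+1} is s^n w -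
   eps^2 s^n q. *)
have redE : redflow A 1 = (1 + eps ^+ 2 * w)
    * ((hs 1 w - hs (-1) w) - eps ^+ 2 * (hs 1 q - hs (-1) q)).
  apply: (@epsX_inj _ 2); rewrite redflowE !volterra1.
  have -> : hs 1 w = bs A 1 + bs A 2 + eps ^+ 2 * hs 1 q.
    by rewrite hs_w /q hsM hs_hs.
  have -> : hs (-1) w = bs A (-1) + bs A 0 + eps ^+ 2 * hs (-1) q.
    by rewrite hs_w /q hsM hs_hs.
  have <- : av A 0 * av A 1 = 1 + eps ^+ 2 * w by rewrite -(hs0 w) -av_mul.
  by rewrite /= /av; ring.
have [[G1 e1] [G2 e2]] := (hs_diff w, hs_diff q).
set W3 := scC A _ * _ in e1; set Q3 := scC A _ * _ in e2.
have dw : sd w = sconst (X 1) by exact: (iter_sd_X A 1).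
exists (W3 - sd q + w * sd w + eps * (G1 + eps * (w * (W3 - sd q) - Q3)
  + eps ^+ 2 * (w * G1 - G2) - eps ^+ 3 * w * Q3 - eps ^+ 4 * w * G2)).
split; first by rewrite redE e1 e2 -dw; ring.
rewrite !scoefD scoefN scoef_epsM addr0 scoef_sdd (scoef0M w) /q (scoef0M (redb A)) scoef_hs0 dw !scoefC0.
rewrite /W3 scoefCM !sdd_const scoefC0 !dX.
(* Origin of the 12: at eps = 0, b is w / 2 and q is w^2 / 4, so w w' - q' = w w' / 2 = (12 / 24) w
   w'. *)
have bX0 := redb_coef0; have := congr1 (dd (A := A) succn) bX0; rewrite raddfD /= dX dM.
set x := scoef (redb A) 0; set y := dd _ x => dX0.
rewrite /kdv rmorph_nat -bX0 -dX0 -/x.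
move: (cC 24%:R^-1) (X 3) u24 => u z uE; apply/eqP; rewrite -subr_eq0; apply/eqP.
transitivity ((1 - 24%:R * u) * (x * y + x * y)); first by ring.
by rewrite uE subrr mul0r.
Qed.

Lemma commuting_coef0 G : sbr (redflow A 1) G = 0 -> kdv_symmetry 12%:R (scoef G 0).
Proof.
have [T [-> T0]] := first_flow_expansion.
rewrite sbr_addl -[eps in eps * _]expr1 !sbr_epsXl sbr_translation mulr0 add0r => /epsX_eq0.
move=> /(congr1 (fun F => scoef F 0)); rewrite scoefB !scoef_sevo0 T0 scoef0 evolCl.
rewrite [evol _ (_ * _)]derCM -/(evol _ _) -mulrBr => e.
apply/eqP; rewrite -subr_eq0; apply/eqP.
by rewrite -[LHS]mul1r -u24 -mulrA e mulr0.
Qed.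

(* The leading coefficient of G is a KdV symmetry without linear part. *)
Lemma commuting_lin_eq0 G : sbr (redflow A 1) G = 0 -> slin G = 0 -> G = 0.
Proof.
move=> Gc G0; apply: contrapT => /series_neq0[k [H [GE]]]; apply.
move: Gc G0; rewrite GE sbr_epsXr slin_epsX => /epsX_eq0 Hc /epsX_eq0 H0.
apply: (kdv_symmetry_eq0 _ (commuting_coef0 Hc)); first by rewrite pnatr_eq0.
by have := congr1 (fun F : series {poly K} => scoef F 0) H0; rewrite scoef0.
Qed.

(** If F began at some order k < N, its leading coefficient would be a KdV symmetry with zero linear
    part, hence 0. So divisibility can be tested on the linear part. *)
Lemma commuting_divisible N F S : sbr (redflow A 1) F = 0 -> slin F = eps ^+ N * S ->
  exists G, [/\ F = eps ^+ N * G, slin G = S & sbr (redflow A 1) G = 0].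
Proof.
move=> Fc FS; suff [G FE] : exists G, F = eps ^+ N * G.
  exists G; split=> //; apply: (@epsX_inj _ N); first by rewrite -slin_epsX -FE.
  by rewrite -sbr_epsXr -FE mulr0.
apply: contrapT => nF; have F0 : F <> 0 by move=> F0; apply: nF; exists 0; rewrite F0 mulr0.
have [k [H [FE]]] := series_neq0 F0; apply.
have lt_kN : (k < N)%N.
  rewrite ltnNge; apply/negP => leNk; apply: nF; exists (eps ^+ (k - N) * H).
  by rewrite mulrA -exprD subnKC.
have Hc : sbr (redflow A 1) H = 0 by apply: (@epsX_eq0 _ k); rewrite -sbr_epsXr -FE.
apply: (kdv_symmetry_eq0 _ (commuting_coef0 Hc)); first by rewrite pnatr_eq0.
have := congr1 (fun F : series {poly K} => scoef F k) FS.
rewrite scoef_epsXM lt_kN FE slin_epsX => <-.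
by rewrite -{2}[k]add0n scoef_epsXM_add.
Qed.

Lemma redflow_lcomb_commute L : lcomb (@redflow K A) L -> sbr (redflow A 1) L = 0.
Proof. by apply: sbr_lcomb => k _; exact: redflow_commute1. Qed.

Lemma redflow_lcomb_aug L : lcomb (@redflow K A) L -> saug L = 0.
Proof. by apply: saug_lcomb => k; exact: saug_redflow. Qed.

(* The bracket commutes with the first flow by Jacobi, and linear parts commute. *)
Lemma lcombs_commute L M :
  lcomb (@redflow K A) L -> lcomb (@redflow K A) M -> sbr L M = 0.
Proof.
move=> cL cM; apply: commuting_lin_eq0; last first.
  by apply: slin_sbr; exact: redflow_lcomb_aug.
by rewrite sbr_jacobi !redflow_lcomb_commute // [sbr 0 M]sbrN !sbr0r oppr0 addr0.
Qed.

(** The symbols realised by combinations of the flows; suitable combinations can thus be sought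
    among Laurent polynomials in q. *)
Let lin_span (x : series {poly K}) : Prop := exists F, lcomb (@redflow K A) F /\ slin F = x.

Let lin_spanD x y : lin_span x -> lin_span y -> lin_span (x + y).
Proof.
by move=> [F [cF <-]] [G [cG <-]]; exists (F + G); rewrite raddfD; split=> //; exact: lcombD.
Qed.

Let lin_spanC c x : lin_span x -> lin_span (sconst c%:P * x).
Proof.
move=> [F [cF <-]]; exists (sk (sconst c) * F); split; first exact: lcomb_sk.
by rewrite sk_const slinCM.
Qed.

Let lin_spanZ (z : int) x : lin_span x -> lin_span (z%:~R * x).
Proof.
by move=> /(lin_spanC z%:~R); rewrite !rmorph_int.
Qed.

Let lin_span0 : lin_span 0.
Proof. by exists 0; rewrite raddf0; split=> //; exact: lcomb0. Qed.

(** The linear part of flow J + 1 contains [qodd] of J + 1 with coefficient (-1)^J by [vmx_top], and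
    lower ones with integer coefficients, which are subtracted by induction. *)
Let lin_span_Qodd j : lin_span (qodd K j).
Proof.
elim/ltn_ind: j => -[|J] IH; first by rewrite /qodd oppr0 subrr.
have vmxE m : vmx (fun=> 1) J.+1.*2 0 m = (vmx (fun=> 1 : int) J.+1.*2 0 m)%:~R :> series {poly K}.
  rewrite (rmorph_vmx (intmul 1 : {rmorphism int -> series {poly K}})).
  by congr vmx; apply/funext.
have vt : vmx (fun=> 1) J.+1.*2 0 (2 * J.+1%:Z) = 1 :> series {poly K}.
  have -> : 2 * J.+1%:Z = 0 + J.+1.*2%:Z by lia.
  by rewrite vmx_top -mul2n exprM sqrrN expr1n expr1n.
have := slin_redflow A J.+1; move: (J.+1.*2) vmxE vt => p vmxE vt.
rewrite big_ord_recr /= vt mulr1.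
have sgn2 : (-1) ^+ J * (-1) ^+ J = 1 :> series {poly K}.
  by rewrite -exprMn mulrNN mulr1 expr1n.
set S := \sum_(j < J) _ => e.
have -> : qodd K J.+1 = ((-1) ^+ J : int)%:~R * (slin (redflow A J.+1) + (-1)%:~R * S).
  rewrite e rmorphXn /= mulrN1z mulN1r addrAC subrr add0r mulrA.
  by rewrite sgn2 mul1r.
apply: lin_spanZ; apply: lin_spanD; first by exists (redflow A J.+1); split; [exact: lcomb_gen|].
apply: lin_spanZ; rewrite /S; apply: big_ind => [||j _]; [exact: lin_span0|exact: lin_spanD|].
rewrite vmxE; set z := vmx _ _ _ _.
have -> : (-1) ^+ j * qodd K j.+1 * z%:~R
    = ((-1) ^+ j : int)%:~R * (z%:~R * qodd K j.+1) :> series {poly K}.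
  by rewrite rmorphXn /= mulrN1z; ring.
by do 2!apply: lin_spanZ; apply: IH; rewrite ltnS.
Qed.

(** Multiplication by q + q^-1 - 2 is the second difference in j of q^j - q^-j. *)
Let lin_span_basis n j : lin_span (qodd K j * (qexp K 1 + qexp K (-1) - 2%:R) ^+ n).
Proof.
elim: n j => [|n IHn] j; first by rewrite expr0 mulr1; exact: lin_span_Qodd.
case: j => [|j]; first by rewrite /qodd oppr0 subrr mul0r.
have -> : qodd K j.+1 * (qexp K 1 + qexp K (-1) - 2%:R) ^+ n.+1
    = qodd K j.+2 * (qexp K 1 + qexp K (-1) - 2%:R) ^+ n
      + (qodd K j * (qexp K 1 + qexp K (-1) - 2%:R) ^+ n
      + (-2)%:~R * (qodd K j.+1 * (qexp K 1 + qexp K (-1) - 2%:R) ^+ n)).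
  have step : qodd K j.+1 * (qexp K 1 + qexp K (-1) - 2%:R)
      = qodd K j.+2 + qodd K j - 2%:R * qodd K j.+1.
    rewrite /qodd.
    have -> : qexp K j.+2%:Z = qexp K j.+1 * qexp K 1 by rewrite -qexpD; congr qexp; lia.
    have -> : qexp K j%:Z = qexp K j.+1 * qexp K (-1) by rewrite -qexpD; congr qexp; lia.
    have -> : qexp K (- j.+2%:Z) = qexp K (- j.+1%:Z) * qexp K (-1) by rewrite -qexpD; congr qexp; lia.
    have -> : qexp K (- j%:Z) = qexp K (- j.+1%:Z) * qexp K 1 by rewrite -qexpD; congr qexp; lia.
    ring.
  rewrite exprS mulrA step.
  have -> : (-2)%:~R = - 2%:R :> series {poly K} by rewrite rmorphN.
  ring.
by apply: lin_spanD; [|apply: lin_spanD; [|apply: lin_spanZ]]; exact: IHn.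
Qed.

Let Q_coef1 n : scoef (qexp K n) 1 = (n%:~R / 2%:R)%:P * 'X.
Proof. by rewrite /= /expcoef expr1 divr1. Qed.

Let Q_coef0 n : scoef (qexp K n) 0 = 1.
Proof. by rewrite /= /expcoef expr0 divr1 mulr1. Qed.

Let Qodd1E : exists S, qodd K 1 = eps * S /\ scoef S 0 = 'X.
Proof.
exists (sdrop 1 (qodd K 1)); split.
  rewrite -[eps]expr1; apply: sdropP => -[|//] _.
  by rewrite /qodd scoefB !Q_coef0 subrr.
have -> : scoef (sdrop 1 (qodd K 1)) 0 = scoef (qodd K 1) 1 by [].
rewrite /qodd scoefB !Q_coef1 -mulrBl -rmorphB -mulrBl opprK.
by rewrite mulr1z -mulr2n divff ?pnatr_eq0 // rmorph1 mul1r.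
Qed.

(** 2 cosh (eps X / 2) - 2 = (eps X / 2)^2 + ..., hence the factor 1/4. *)
Let Qeven1E : exists S, qexp K 1 + qexp K (-1) - 2%:R = eps ^+ 2 * S
  /\ scoef S 0 = (4%:R^-1)%:P * 'X^2.
Proof.
set E := _ - _; exists (sdrop 2 E).
have two : 2%:R = sconst 2%:R :> series {poly K} by rewrite (rmorph_nat (@sconst _)).
split.
  apply: sdropP => -[|[|//]] _; rewrite scoefB scoefD two scoefC.
    by rewrite !Q_coef0 subrr.
  by rewrite !Q_coef1 -mulrDl -rmorphD -mulrDl mulrN1z subrr mul0r rmorph0 mul0r subr0.
have -> : scoef (sdrop 2 E) 0 = scoef E 2 by [].
rewrite scoefB scoefD two /= subr0 -mulrDl -rmorphD; congr (_%:P * _).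
by rewrite /expcoef (_ : 2`! = 2)%N // mulrN1z mulr1z; field.
Qed.

Lemma kdv_symmetry_basis n : exists L, [/\ lcomb (@redflow K A) L,
  kdv_symmetry 12%:R (scoef L 0)
  & lin (scoef L 0) = ((4%:R^-1) ^+ n)%:P * 'X^(n.*2.+1)].
Proof.
have [F [cF FE]] := lin_span_basis n 1.
have [[S [e1 S0]] [T [e2 T0]]] := (Qodd1E, Qeven1E).
have FE' : slin F = eps ^+ n.*2.+1 * (S * T ^+ n).
  by rewrite FE e1 e2 exprMn -exprM mul2n exprS; ring.
have [L [FL LE Lc]] := commuting_divisible (redflow_lcomb_commute cF) FE'.
exists L; split.
- by apply: (@lcomb_div _ _ _ n.*2.+1); rewrite -FL.
- exact: commuting_coef0.
have -> : lin (scoef L 0) = scoef (slin L) 0 by [].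
have TX : scoef (T ^+ n) 0 = scoef T 0 ^+ n.
  by elim: (n) => [|m IHm]; rewrite ?expr0 // !exprS scoef0M IHm.
by rewrite LE scoef0M S0 TX T0 exprMn -rmorphXn -exprM mul2n exprS; ring.
Qed.

Lemma kdv_symmetryD (M N : A) : kdv_symmetry 12%:R M -> kdv_symmetry 12%:R N ->
  kdv_symmetry 12%:R (M + N).
Proof. by rewrite /kdv_symmetry evolD => <- <-; exact: derD. Qed.

Lemma kdv_symmetryCM a (M : A) : kdv_symmetry 12%:R M -> kdv_symmetry 12%:R (cC a * M).
Proof. by rewrite /kdv_symmetry evolCl => <-; exact: derCM. Qed.

(** Choose the combination with the same odd linear coefficients as M; the even ones vanish. The
    difference is a symmetry without linear part, so it is 0. *)
Lemma kdv_symmetry_deformation (M : A) : kdv_symmetry 12%:R M ->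
  exists L, lcomb (@redflow K A) L /\ scoef L 0 = M.
Proof.
move=> sM; have [Lf LfP] := choice kdv_symmetry_basis.
(* 4^n undoes the factor 4^-n in the linear part of the n-th basis symmetry. *)
pose c n : K := 4%:R ^+ n * (lin M)`_(n.*2.+1).
have [N szM] : exists N, (size (lin M) <= N.*2.+1)%N.
  by exists (size (lin M)); rewrite -addnn; apply: leqW; exact: leq_addr.
pose L := \sum_(n < N) sk (sconst (c n)) * Lf n.
exists L; split; first by apply: lcomb_sum => n; apply: lcomb_sk; case: (LfP n).
have L0 : scoef L 0 = \sum_(n < N) cC (c n) * scoef (Lf n) 0.
  by rewrite scoef_sum; apply: eq_bigr => n _; rewrite sk_const scoefCM.
apply/esym/eqP; rewrite -subr_eq0; apply/eqP.
apply: (@kdv_symmetry_eq0 _ _ 12%:R); first by rewrite pnatr_eq0.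
  have -> : M - scoef L 0 = M + cC (-1) * scoef L 0 by rewrite rmorphN1 mulN1r.
  apply: kdv_symmetryD => //; apply: kdv_symmetryCM; rewrite L0.
  apply: big_ind => [|F G|n _]; [|exact: kdv_symmetryD|].
    by have := kdv_symmetryCM 0 sM; rewrite rmorph0 mul0r.
  by apply: kdv_symmetryCM; case: (LfP n).
have linL n : lin (cC (c n) * scoef (Lf n) 0) = (lin M)`_(n.*2.+1) *: 'X^(n.*2.+1).
  rewrite linCM; have [_ _ ->] := LfP n; rewrite mulrA -rmorphM mul_polyC; congr (_ *: _).
  by rewrite /c mulrAC -exprMn divff ?pnatr_eq0 // expr1n mul1r.
rewrite raddfB /= L0 raddf_sum /=; under eq_bigr => n _ do rewrite linL.
apply/polyP => i; rewrite coefB coef_sum coef0.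
under eq_bigr => n _ do rewrite coefZ coefXn.
rewrite -(odd_double_half i); case: (odd i) => /=; last first.
  rewrite add0n (kdv_symmetry_even _ _ sM) ?pnatr_eq0 // big1 ?subr0 // => n _.
  case: eqP => [/(congr1 odd)|_]; last by rewrite mulr0.
  by rewrite /= !odd_double.
rewrite add1n; set m := i./2; have [lt_mN|le_Nm] := ltnP m N.
  rewrite (bigD1 (Ordinal lt_mN)) //= eqxx mulr1 big1 ?addr0 ?subrr // => n nm.
  rewrite eqSS (inj_eq double_inj); case: eqP => [e|_]; last by rewrite mulr0.
  by case/eqP: nm; apply: val_inj.
rewrite nth_default ?sub0r ?big1 ?oppr0 // => [n _|].
  rewrite eqSS (inj_eq double_inj) gtn_eqF ?mulr0 //.
  exact: leq_trans (ltn_ord n) le_Nm.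
by apply: leq_trans szM _; rewrite ltnS leq_double.
Qed.

End FirstFlow.

(** * Rescaling and tridiagonal sums *)

Section Rescaling.
Context (K : numFieldType) (A : free_algebra K nat) (c : K).
Hypothesis c0 : c != 0.
Implicit Types (f L M : A).

Local Notation d := (dd (A := A) succn).

Definition scaleX : A -> A := fa_subst (@cC _ _ A) (fun k => cC c * fa_X A k).
HB.instance Definition _ := GRing.RMorphism.on scaleX.

Definition grescale f : A := cC c^-1 * scaleX f.

Lemma scaleX_d f : scaleX (d f) = d (scaleX f).
Proof.
move: f; apply: (@fa_der_ext _ _ _ _ scaleX (scaleX \o d) (d \o scaleX)) => [||a|k] /=.
- by split=> [f g|f g] /=; rewrite ?raddfD ?rmorphD // dM rmorphD !rmorphM.
- by split=> [f g|f g] /=; rewrite ?rmorphD ?raddfD // rmorphM dM.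
- by rewrite dC rmorph0 [scaleX _]fa_substC dC.
- by rewrite dX ![scaleX _]fa_substX dCM dX.
Qed.

Lemma scaleX_evol L M : scaleX (evol L M) = evol (grescale L) (scaleX M).
Proof.
move: M; apply: (@fa_der_ext _ _ _ _ scaleX (scaleX \o evol L)
  (evol (grescale L) \o scaleX)) => [||a|k] /=.
- by split=> [f g|f g] /=; rewrite /evol ?derD ?rmorphD // derM rmorphD !rmorphM.
- by split=> [f g|f g] /=; rewrite /evol ?rmorphD ?derD // rmorphM derM.
- by rewrite /evol derC rmorph0 [scaleX _]fa_substC derC.
rewrite [scaleX (fa_X _ _)]fa_substX /evol derCM !derX /grescale iter_ddCM mulrA -rmorphM.
by rewrite divff // rmorph1 mul1r; elim: k => //= k <-; rewrite scaleX_d.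
Qed.

Lemma evol_rescale L M : evol (grescale L) (grescale M) = grescale (evol L M).
Proof. by rewrite [in RHS]/grescale scaleX_evol {2}/grescale; exact: derCM. Qed.

Lemma rescale_kdv : grescale (fa_X A 3 + fa_X A 1 * fa_X A 0) = kdv c.
Proof.
rewrite /grescale rmorphD rmorphM /= ![scaleX _]fa_substX /kdv.
have cV : cC c^-1 * cC c = 1 :> A by rewrite -rmorphM mulVf // rmorph1.
move: (cC c^-1) (cC c) cV => v u vu.
by transitivity (v * u * (fa_X A 3 + u * (fa_X A 1 * fa_X A 0))); [ring | rewrite vu mul1r].
Qed.

Lemma rescale_symmetry M :
    evol (fa_X A 3 + fa_X A 1 * fa_X A 0) M - evol M (fa_X A 3 + fa_X A 1 * fa_X A 0) = 0 ->
  kdv_symmetry c (grescale M).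
Proof.
by move=> /eqP; rewrite subr_eq0 => /eqP e; rewrite /kdv_symmetry -rescale_kdv !evol_rescale e.
Qed.

End Rescaling.

Lemma tridiagonal_row (R : comNzRingType) (x y F : int -> R) i :
  \sum_(l \in [set: int]%classic)
    (if i == l + 1 then 1 else if i == l then x i else if l == i + 1 then y i else 0) * F l
  = F (i - 1) + x i * F i + y i * F (i + 1).
Proof.
rewrite (@fsbigE _ _ _ _ _ [:: i - 1; i; i + 1]) //=; last first.
- move=> l _; rewrite !inE !negb_or => /and3P[l1 l2 l3].
  rewrite ifN ?ifN ?mul0r //; first by rewrite eq_sym.
  by apply: contra l1 => /eqP ->; rewrite addrK.
- by rewrite !inE negb_or andbT -andbA; apply/and3P; split; apply/eqP; lia.
rewrite !big_cons big_nil !classical_sets.in_setT addr0 subrK eqxx mul1r addrA.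
have -> : (i == i + 1) = false by apply/eqP; lia.
have -> : (i == i + 1 + 1) = false by apply/eqP; lia.
by rewrite eqxx.
Qed.

Lemma tridiagonal_col (R : comNzRingType) (x y F : int -> R) j :
  \sum_(l \in [set: int]%classic)
    F l * (if l == j + 1 then 1 else if l == j then x l else if j == l + 1 then y l else 0)
  = F (j + 1) + F j * x j + F (j - 1) * y (j - 1).
Proof.
rewrite (@fsbigE _ _ _ _ _ [:: j + 1; j; j - 1]) //=; last first.
- move=> l _; rewrite !inE !negb_or => /and3P[l1 l2 l3].
  rewrite (negPf l1) (negPf l2) ifN ?mulr0 //.
  by apply: contra l3 => /eqP ->; rewrite addrK.
- by rewrite !inE negb_or andbT -andbA; apply/and3P; split; apply/eqP; lia.
rewrite !big_cons big_nil !classical_sets.in_setT addr0 eqxx mulr1 addrA.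
have -> : (j == j + 1) = false by apply/eqP; lia.
have -> : (j - 1 == j + 1) = false by apply/eqP; lia.
have -> : (j - 1 == j) = false by apply/eqP; lia.
by rewrite !eqxx subrK eqxx.
Qed.

(** * Transfer to the concrete polynomial rings *)

Section Transfer.
Context (K : numFieldType).

Local Notation A := (pol_free_algebra K nat).
Local Notation B := (pol_free_algebra K vw_index).
Local Notation C := (pol_free_algebra K XY_index).

Lemma todaC_mul (F : zmx K) i j : zmx_mul (@todaC K) F i j
  = F (i - 1) j + var_X K i * F i j + var_Y K i * F (i + 1) j.
Proof. exact: (tridiagonal_row (var_X K) (var_Y K) (F^~ j)). Qed.

Lemma mul_todaC (F : zmx K) i j : zmx_mul F (@todaC K) i j
  = F i (j + 1) + F i j * var_X K j + F i (j - 1) * var_Y K (j - 1).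
Proof. exact: (tridiagonal_col (var_X K) (var_Y K) (F i)). Qed.

Lemma iter_todaC k i j : iter k (zmx_mul (@todaC K)) (@zmx_id K) i j = gmx C k i j.
Proof.
elim: k i j => [//|k IHk] i j; apply: etrans (todaC_mul (iter k (zmx_mul (@todaC K)) (@zmx_id K)) i j) _.
by rewrite !IHk.
Qed.

(** Of the strictly upper part only the entries (-1, 0) and (0, 1) survive; the diagonal and lower
    ones are 0. *)
Lemma gen_todaP (R : comNzRingType) (x y : int -> R) (E F : int -> int -> R) :
    (forall i j, E i j = if i < j then F i j else 0) ->
  E (0 - 1) 0 + x 0 * E 0 0 + y 0 * E (0 + 1) 0
    - (E 0 (0 + 1) + E 0 0 * x 0 + E 0 (0 - 1) * y (0 - 1)) = F (-1) 0 - F 0 1.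
Proof. by move=> EF; rewrite !EF /=; ring. Qed.

Lemma gen_todaQ (R : comNzRingType) (x y : int -> R) (E F : int -> int -> R) :
    (forall i j, E i j = if i < j then F i j else 0) ->
  E (0 - 1) 1 + x 0 * E 0 1 + y 0 * E (0 + 1) 1
    - (E 0 (1 + 1) + E 0 1 * x 1 + E 0 (1 - 1) * y (1 - 1))
  = F (-1) 1 - F 0 2 + (x 0 - x 1) * F 0 1.
Proof. by move=> EF; rewrite !EF /=; ring. Qed.

Lemma todaP_gP k : todaP K k = gP C k.
Proof.
rewrite /todaP /toda_bracket /zmx_comm todaC_mul mul_todaC.
apply: (@gen_todaP _ (var_X K) (var_Y K) _ (gmx C k)) => i j.
by rewrite /zmx_upper iter_todaC.
Qed.

Lemma todaQ_gQ k : todaQ K k = gQ C k.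
Proof.
rewrite /todaQ /toda_bracket /zmx_comm todaC_mul mul_todaC.
apply: (@gen_todaQ _ (var_X K) (var_Y K) _ (gmx C k)) => i j.
by rewrite /zmx_upper iter_todaC.
Qed.

Lemma dvwE : @dvw K = dd (A := B) vw_next.
Proof. by rewrite /dvw /dd /der /=; congr pder; apply/funext => -[]. Qed.

Lemma sdvwE : @sdvw K = sdd (A := B) vw_next.
Proof. by rewrite /sdvw dvwE. Qed.

Lemma shiftE_gshift j F : shiftE j F = gshift (A := B) vw_next j%:~R F.
Proof.
apply: seriesP => n; apply: eq_bigr => i _; rewrite dvwE; exact/esym/mul_malgC.
Qed.

Lemma toda_substE : @toda_subst K = @gtoda K B C.
Proof.
have e : (fun i : XY_index => match i with
    inl j => shiftE j (sv K) | inr j => shiftE j (sw K) end) = XY_values B.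
  by apply/funext => -[j|j]; exact: shiftE_gshift.
exact: (congr1 (psubst (@spC K)) e).
Qed.

Lemma sevolE a b : sevol a b = vw_evol (B := B) a b.
Proof.
have e : (fun i : vw_index => match i with
    inl k => iter k (@sdvw K) a | inr k => iter k (@sdvw K) b end)
    = vw_values (sdd (A := B) vw_next) a b.
  by apply/funext => -[k|k]; rewrite sdvwE.
exact: (congr1 (fun x => sext (pder (@sconst _) x)) e).
Qed.

Lemma DprimeE f g : Dprime f g = vw_evol (B := B) (gtoda B (C := C) f) (gtoda B (C := C) g).
Proof. by rewrite /Dprime sevolE toda_substE. Qed.

Lemma PhiE : @Phi K = @gPhi K B.
Proof.
have e : (fun i : vw_index => match i with
    | inl k => iter k (@sdvw K) (- 2%:R + eps ^+ 2 * sv K)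
    | inr k => iter k (@sdvw K) (1 + eps ^+ 2 * sw K) end)
    = vw_values (sdd (A := B) vw_next) (- 2%:R + eps ^+ 2 * sv K) (1 + eps ^+ 2 * sw K).
  by apply/funext => -[k|k]; rewrite sdvwE.
exact: (congr1 (fun x => sext (psubst (@spC K) x)) e).
Qed.

Lemma calD_is_calD k : is_calD (todaP K k) (todaQ K k) (@calD K B C k).
Proof.
split; last by move=> F; rewrite todaP_gP todaQ_gQ PhiE DprimeE; exact: (calD_Phi (B := B) C k F).
by rewrite /derivation_Reps sdvwE; exact: (@calD_derivation K B C k).
Qed.

(** Turns both claims about the ideal into identities after applying [gproj]. *)
Lemma idealP F : idealI (redP A) F <-> gproj A (B := B) F = 0.
Proof.
have WE N (h : nat -> series B) : \sum_(k < N) h k * iter k (@sdvw K) (sv K - incl (redP A))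
    = \sum_(k < N) h k * iter k (sdd (A := B) vw_next) (Wgen A B).
  by rewrite sdvwE.
split=> [idF|/proj_in_ideal idF n].
  apply: (@in_ideal_proj K A B) => n; have [N [h FE]] := idF n.
  pose S := \sum_(k < N) h k * iter k (sdd (A := B) vw_next) (Wgen A B).
  have S0 i : (i < n)%N -> scoef (F - S) i = 0.
    by move=> lt_in; rewrite scoefB (FE i lt_in) WE subrr.
  by exists N, h, (sdrop n (F - S)); rewrite -(sdropP S0) addrC subrK.
have [N [h [G FE]]] := idF n; exists N, h => i lt_in.
by rewrite WE FE scoefD scoef_epsXM lt_in addr0.
Qed.

Lemma rescaleE c f : rescale c f = grescale (A := A) c f.
Proof.
have e : (fun k : nat => c *: (pX k : R0 K)) = (fun k => @cC _ _ A c * fa_X A k).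
  by apply/funext => k; exact/esym/mul_malgC.
apply: etrans (esym (mul_malgC _ _)) _.
exact: (congr1 (fun x : nat -> A => @cC _ _ A c^-1 * psubst (@pC K nat) x f) e).
Qed.

Lemma toda_kdv_deformation :
  exists D : nat -> series (Rvw K) -> series (Rvw K),
  (forall k, (0 < k)%N -> is_calD (todaP _ k) (todaQ _ k) (D k)) /\
  exists P : series (R0 K),
  (forall k, (0 < k)%N -> forall F, idealI P F -> idealI P (D k F)) /\
  exists bD : nat -> series (R0 K),
  (forall k, (0 < k)%N -> forall f,
     idealI P (D k (incl f) - incl (sevol0 (bD k) f))) /\
  forall L0 : nat -> R0 K, KdV_hierarchy L0 ->
  exists L : nat -> series (R0 K),
    [/\ forall k, (0 < k)%N -> laurent_comb bD (L k),
        forall j k, (0 < j)%N -> (0 < k)%N -> sbracket0 (L j) (L k) = 0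
      & forall k, (0 < k)%N -> at_eps0 (L k) = rescale 12%:R (L0 k)].
Proof.
exists (@calD K B C); split=> [k _|]; first exact: calD_is_calD.
exists (redP A); split=> [k _ F /idealP F0|].
  by apply/idealP; rewrite gproj_calD F0 raddf0.
exists (@redflow K A); split=> [k _ f|L0 [L01 L0C _]].
  by apply/idealP; exact: (@proj_calD_incl K A B C k f).
(* The bracket with the first member, the KdV element, becomes after rescaling the symmetry equation
   with factor 12. *)
have sym k : (0 < k)%N -> kdv_symmetry 12%:R (rescale 12%:R (L0 k) : A).
  have nz : 12%:R != 0 :> K by rewrite pnatr_eq0.
  move=> k0; have := L0C 1%N k isT k0; rewrite L01 rescaleE.
  exact: (@rescale_symmetry K A 12%:R nz (L0 k)).
(* The series 0 at k = 0 is a dummy; [choice] asks for a witness at every k. *)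
have exL k : exists L : series A, (0 < k)%N ->
    lcomb (@redflow K A) L /\ scoef L 0 = rescale 12%:R (L0 k).
  by case: k => [|k]; [exists 0|have [L LP] := kdv_symmetry_deformation (sym k.+1 isT); exists L].
have [L LP] := choice exL; exists L; split=> [k k0|j k j0 k0|k k0].
- by have [] := LP k k0.
- have [[cj _] [ck _]] := (LP j j0, LP k k0).
  exact: (@lcombs_commute K A _ _ cj ck).
by have [] := LP k k0.
Qed.

End Transfer.

Theorem theorem1p1 (R : realType) :
  exists D : nat -> series (Rvw R[i]) -> series (Rvw R[i]),
  (forall k, (0 < k)%N -> is_calD (todaP _ k) (todaQ _ k) (D k)) /\
  exists P : series (R0 R[i]),
  (forall k, (0 < k)%N -> forall F, idealI P F -> idealI P (D k F)) /\
  exists bD : nat -> series (R0 R[i]),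
  (forall k, (0 < k)%N -> forall f,
     idealI P (D k (incl f) - incl (sevol0 (bD k) f))) /\
  forall K : nat -> R0 R[i], KdV_hierarchy K ->
  exists L : nat -> series (R0 R[i]),
    [/\ forall k, (0 < k)%N -> laurent_comb bD (L k),
        forall j k, (0 < j)%N -> (0 < k)%N -> sbracket0 (L j) (L k) = 0
      & forall k, (0 < k)%N -> at_eps0 (L k) = rescale 12%:R (K k)].
Proof. exact: toda_kdv_deformation. Qed.
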